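(* Let $f$ be a $C^1$ symplectic twist diffeomorphism of $\mathbb A=\mathbb T\times\mathbb R$ and let $u:\mathbb T\times\mathbb R\to\mathbb R$ be a continuous map such that $u(0,c)=0$ for all $c$ and each $u_c=u(\cdot,c)$ is a weak K.A.M. solution for the cohomology class $c$. The following are equivalent: (1) $f$ is $C^0$-integrable; (2) the map $u$ is $C^1$. Moreover, in this case, $u$ is unique and for every $c\in\mathbb R$: - the graph of $c+u_c'$ is a leaf of the invariant foliation; - $h_c:\theta\mapsto\theta+\frac{\partial u}{\partial c}(\theta,c)$ is a semi-conjugation between the projected dynamics $g_c:\theta\mapsto\pi_1\circ f\big(\theta,c+\frac{\partial u}{\partial\theta}(\theta,c)\big)$ and a rotation $R$ of $\mathbb T$, i.e. $h_c\circ g_c=R\circ h_c$.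
   Context: $\mathbb T=\mathbb R/\mathbb Z$, $\mathbb A=\mathbb T\times\mathbb R$ with coordinates $(\theta,r)$, $\pi_1(\theta,r)=\theta$. Symplectic twist map (or diffeomorphism): a $C^1$ diffeomorphism $f:\mathbb A\to\mathbb A$ that is isotopic to the identity; exact symplectic, i.e. if $f(\theta,r)=(\Theta,R)$ then the 1-form $R\,d\Theta-r\,d\theta$ is exact; and has the twist property: for any lift $F=(F_1,F_2):\mathbb R^2\to\mathbb R^2$ of $f$ and any $\tilde\theta\in\mathbb R$, the map $r\mapsto F_1(\tilde\theta,r)$ is an increasing $C^1$ diffeomorphism from $\mathbb R$ onto $\mathbb R$. Generating function: fix a lift $F$ of $f$. A $C^2$ function $S:\mathbb R^2\to\mathbb R$ is a generating function of $F$ if $S(\theta+1,\Theta+1)=S(\theta,\Theta)$; $S(\theta,\Theta)/|\Theta-\theta|\to+\infty$ as $|\Theta-\theta|\to\infty$; for all $\theta_0,\Theta_0$ the maps $\theta\mapsto\frac{\partial S}{\partial\Theta}(\theta,\Theta_0)$ and $\Theta\mapsto\frac{\partial S}{\partial\theta}(\theta_0,\Theta)$ are decreasing diffeomorphisms of $\mathbb R$; and $F(\theta,r)=(\Theta,R)\Leftrightarrow r=-\frac{\partial S}{\partial\theta}(\theta,\Theta)$ and $R=\frac{\partial S}{\partial\Theta}(\theta,\Theta)$. Fix such an $S$. Weak K.A.M. solutions: for $c\in\mathbb R$ there is a unique $\alpha(c)\in\mathbb R$ for which there exists $u\in C^0(\mathbb T,\mathbb R)$ whose lift $\tilde u:\mathbb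 R\to\mathbb R$ satisfies, for all $\theta\in\mathbb R$, $\tilde u(\theta)=\inf_{\theta'\in\mathbb R}\big(\tilde u(\theta')+S(\theta',\theta)+c(\theta'-\theta)+\alpha(c)\big)$. Any such $u$ is a weak K.A.M. solution for the cohomology class $c$. $f$ is $C^0$-integrable if $\mathbb A$ is $C^0$-foliated by $C^0$ invariant graphs: there is a family $(\eta_a)_{a\in\mathbb R}$ in $C^0(\mathbb T,\mathbb R)$ such that $(\theta,a)\mapsto(\theta,\eta_a(\theta))$ is a homeomorphism of $\mathbb A$ and the graph of each $\eta_a$ is invariant by $f$. *)

(* Defs.v *)
From Stdlib Require Import Reals ZArith Lra.
From Coquelicot Require Import Coquelicot.
Open Scope R_scope.

(* Each class of [R/Z] is represented by its element of [0,1). *)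
Record circle : Type := Circle { repr : R; repr_bound : 0 <= repr < 1 }.

Lemma frac_part_bound (x : R) : 0 <= frac_part x < 1.
Proof. destruct (base_fp x); lra. Qed.

Definition proj (x : R) : circle := Circle (frac_part x) (frac_part_bound x).

Definition rot (rho : R) (t : circle) : circle := proj (repr t + rho).

(* The quotient metric of [R/Z]. *)
Definition circle_ball (t : circle) (e : R) (s : circle) : Prop :=
  exists k : Z, Rabs (repr s - repr t - IZR k) < e.

Lemma circle_ball_center (t : circle) (e : posreal) : circle_ball t e t.
Proof.
exists 0%Z. replace (repr t - repr t - IZR 0) with 0 by (simpl; ring).
rewrite Rabs_R0. apply cond_pos.
Qed.

Lemma circle_ball_sym (t s : circle) (e : R) :
  circle_ball t e s -> circle_ball s e t.
Proof.
intros [k Hk]. exists (- k)%Z. rewrite opp_IZR.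
replace (repr t - repr s - - IZR k) with (- (repr s - repr t - IZR k)) by ring.
now rewrite Rabs_Ropp.
Qed.

Lemma circle_ball_triangle (t s r : circle) (e1 e2 : R) :
  circle_ball t e1 s -> circle_ball s e2 r -> circle_ball t (e1 + e2) r.
Proof.
intros [k Hk] [l Hl]. exists (k + l)%Z. rewrite plus_IZR.
replace (repr r - repr t - (IZR k + IZR l))
  with ((repr s - repr t - IZR k) + (repr r - repr s - IZR l)) by ring.
eapply Rle_lt_trans; [apply Rabs_triang | lra].
Qed.

Definition circle_UniformSpace_mixin : UniformSpace.mixin_of circle :=
  UniformSpace.Mixin circle (proj 0) circle_ball
    circle_ball_center circle_ball_sym circle_ball_triangle.

Canonical circle_UniformSpace : UniformSpace :=
  UniformSpace.Pack circle circle_UniformSpace_mixin circle.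

Definition annulus : Type := (circle * R)%type.

Definition projA (x : R * R) : annulus := (proj (fst x), snd x).

Definition C1_R (phi : R -> R) : Prop :=
  (forall x, ex_derive phi x) /\ (forall x, continuous (Derive phi) x).

Definition d1 (G : R * R -> R) (p : R * R) : R :=
  Derive (fun x => G (x, snd p)) (fst p).
Definition d2 (G : R * R -> R) (p : R * R) : R :=
  Derive (fun y => G (fst p, y)) (snd p).

Definition C1_R2 (G : R * R -> R) : Prop :=
  (forall x y, ex_derive (fun x' => G (x', y)) x) /\
  (forall x y, ex_derive (fun y' => G (x, y')) y) /\
  (forall p, continuous (d1 G) p) /\ (forall p, continuous (d2 G) p).

Definition C2_R2 (G : R * R -> R) : Prop :=
  C1_R2 G /\ C1_R2 (d1 G) /\ C1_R2 (d2 G).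

Definition C1_diffeo_R (phi : R -> R) : Prop :=
  C1_R phi /\
  exists psi : R -> R, C1_R psi /\
    (forall x, psi (phi x) = x) /\ (forall y, phi (psi y) = y).

Definition increasing_C1_diffeo (phi : R -> R) : Prop :=
  C1_diffeo_R phi /\ forall x y, x < y -> phi x < phi y.
Definition decreasing_C1_diffeo (phi : R -> R) : Prop :=
  C1_diffeo_R phi /\ forall x y, x < y -> phi y < phi x.

Definition homeomorphism (f : annulus -> annulus) : Prop :=
  (forall x, continuous f x) /\
  exists g : annulus -> annulus, (forall x, continuous g x) /\
    (forall x, g (f x) = x) /\ (forall x, f (g x) = x).

Definition is_lift (f : annulus -> annulus) (F : R * R -> R * R) : Prop :=
  (forall x, continuous F x) /\ (forall x, projA (F x) = f (projA x)).

(* [projA] is the universal covering, hence a local chart of the annulus, and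
   any continuous map of the annulus has a lift. *)
Definition C1_annulus_map (f : annulus -> annulus) : Prop :=
  exists F, is_lift f F /\
    C1_R2 (fun x => fst (F x)) /\ C1_R2 (fun x => snd (F x)).

Definition C1_annulus_diffeo (f : annulus -> annulus) : Prop :=
  C1_annulus_map f /\
  exists g : annulus -> annulus, C1_annulus_map g /\
    (forall x, g (f x) = x) /\ (forall x, f (g x) = x).

Definition C1_annulus_fun (u : annulus -> R) : Prop :=
  C1_R2 (fun x => u (projA x)).

Definition isotopic_to_id (f : annulus -> annulus) : Prop :=
  exists H : R * annulus -> annulus,
    continuous_on (fun p : R * annulus => 0 <= fst p <= 1) H /\
    (forall t, 0 <= t <= 1 -> homeomorphism (fun x => H (t, x))) /\
    (forall x, H (0, x) = x) /\ (forall x, H (1, x) = f x).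

(* The 1-form [R dTheta - r dtheta] has a primitive [s] on the annulus; the
   form does not depend on the lift. *)
Definition exact_symplectic (f : annulus -> annulus) : Prop :=
  forall F, is_lift f F ->
  exists s : annulus -> R, forall theta r,
    is_derive (fun x => s (projA (x, r))) theta
      (snd (F (theta, r)) * d1 (fun p => fst (F p)) (theta, r) - r) /\
    is_derive (fun y => s (projA (theta, y))) r
      (snd (F (theta, r)) * d2 (fun p => fst (F p)) (theta, r)).

Definition twist (f : annulus -> annulus) : Prop :=
  forall F, is_lift f F ->
  forall theta, increasing_C1_diffeo (fun r => fst (F (theta, r))).

Definition symplectic_twist_diffeo (f : annulus -> annulus) : Prop :=
  C1_annulus_diffeo f /\ isotopic_to_id f /\ exact_symplectic f /\ twist f.

Definition generating_function (F : R * R -> R * R) (S : R * R -> R) : Prop :=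
  C2_R2 S /\
  (forall theta Theta, S (theta + 1, Theta + 1) = S (theta, Theta)) /\
  (forall M, exists K, forall theta Theta,
     K < Rabs (Theta - theta) -> M < S (theta, Theta) / Rabs (Theta - theta)) /\
  (forall Theta0, decreasing_C1_diffeo (fun theta => d2 S (theta, Theta0))) /\
  (forall theta0, decreasing_C1_diffeo (fun Theta => d1 S (theta0, Theta))) /\
  (forall theta r Theta R',
     F (theta, r) = (Theta, R') <->
     r = - d1 S (theta, Theta) /\ R' = d2 S (theta, Theta)).

Definition weak_kam_equation (S : R * R -> R) (c a : R) (u : circle -> R) : Prop :=
  forall theta,
    is_glb_Rbar
      (fun y => exists theta', y =
         u (proj theta') + S (theta', theta) + c * (theta' - theta) + a)
      (Finite (u (proj theta))).

(* The constant [a] is not a choice: for each [c] the equation has a continuous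
   solution for exactly one [a], which is alpha(c). *)
Definition weak_kam_solution (S : R * R -> R) (c : R) (u : circle -> R) : Prop :=
  (forall t, continuous u t) /\ exists a, weak_kam_equation S c a u.

Definition weak_kam_family (S : R * R -> R) (u : annulus -> R) : Prop :=
  (forall x, continuous u x) /\
  (forall c, u (proj 0, c) = 0) /\
  (forall c, weak_kam_solution S c (fun t => u (t, c))).

Definition graph (eta : circle -> R) (x : annulus) : Prop :=
  snd x = eta (fst x).

Definition invariant (f : annulus -> annulus) (G : annulus -> Prop) : Prop :=
  forall y, G y <-> exists x, G x /\ f x = y.

Definition invariant_foliation (f : annulus -> annulus)
    (eta : R -> circle -> R) : Prop :=
  (forall a t, continuous (eta a) t) /\
  homeomorphism (fun x => (fst x, eta (snd x) (fst x))) /\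
  (forall a, invariant f (graph (eta a))).

Definition C0_integrable (f : annulus -> annulus) : Prop :=
  exists eta, invariant_foliation f eta.

Definition leaf (eta : R -> circle -> R) (G : annulus -> Prop) : Prop :=
  exists a, forall x, G x <-> graph (eta a) x.

Definition du_dtheta (u : annulus -> R) (x : annulus) : R :=
  d1 (fun p => u (projA p)) (repr (fst x), snd x).
Definition du_dc (u : annulus -> R) (x : annulus) : R :=
  Derive (fun c => u (fst x, c)) (snd x).

Definition projected_dynamics (f : annulus -> annulus) (u : annulus -> R)
    (c : R) (t : circle) : circle :=
  fst (f (t, c + du_dtheta u (t, c))).

Definition h_map (u : annulus -> R) (c : R) (t : circle) : circle :=
  rot (du_dc u (t, c)) t.

(* Main.v *)
(* Write [P_c(x) = u_c(x) + c x], [E_c = P_c'] for the leaf and [g_c] for the lift of the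
   dynamics projected from it. Comparing the calibrations of two parameters along an orbit
   gives, for [D = P_c' - P_c],
     [D(g_c x) <= D(x) + alpha(c') - alpha(c)],
   with equality at [x] only if the leaves [c] and [c'] meet over [x].

   From a C0 foliation: leaves are calibrated, and those made of periodic points are dense
   and carry a unique solution, so by continuity [P_c] comes from [u]. To differentiate
   [P_c] in [c] one counts steps of a small iterate [G = g_c^m + j]: each of them increases
   [D] by almost the same amount. On a leaf without periodic points, [G] can be chosen
   arbitrarily close to a small rotation. On a leaf [c0] with [g^q = id + p], the map
   [g_c^q - p] moves [x] by about [T_r(x) (E_c(x) - E_c0(x))], where [T_r > 0] is the
   vertical derivative of [F^q]; an action estimate then shows that the step count from 0
   to [x] is proportional to the integral of [1 / sqrt(T_r)].

   From a C1 map [u]: [h_c(x) = x + du/dc] satisfies [h_c(g_c x) = h_c(x) + alpha'(c)]. If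
   two leaves meet they have the same rotation number and [alpha] is affine between them.
   Without periodic points [D - (c' - c) h_c] is then constant; with periodic points the
   [h_c''], for [c''] between [c] and [c'], are constant on the gaps between these points.
   In both cases the two leaves coincide, hence [c = c']. *)
From Stdlib Require Import Reals ZArith Lra Lia.
From Stdlib Require Import Classical IndefiniteDescription ProofIrrelevance.
From Coquelicot Require Import Coquelicot.
Require Import Defs.
Open Scope R_scope.

(** * Real analysis *)

(** The leaves are merely continuous in both variables, so the dynamics on them cannot be linearised
    in c. All quantitative information comes from comparing actions, which yields inequalities only,
    and every limit is squeezed between two of them. The square root has the following origin. Near
    a leaf of type p/q, the relative action of a jump from x to y is about (I(y) - I(x))^2 / 2,
    where I' = 1 / sqrt(T_r) on the leaf: in the coordinate I the q-th iterate looks like a free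
    particle, whose generating function is (Y - X)^2 / 2. A neighbouring leaf with action drift s
    then advances I by about a = sqrt(2 s) per step, and P_c - P_c0 is close to a I. As this
    difference equals c - c0 at 1, the slope in c is I(x) / I(1). A derivative at each single leaf
    would not make u of class C1: one common value has to control the difference quotients based at
    all leaves close to the given one. *)

Ltac min_bounds m :=
  lazymatch m with
  | Rmin ?a ?b =>
      let Hl := fresh "Hmin" in let Hr := fresh "Hmin" in
      pose proof (Rmin_l a b) as Hl; pose proof (Rmin_r a b) as Hr;
      min_bounds a; min_bounds b
  | _ => idtac
  end.

Ltac abs_lra :=
  repeat match goal with
  | H : Rabs _ < _ |- _ => apply Rabs_def2 in H
  | H : Rabs _ <= _ |- _ => apply Rabs_le_between in H
  end;
  try apply Rabs_def1; try apply Rabs_le; lra.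

Lemma continuous_eps (f : R -> R) (x : R) :
  continuous f x <->
  forall e, 0 < e -> exists d, 0 < d /\
    forall y, Rabs (y - x) < d -> Rabs (f y - f x) < e.
Proof.
split.
- intros H e He.
  assert (HP : locally (f x) (fun z => Rabs (z - f x) < e)).
  { exists (mkposreal e He). now intros z. }
  destruct (H _ HP) as [d Hd].
  exists d; split; [apply cond_pos | intros y Hy; apply (Hd y Hy)].
- intros H; apply filterlim_locally; intros e.
  destruct (H e (cond_pos e)) as [d [Hd H1]].
  exists (mkposreal d Hd); intros y Hy; apply (H1 y Hy).
Qed.

Lemma continuous_pt (f : R -> R) (x : R) : continuous f x -> continuity_pt f x.
Proof. intros H; now apply continuity_pt_filterlim. Qed.

Lemma derive_continuous (f : R -> R) (x l : R) : is_derive f x l -> continuous f x.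
Proof. intros H; apply (ex_derive_continuous (V := R_NormedModule) f x); now exists l. Qed.

Lemma is_derive_eps (f : R -> R) (x l : R) :
  is_derive f x l <->
  forall e, 0 < e -> exists d, 0 < d /\
    forall y, Rabs (y - x) < d -> Rabs (f y - f x - l * (y - x)) <= e * Rabs (y - x).
Proof.
rewrite is_derive_Reals. split.
- intros H e He. destruct (H e He) as [d Hd].
  exists d; split; [apply cond_pos|]. intros y Hy.
  destruct (Req_dec y x) as [->|Hn].
  + replace (f x - f x - l * (x - x)) with 0 by ring.
    replace (x - x) with 0 by ring. rewrite !Rabs_R0. lra.
  + assert (Hn' : y - x <> 0) by lra.
    specialize (Hd (y - x) Hn' Hy). replace (x + (y - x)) with y in Hd by ring.
    replace (f y - f x - l * (y - x)) with (((f y - f x) / (y - x) - l) * (y - x))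
      by (field; auto).
    rewrite Rabs_mult. apply Rmult_le_compat_r; [apply Rabs_pos | lra].
- intros H e He. assert (He2 : 0 < e / 2) by lra.
  destruct (H (e / 2) He2) as [d [Hd H1]]. exists (mkposreal d Hd). simpl.
  intros h Hh Hhd. specialize (H1 (x + h)). replace (x + h - x) with h in H1 by ring.
  specialize (H1 Hhd).
  replace ((f (x + h) - f x) / h - l) with ((f (x + h) - f x - l * h) / h) by (field; auto).
  unfold Rdiv. rewrite Rabs_mult, Rabs_inv.
  assert (0 < Rabs h) by now apply Rabs_pos_lt.
  apply Rle_lt_trans with (e / 2); [|lra].
  apply Rmult_le_reg_r with (Rabs h); auto.
  rewrite Rmult_assoc, Rinv_l; lra.
Qed.

Lemma ivt (f : R -> R) (a b y : R) :
  (forall x, continuous f x) -> a <= b -> f a <= y <= f b ->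
  exists x, a <= x <= b /\ f x = y.
Proof.
intros Hc Hab Hy.
destruct (IVT_gen f a b y) as [x [Hx Hf]].
- intros x; now apply continuous_pt.
- rewrite Rmin_left, Rmax_right; lra.
- rewrite Rmin_left, Rmax_right in Hx by lra. now exists x.
Qed.

Lemma mean_value (f df : R -> R) (a b : R) :
  (forall x, is_derive f x (df x)) -> a <= b ->
  exists c, a <= c <= b /\ f b - f a = df c * (b - a).
Proof.
intros Hd Hab. destruct (MVT_gen f a b df) as [c [Hc Hf]].
- intros x _; apply Hd.
- intros x _; apply continuous_pt, derive_continuous with (1 := Hd x).
- rewrite Rmin_left, Rmax_right in Hc by lra. now exists c.
Qed.

Lemma derive_nonneg_le (f df : R -> R) (a b : R) :
  (forall x, is_derive f x (df x)) -> a <= b ->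
  (forall x, a <= x <= b -> 0 <= df x) -> f a <= f b.
Proof.
intros Hd Hab Hp. destruct (mean_value f df a b Hd Hab) as [c [Hc He]].
specialize (Hp c Hc). nra.
Qed.

Lemma derive_zero_const (f : R -> R) (x y : R) :
  (forall x, is_derive f x 0) -> f x = f y.
Proof.
intros Hd.
assert (H : forall a b, a <= b -> f a = f b).
{ intros a b Hab. destruct (mean_value f (fun _ => 0) a b Hd Hab) as [c [_ H]]. lra. }
destruct (Rle_dec x y); [now apply H | symmetry; apply H; lra].
Qed.

Lemma incr_derive_nonneg (phi : R -> R) (x l : R) : is_derive phi x l ->
  (forall y, x < y -> phi x <= phi y) -> 0 <= l.
Proof.
intros D Hm. apply Rnot_lt_le; intros h.
destruct (proj1 (is_derive_eps _ _ _) D (- l / 2) ltac:(lra)) as [d [Hd K]].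
specialize (K (x + d / 2)). replace (x + d / 2 - x) with (d / 2) in K by ring.
rewrite (Rabs_right (d / 2)) in K by lra. specialize (K ltac:(lra)).
apply Rabs_le_between in K. specialize (Hm (x + d / 2) ltac:(lra)). nra.
Qed.

Lemma strict_mono_inj (f : R -> R) (x y : R) :
  (forall x y, x < y -> f x < f y) -> f x = f y -> x = y.
Proof.
intros Hf H. destruct (Rtotal_order x y) as [h|[h|h]]; auto; apply Hf in h; lra.
Qed.

Lemma strict_mono_lt (f : R -> R) (x y : R) :
  (forall x y, x < y -> f x < f y) -> f x < f y -> x < y.
Proof.
intros Hf H. destruct (Rtotal_order x y) as [h|[->|h]]; [exact h|lra|apply Hf in h; lra].
Qed.

Lemma ab_max (f : R -> R) (a b : R) :
  (forall x, continuous f x) -> a <= b ->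
  exists x, a <= x <= b /\ forall y, a <= y <= b -> f y <= f x.
Proof.
intros Hc Hab. destruct (continuity_ab_maj f a b Hab) as [x [H1 H2]].
- intros c _; now apply continuous_pt.
- now exists x.
Qed.

Lemma ab_min (f : R -> R) (a b : R) :
  (forall x, continuous f x) -> a <= b ->
  exists x, a <= x <= b /\ forall y, a <= y <= b -> f x <= f y.
Proof.
intros Hc Hab. destruct (ab_max (fun x => - f x) a b) as [x [Hx H]]; auto.
- intros x; apply (continuous_opp f x), Hc.
- exists x; split; auto. intros y Hy; specialize (H y Hy); lra.
Qed.

(** A Lebesgue number argument for a property inherited by smaller radii. The compactness statement
    behind it provides the covering point under a double negation, hence the argument by
    contradiction. *)
Lemma compact_uniform (A : R -> R -> Prop) (a b : R) :
  (forall x d d', A x d -> 0 < d' <= d -> A x d') ->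
  (forall x, a <= x <= b ->
     exists d, 0 < d /\ forall y, Rabs (y - x) < d -> A y d) ->
  exists d, 0 < d /\ forall x, a <= x <= b -> A x d.
Proof.
intros Hm Hl.
assert (Hc : forall x, exists d : posreal,
          a <= x <= b -> forall y, Rabs (y - x) < d -> A y d).
{ intros x. destruct (classic (a <= x <= b)) as [Hx|Hx].
  - destruct (Hl x Hx) as [d [Hd H]]. now exists (mkposreal d Hd).
  - exists (mkposreal 1 Rlt_0_1). tauto. }
destruct (functional_choice _ Hc) as [delta Hdelta].
destruct (compactness_value_1d a b delta) as [d Hd].
exists d; split; [apply cond_pos|]. intros x Hx.
apply NNPP; intros Hn. apply (Hd x Hx). intros [t [Ht [H1 H2]]]. apply Hn.
apply Hm with (delta t).
- exact (Hdelta t Ht x H1).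
- split; [apply cond_pos | exact H2].
Qed.

(* Continuity of the root in the second variable only needs continuity of [G]
   in the first one. *)
Lemma implicit_continuous {U : UniformSpace} (G : U -> R -> R) (b : U -> R) (x0 : U) :
  (forall y, continuous (fun x => G x y) x0) ->
  (forall x y y', y < y' -> G x y < G x y') ->
  (forall x, G x (b x) = 0) ->
  continuous b x0.
Proof.
intros Hc Hm Hb. apply filterlim_locally; intros e.
assert (He := cond_pos e).
assert (H1 : G x0 (b x0 - e) < 0) by (rewrite <- (Hb x0); apply Hm; lra).
assert (H2 : 0 < G x0 (b x0 + e)) by (rewrite <- (Hb x0); apply Hm; lra).
assert (L1 : locally x0 (fun x => G x (b x0 - e) < 0)).
{ apply (Hc (b x0 - e) (fun z => z < 0)). now apply open_lt. }
assert (L2 : locally x0 (fun x => 0 < G x (b x0 + e))).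
{ apply (Hc (b x0 + e) (fun z => 0 < z)). now apply open_gt. }
generalize (filter_and _ _ L1 L2). apply filter_imp. intros x [K1 K2].
change (Rabs (b x - b x0) < e). apply Rabs_def1.
- destruct (Rlt_dec (b x - b x0) e) as [h|h]; auto.
  destruct (Rle_lt_or_eq_dec (b x0 + e) (b x)) as [h'|h']; [lra| |].
  + specialize (Hm x _ _ h'). rewrite Hb in Hm. lra.
  + rewrite h', Hb in K2. lra.
- destruct (Rlt_dec (- e) (b x - b x0)) as [h|h]; auto.
  destruct (Rle_lt_or_eq_dec (b x) (b x0 - e)) as [h'|h']; [lra| |].
  + specialize (Hm x _ _ h'). rewrite Hb in Hm. lra.
  + rewrite <- h', Hb in K1. lra.
Qed.

(** * Joint continuity of functions of two real variables *)

Definition cont2 (f : R -> R -> R) : Prop := forall x y, continuity_2d_pt f x y.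

Lemma cont2_eps (f : R -> R -> R) (x y e : R) : cont2 f -> 0 < e ->
  exists d, 0 < d /\ forall u v, Rabs (u - x) < d -> Rabs (v - y) < d ->
    Rabs (f u v - f x y) < e.
Proof.
intros Hf He. destruct (Hf x y (mkposreal e He)) as [d Hd].
exists d; split; [apply cond_pos | exact Hd].
Qed.

Lemma cont2_continuous (f : R -> R -> R) :
  cont2 f <-> forall p : R * R, continuous (fun q => f (fst q) (snd q)) p.
Proof.
split; intros H.
- intros [x y]. apply (proj1 (continuity_2d_pt_filterlim f x y)), H.
- intros x y. apply (proj2 (continuity_2d_pt_filterlim f x y)), (H (x, y)).
Qed.

Lemma cont2_comp {U : UniformSpace} (f : R -> R -> R) (a b : U -> R) (t : U) :
  cont2 f -> continuous a t -> continuous b t ->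
  continuous (fun s => f (a s) (b s)) t.
Proof.
intros Hf Ha Hb. apply (continuous_comp_2 a b f t Ha Hb).
apply (proj1 (cont2_continuous f) Hf (a t, b t)).
Qed.

Lemma cont2_comp2 (f a b : R -> R -> R) :
  cont2 f -> cont2 a -> cont2 b -> cont2 (fun x y => f (a x y) (b x y)).
Proof.
intros Hf Ha Hb. apply cont2_continuous. intros p.
apply (cont2_comp f (fun q : R * R => a (fst q) (snd q))
  (fun q : R * R => b (fst q) (snd q)) p Hf); now apply cont2_continuous.
Qed.

Lemma cont2_left (f : R -> R -> R) (x y : R) : cont2 f -> continuous (fun s => f s y) x.
Proof.
intros Hf. apply (cont2_comp f (fun s => s) (fun _ => y)); auto.
apply continuous_id. apply continuous_const.
Qed.

Lemma cont2_right (f : R -> R -> R) (x y : R) : cont2 f -> continuous (f x) y.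
Proof.
intros Hf. apply (cont2_comp f (fun _ => x) (fun s => s)); auto.
apply continuous_const. apply continuous_id.
Qed.

Lemma cont2_fst : cont2 (fun x _ => x).
Proof. intros x y; apply continuity_2d_pt_id1. Qed.

Lemma cont2_snd : cont2 (fun _ y => y).
Proof. intros x y; apply continuity_2d_pt_id2. Qed.

Lemma cont2_const (k : R) : cont2 (fun _ _ => k).
Proof. intros x y; apply continuity_2d_pt_const. Qed.

Lemma cont2_plus (f g : R -> R -> R) :
  cont2 f -> cont2 g -> cont2 (fun x y => f x y + g x y).
Proof. intros Hf Hg x y; now apply continuity_2d_pt_plus. Qed.

Lemma cont2_minus (f g : R -> R -> R) :
  cont2 f -> cont2 g -> cont2 (fun x y => f x y - g x y).
Proof. intros Hf Hg x y; now apply continuity_2d_pt_minus. Qed.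

Lemma cont2_mult (f g : R -> R -> R) :
  cont2 f -> cont2 g -> cont2 (fun x y => f x y * g x y).
Proof. intros Hf Hg x y; now apply continuity_2d_pt_mult. Qed.

Lemma cont2_opp (f : R -> R -> R) : cont2 f -> cont2 (fun x y => - f x y).
Proof. intros Hf x y; now apply continuity_2d_pt_opp. Qed.

Lemma cont2_ext (f g : R -> R -> R) : (forall x y, f x y = g x y) -> cont2 f -> cont2 g.
Proof. intros He Hf x y; now apply continuity_2d_pt_ext with (1 := He). Qed.

Lemma cont2_swap (f : R -> R -> R) : cont2 f -> cont2 (fun x y => f y x).
Proof.
intros Hf. exact (cont2_comp2 f (fun _ y => y) (fun x _ => x) Hf cont2_snd cont2_fst).
Qed.

Lemma cont2_of_1 (f : R -> R) (a : R -> R -> R) :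
  (forall x, continuous f x) -> cont2 a -> cont2 (fun x y => f (a x y)).
Proof.
intros Hf Ha x y. apply continuity_1d_2d_pt_comp; [now apply continuous_pt | apply Ha].
Qed.

(* Only one-sided information is used: each [Psi (C t)] is a C1 minorant of [w]
   touching it at [t], and moving the touching point exchanges the two bounds. *)
Lemma envelope (Psi dPsi : R -> R -> R) (C w : R -> R) (t0 : R) :
  (forall c t, is_derive (Psi c) t (dPsi c t)) -> cont2 dPsi ->
  continuous C t0 ->
  (forall t, w t = Psi (C t) t) ->
  (forall t t', Psi (C t) t' <= w t') ->
  is_derive w t0 (dPsi (C t0) t0).
Proof.
intros Hd Hc HC Hw Hle. apply is_derive_eps. intros e He.
destruct (cont2_eps dPsi (C t0) t0 e Hc He) as [d [Hd0 H1]].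
destruct (proj1 (continuous_eps C t0) HC d Hd0) as [d' [Hd' H2]].
exists (Rmin d d'). split; [now apply Rmin_pos|]. intros t Ht.
assert (Ht1 : Rabs (t - t0) < d) by (eapply Rlt_le_trans; [exact Ht | apply Rmin_l]).
assert (Ht2 : Rabs (t - t0) < d') by (eapply Rlt_le_trans; [exact Ht | apply Rmin_r]).
assert (K : forall c, Rabs (c - C t0) < d ->
  Rabs (Psi c t - Psi c t0 - dPsi (C t0) t0 * (t - t0)) <= e * Rabs (t - t0)).
{ intros c Hcd.
  destruct (MVT_gen (Psi c) t0 t (dPsi c)) as [x [Hx Hm]].
  - intros x _; apply Hd.
  - intros x _; apply continuous_pt, derive_continuous with (1 := Hd c x).
  - rewrite Hm. replace (dPsi c x * (t - t0) - dPsi (C t0) t0 * (t - t0))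
      with ((dPsi c x - dPsi (C t0) t0) * (t - t0)) by ring.
    rewrite Rabs_mult. apply Rmult_le_compat_r; [apply Rabs_pos|].
    left. apply H1; auto. apply Rle_lt_trans with (2 := Ht1).
    unfold Rmin, Rmax in Hx. destruct (Rle_dec t0 t); unfold Rabs;
    destruct (Rcase_abs (x - t0)), (Rcase_abs (t - t0)); lra. }
assert (K0 := K (C t0)). assert (K1 := K (C t) (H2 t Ht2)).
replace (C t0 - C t0) with 0 in K0 by ring. rewrite Rabs_R0 in K0. specialize (K0 Hd0).
assert (L1 := Hle t0 t). assert (L2 := Hle t t0).
assert (E1 := Hw t0). assert (E2 := Hw t).
apply Rabs_le_between in K0. apply Rabs_le_between in K1. apply Rabs_le_between. lra.
Qed.

Lemma frac_part_bounds (x : R) : 0 <= x - IZR (Int_part x) < 1.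
Proof. destruct (base_Int_part x). lra. Qed.

(* Bolzano-Weierstrass for the fractional parts. *)
Lemma close_mod_one (f : nat -> R) (e : R) : 0 < e ->
  exists n m p, (n < m)%nat /\ Rabs (f m - f n - IZR p) < e.
Proof.
intros He.
destruct (Bolzano_Weierstrass (fun n => f n - IZR (Int_part (f n)))
  (fun x => 0 <= x <= 1)) as [l Hl].
- apply compact_P3.
- intros n. destruct (frac_part_bounds (f n)). lra.
- assert (He2 : 0 < e / 2) by lra.
  assert (HV : neighbourhood (disc l (mkposreal _ He2)) l).
  { exists (mkposreal _ He2). now intros x. }
  destruct (Hl _ O HV) as [n [_ Hn]].
  destruct (Hl _ (S n) HV) as [m [Hm Hm']].
  exists n, m, (Int_part (f m) - Int_part (f n))%Z. split; [lia|].
  unfold disc in Hn, Hm'. simpl in Hn, Hm'. rewrite minus_IZR.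
  apply Rabs_def2 in Hn. apply Rabs_def2 in Hm'. abs_lra.
Qed.

Lemma archimed_nat (x : R) : exists n : nat, x < INR n.
Proof.
destruct (INR_archimed 1 x Rlt_0_1) as [n Hn]. exists n. lra.
Qed.

Lemma no_drift (a b : R) : (forall n : nat, INR n * a <= b) -> a <= 0.
Proof.
intros H. apply Rnot_lt_le; intros h.
destruct (INR_archimed a b) as [n Hn]; [lra|]. specialize (H n). lra.
Qed.

Lemma IVT_sign (f : R -> R) : (forall x, continuous f x) -> (forall x, f x <> 0) ->
  (forall x, 0 < f x) \/ (forall x, f x < 0).
Proof.
intros Hc Hn.
assert (K : forall x y, f x < 0 -> 0 < f y -> False).
{ intros x y Hx Hy. destruct (IVT_gen f x y 0) as [z [_ Hz]].
  - intros t; now apply continuous_pt.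
  - unfold Rmin, Rmax. destruct (Rle_dec (f x) (f y)); lra.
  - now apply (Hn z). }
destruct (Rtotal_order (f 0) 0) as [h|[h|h]].
- right. intros x. destruct (Rtotal_order (f x) 0) as [k|[k|k]]; auto.
  + now destruct (Hn x). + now destruct (K 0 x).
- now destruct (Hn 0).
- left. intros x. destruct (Rtotal_order (f x) 0) as [k|[k|k]]; auto.
  + now destruct (K x 0). + now destruct (Hn x).
Qed.

Lemma primitive (f : R -> R) : (forall x, continuous f x) ->
  exists F, F 0 = 0 /\ forall x, is_derive F x (f x).
Proof.
intros Hf. exists (fun x => RInt f 0 x). split; [exact (RInt_point (V := R_CompleteNormedModule) 0 f)|].
intros x. apply (is_derive_RInt f _ 0); auto.
exists (mkposreal 1 Rlt_0_1). intros y _.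
apply (RInt_correct (V := R_CompleteNormedModule)), (ex_RInt_continuous (V := R_CompleteNormedModule)). intros z _. apply Hf.
Qed.

(** The mean value theorem bounds [Q a t - Q a0 t] by the values of [E a - E a0] on [0,1], which
    compactness makes uniformly small. *)
Lemma primitive_param_continuous (E Q : R -> R -> R) (a0 t : R) :
  cont2 E -> (forall a, Q a 0 = 0) -> (forall a x, is_derive (Q a) x (E a x)) ->
  0 <= t <= 1 -> continuous (fun a => Q a t) a0.
Proof.
intros HE HQ0 HQ Ht. apply continuous_eps. intros e He.
destruct (compact_uniform (fun x d => forall a, Rabs (a - a0) < d ->
  Rabs (E a x - E a0 x) < e) 0 1) as [d [Hd H]].
- intros x d d' H Hd a Ha. apply H. lra.
- intros x0 _. destruct (cont2_eps E a0 x0 (e / 2) HE ltac:(lra)) as [d [Hd H]].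
  exists d. split; auto. intros x Hx a Ha.
  assert (A := H a x Ha Hx). assert (B := H a0 x). rewrite Rminus_diag, Rabs_R0 in B.
  specialize (B Hd Hx). abs_lra.
- exists d. split; [exact Hd|]. intros a Ha.
  destruct (mean_value (fun x => Q a x - Q a0 x) (fun x => E a x - E a0 x) 0 t) as [x [Hx Ex]].
  + intros x. apply (is_derive_minus (Q a) (Q a0)); apply HQ.
  + lra.
  + rewrite !HQ0 in Ex. replace (Q a t - Q a0 t) with ((E a x - E a0 x) * t) by lra.
    rewrite Rabs_mult, (Rabs_right t) by lra.
    specialize (H x ltac:(lra) a Ha). assert (K := Rabs_pos (E a x - E a0 x)). nra.
Qed.

(** * Lifts of circle homeomorphisms *)

Record circle_lift (g : R -> R) : Prop := {
  cl_incr : forall x y, x < y -> g x < g y;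
  cl_cont : forall x, continuous g x;
  cl_deg : forall x, g (x + 1) = g x + 1 }.

Definition iter (g : R -> R) (n : nat) (x : R) : R := Nat.iter n g x.

Lemma iter_add (g : R -> R) (n m : nat) (x : R) :
  iter g (n + m) x = iter g n (iter g m x).
Proof. apply Nat.iter_add. Qed.

Lemma iter_S_r (g : R -> R) (n : nat) (x : R) : iter g (S n) x = iter g n (g x).
Proof. apply Nat.iter_succ_r. Qed.

Lemma cl_le (g : R -> R) (x y : R) : circle_lift g -> x <= y -> g x <= g y.
Proof.
intros Hg [h| ->]; [left; now apply (cl_incr g Hg) | lra].
Qed.

Lemma shift_INR (g : R -> R) (d : R) : (forall x, g (x + 1) = g x + d) ->
  forall (n : nat) x, g (x + INR n) = g x + INR n * d.
Proof.
intros Hg n. induction n as [|n IH]; intros x.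
- simpl. rewrite Rplus_0_r. ring.
- rewrite S_INR. replace (x + (INR n + 1)) with ((x + INR n) + 1) by ring.
  rewrite Hg, IH. ring.
Qed.

Lemma shift_IZR (g : R -> R) (d : R) : (forall x, g (x + 1) = g x + d) ->
  forall (k : Z) x, g (x + IZR k) = g x + IZR k * d.
Proof.
intros Hg k x. destruct (Z_le_gt_dec 0 k) as [h|h].
- rewrite <- (Z2Nat.id k h), <- INR_IZR_INZ. now apply shift_INR.
- assert (H := shift_INR g d Hg (Z.to_nat (- k)) (x + IZR k)).
  rewrite INR_IZR_INZ, Z2Nat.id, opp_IZR in H by lia.
  replace (x + IZR k + - IZR k) with x in H by ring. lra.
Qed.

Lemma cl_shift (g : R -> R) (k : Z) (x : R) : circle_lift g ->
  g (x + IZR k) = g x + IZR k.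
Proof.
intros Hg. rewrite (shift_IZR g 1 (cl_deg g Hg)). ring.
Qed.

Lemma circle_lift_iter (g : R -> R) (n : nat) : circle_lift g -> circle_lift (iter g n).
Proof.
intros Hg. induction n as [|n IH].
- split; unfold iter; simpl; auto. intros x; apply continuous_id.
- split; unfold iter in *; simpl.
  + intros x y H. apply (cl_incr g Hg), (cl_incr _ IH), H.
  + intros x. apply (continuous_comp (fun y => Nat.iter n g y) g).
    apply (cl_cont _ IH). apply (cl_cont g Hg).
  + intros x. rewrite (cl_deg _ IH). apply (cl_deg g Hg).
Qed.

Definition shifted_iter (g : R -> R) (m : nat) (j : Z) (x : R) : R := iter g m x + IZR j.

Lemma circle_lift_shifted (g : R -> R) (m : nat) (j : Z) :
  circle_lift g -> circle_lift (shifted_iter g m j).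
Proof.
intros Hg. assert (Hm := circle_lift_iter g m Hg). unfold shifted_iter. split.
- intros x y H. apply Rplus_lt_compat_r, (cl_incr _ Hm), H.
- intros x. apply (continuous_plus (iter g m) (fun _ => IZR j)).
  apply (cl_cont _ Hm). apply continuous_const.
- intros x. rewrite (cl_deg _ Hm). ring.
Qed.

Lemma iter_shifted (g : R -> R) (m n : nat) (j : Z) (x : R) : circle_lift g ->
  iter (shifted_iter g m j) n x = iter g (n * m) x + INR n * IZR j.
Proof.
intros Hg. induction n as [|n IH].
- simpl. unfold iter; simpl. ring.
- rewrite S_INR. change (iter (shifted_iter g m j) (S n) x)
    with (shifted_iter g m j (iter (shifted_iter g m j) n x)).
  rewrite IH. unfold shifted_iter.
  replace (INR n * IZR j) with (IZR (Z.of_nat n * j))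
    by (rewrite mult_IZR, <- INR_IZR_INZ; reflexivity).
  rewrite (cl_shift _ _ _ (circle_lift_iter g m Hg)), <- iter_add.
  rewrite mult_IZR, <- INR_IZR_INZ. simpl. ring.
Qed.

Lemma cl_surj (g : R -> R) (y : R) : circle_lift g -> exists x, g x = y.
Proof.
intros Hg. set (k := Int_part (y - g 0)).
destruct (frac_part_bounds (y - g 0)) as [H1 H2]. fold k in H1, H2.
destruct (ivt g (IZR k) (IZR k + 1) y) as [x [_ Hx]].
- apply (cl_cont g Hg).
- lra.
- rewrite (cl_deg g Hg). replace (IZR k) with (0 + IZR k) by ring.
  rewrite (cl_shift g k 0 Hg). lra.
- now exists x.
Qed.

Lemma periodic_IZR (f : R -> R) : (forall x, f (x + 1) = f x) ->
  forall (k : Z) x, f (x + IZR k) = f x.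
Proof.
intros Hf k x. rewrite (shift_IZR f 0); [ring|]. intros y. rewrite Hf. ring.
Qed.

Lemma periodic_shift_unit (f : R -> R) (x : R) : (forall y, f (y + 1) = f y) ->
  exists y, 0 <= y < 1 /\ f y = f x /\ exists k, x = y + IZR k.
Proof.
intros Hf. exists (x - IZR (Int_part x)).
split; [apply frac_part_bounds|]. split.
- rewrite <- (periodic_IZR f Hf (Int_part x)). f_equal. ring.
- exists (Int_part x). ring.
Qed.

Lemma periodic_bounded (f : R -> R) : (forall x, continuous f x) ->
  (forall x, f (x + 1) = f x) -> exists B, 0 < B /\ forall x, Rabs (f x) <= B.
Proof.
intros Hc Hp.
destruct (ab_max f 0 1 Hc Rle_0_1) as [a [_ Ha]].
destruct (ab_min f 0 1 Hc Rle_0_1) as [b [_ Hb]].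
exists (Rabs (f a) + Rabs (f b) + 1). split.
- assert (H1 := Rabs_pos (f a)). assert (H2 := Rabs_pos (f b)). lra.
- intros x. destruct (periodic_shift_unit f x Hp) as [y [Hy [<- _]]].
  assert (Hy' : 0 <= y <= 1) by lra. specialize (Ha y Hy'). specialize (Hb y Hy').
  assert (A1 := Rle_abs (f a)). assert (A2 := Rabs_maj2 (f b)).
  assert (A3 := Rabs_pos (f a)). assert (A4 := Rabs_pos (f b)).
  abs_lra.
Qed.

Lemma periodic_max (f : R -> R) : (forall x, continuous f x) ->
  (forall x, f (x + 1) = f x) -> exists a, forall x, f x <= f a.
Proof.
intros Hc Hp. destruct (ab_max f 0 1 Hc Rle_0_1) as [a [_ Ha]].
exists a. intros x. destruct (periodic_shift_unit f x Hp) as [y [Hy [<- _]]].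
apply Ha. lra.
Qed.

Lemma periodic_min (f : R -> R) : (forall x, continuous f x) ->
  (forall x, f (x + 1) = f x) -> exists a, forall x, f a <= f x.
Proof.
intros Hc Hp. destruct (ab_min f 0 1 Hc Rle_0_1) as [a [_ Ha]].
exists a. intros x. destruct (periodic_shift_unit f x Hp) as [y [Hy [<- _]]].
apply Ha. lra.
Qed.

Lemma cl_displacement_periodic (g : R -> R) : circle_lift g ->
  (forall x, continuous (fun y => g y - y) x) /\
  (forall x, g (x + 1) - (x + 1) = g x - x).
Proof.
intros Hg. split; intros x.
- apply (continuous_minus g (fun y => y)); [apply (cl_cont g Hg) | apply continuous_id].
- rewrite (cl_deg g Hg). ring.
Qed.

(** [y] lies between two consecutive integer translates of [x], and these have the same displacement
    as [x]. *)
Lemma cl_displacement (g : R -> R) (x y : R) : circle_lift g ->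
  Rabs (g y - y - (g x - x)) <= 1.
Proof.
intros Hg. set (k := Int_part (y - x)).
destruct (frac_part_bounds (y - x)) as [H1 H2]. fold k in H1, H2.
assert (K1 : g (x + IZR k) <= g y) by (apply cl_le; auto; lra).
assert (K2 : g y <= g (x + 1 + IZR k)) by (apply cl_le; auto; lra).
rewrite (cl_shift g _ _ Hg) in K1. rewrite (cl_shift g _ _ Hg), (cl_deg g Hg) in K2.
abs_lra.
Qed.

Lemma cl_moves_right (g : R -> R) : circle_lift g -> (forall x, x < g x) ->
  exists d, 0 < d /\ forall x, x + d <= g x.
Proof.
intros Hg H. destruct (cl_displacement_periodic g Hg) as [Hc Hp].
destruct (periodic_min _ Hc Hp) as [a Ha].
exists (g a - a). split; [specialize (H a); lra|].
intros x. specialize (Ha x). simpl in Ha. lra.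
Qed.

Lemma iter_escapes (g : R -> R) (x y : R) : circle_lift g -> (forall z, z < g z) ->
  exists n, y < iter g n x.
Proof.
intros Hg H. destruct (cl_moves_right g Hg H) as [d [Hd Hm]].
assert (K : forall n, x + INR n * d <= iter g n x).
{ induction n as [|n IH]; [unfold iter; simpl; lra|].
  rewrite S_INR. change (iter g (S n) x) with (g (iter g n x)).
  specialize (Hm (iter g n x)). lra. }
destruct (INR_archimed d (y - x) Hd) as [n Hn]. exists n. specialize (K n). lra.
Qed.

Lemma iter_bracket (g : R -> R) (x y : R) : circle_lift g -> (forall z, z < g z) ->
  x <= y -> exists n, iter g n x <= y < iter g (S n) x.
Proof.
intros Hg H Hxy. destruct (iter_escapes g x y Hg H) as [n Hn].
induction n as [|n IH].
- unfold iter in Hn; simpl in Hn. lra.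
- destruct (Rle_dec (iter g n x) y) as [h|h].
  + now exists n.
  + apply IH. lra.
Qed.

Lemma iter_le_mono (g : R -> R) (x : R) (n m : nat) : (forall z, z < g z) ->
  (n <= m)%nat -> iter g n x <= iter g m x.
Proof.
intros H Hnm. induction Hnm as [|m Hm IH]; [lra|].
change (iter g (S m) x) with (g (iter g m x)). specialize (H (iter g m x)). lra.
Qed.

Lemma iter_mul_ge (g : R -> R) (m n : nat) (x d : R) : circle_lift g ->
  (forall y, y + d <= iter g n y) -> x + INR m * d <= iter g (m * n) x.
Proof.
intros Hg H. induction m as [|m IH].
- simpl. unfold iter; simpl. lra.
- rewrite S_INR. simpl. rewrite iter_add. specialize (H (iter g (m * n) x)). lra.
Qed.

Lemma iter_mul_le (g : R -> R) (m n : nat) (x d : R) : circle_lift g ->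
  (forall y, iter g n y <= y + d) -> iter g (m * n) x <= x + INR m * d.
Proof.
intros Hg H. induction m as [|m IH].
- simpl. unfold iter; simpl. lra.
- rewrite S_INR. simpl. rewrite iter_add. specialize (H (iter g (m * n) x)). lra.
Qed.

(** * Rotation numbers and small returns *)

(** With [a n] the displacement of 0 after [n] steps, every [(a n - 1) / n] lies below every
    [(a m + 1) / m], because both control the iterate of order [n m]. The supremum [rho] of the
    lower family is therefore within [1 / n] of [a n / n], and passing from 0 to [x] costs another
    1. *)
Lemma rotation_number (g : R -> R) : circle_lift g ->
  exists rho, forall n x, Rabs (iter g n x - x - INR n * rho) <= 2.
Proof.
intros Hg. set (a := fun n => iter g n 0).
assert (Hx : forall n x, Rabs (iter g n x - x - a n) <= 1).
{ intros n x. assert (H := cl_displacement _ 0 x (circle_lift_iter g n Hg)).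
  unfold a. now replace (iter g n x - x - iter g n 0)
    with (iter g n x - x - (iter g n 0 - 0)) by ring. }
assert (Hb : forall n m, INR m * (a n - 1) <= INR n * (a m + 1)).
{ intros n m.
  assert (H1 : 0 + INR m * (a n - 1) <= iter g (m * n) 0).
  { apply iter_mul_ge; auto. intros y. specialize (Hx n y).
    abs_lra. }
  assert (H2 : iter g (n * m) 0 <= 0 + INR n * (a m + 1)).
  { apply iter_mul_le; auto. intros y. specialize (Hx m y).
    abs_lra. }
  rewrite Nat.mul_comm in H1. lra. }
set (X := fun r => exists n, (1 <= n)%nat /\ r = (a n - 1) / INR n).
assert (Hpos : forall n, (1 <= n)%nat -> 0 < INR n) by (intros n Hn; apply lt_0_INR; lia).
assert (Hub : forall m, (1 <= m)%nat -> is_upper_bound X ((a m + 1) / INR m)).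
{ intros m Hm r [n [Hn ->]]. assert (P1 := Hpos n Hn). assert (P2 := Hpos m Hm).
  apply Rmult_le_reg_r with (INR n * INR m); [nra|].
  replace ((a n - 1) / INR n * (INR n * INR m)) with (INR m * (a n - 1)) by (field; lra).
  replace ((a m + 1) / INR m * (INR n * INR m)) with (INR n * (a m + 1)) by (field; lra).
  apply Hb. }
destruct (completeness X) as [rho [Hr1 Hr2]].
- exists ((a 1%nat + 1) / INR 1). now apply Hub.
- exists ((a 1%nat - 1) / INR 1). now exists 1%nat.
- exists rho. intros n x.
  assert (Ha : Rabs (a n - INR n * rho) <= 1).
  { destruct n as [|n].
    - unfold a, iter; simpl. rewrite Rmult_0_l, Rminus_0_r, Rabs_R0. lra.
    - assert (Hn : (1 <= S n)%nat) by lia. assert (P := Hpos _ Hn).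
      assert (U := Hr2 _ (Hub _ Hn)).
      assert (L : (a (S n) - 1) / INR (S n) <= rho) by (apply Hr1; now exists (S n)).
      apply (Rmult_le_compat_l (INR (S n))) in U; [|lra].
      apply (Rmult_le_compat_l (INR (S n))) in L; [|lra].
      replace (INR (S n) * ((a (S n) + 1) / INR (S n))) with (a (S n) + 1) in U by (field; lra).
      replace (INR (S n) * ((a (S n) - 1) / INR (S n))) with (a (S n) - 1) in L by (field; lra).
      abs_lra. }
  specialize (Hx n x). abs_lra.
Qed.

(** Pigeonhole gives a small nonzero value of unknown sign; the work lies in making it positive. *)
Lemma small_multiple (rho d : R) : 0 < d ->
  (forall (m : nat) (j : Z), (1 <= m)%nat -> INR m * rho + IZR j <> 0) ->
  exists (m : nat) (j : Z), (1 <= m)%nat /\ 0 < INR m * rho + IZR j < d.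
Proof.
intros Hd Hirr.
assert (Hd' : 0 < Rmin d 1) by (apply Rmin_pos; lra).
destruct (close_mod_one (fun n => INR n * rho) (Rmin d 1) Hd') as [n [m [p [Hnm H]]]].
min_bounds (Rmin d 1).
set (k := (m - n)%nat).
assert (Hk : INR k = INR m - INR n) by (apply minus_INR; lia).
set (y := INR k * rho - IZR p).
assert (Hy : Rabs y < Rmin d 1).
{ unfold y. rewrite Hk. now replace ((INR m - INR n) * rho - IZR p)
    with (INR m * rho - INR n * rho - IZR p) by ring. }
assert (Hy0 : y <> 0).
{ assert (H0 := Hirr k (- p)%Z). rewrite opp_IZR in H0. apply H0. lia. }
apply Rabs_def2 in Hy.
destruct (Rtotal_order y 0) as [h|[h|h]].
- (* If [y < 0], step down from 1 with it: the last value before 0 lies in (0,|y|). *)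
  set (z := - y). set (i := up (/ z - 1)).
  assert (Hz : 0 < z) by (unfold z; lra).
  destruct (archimed (/ z - 1)) as [A1 A2]. fold i in A1, A2.
  assert (B1 : 1 - z < IZR i * z).
  { apply Rmult_lt_compat_r with (r := z) in A1; auto.
    replace ((/ z - 1) * z) with (1 - z) in A1 by (field; lra). lra. }
  assert (B2 : IZR i * z <= 1).
  { assert (A3 : IZR i <= / z) by lra.
    apply Rmult_le_compat_r with (r := z) in A3; [|lra]. rewrite Rinv_l in A3; lra. }
  assert (Hi : (0 < i)%Z).
  { apply lt_IZR. apply Rmult_lt_reg_r with z; auto. unfold z in *. lra. }
  assert (Hi' : INR (Z.to_nat i) = IZR i) by (rewrite INR_IZR_INZ, Z2Nat.id; auto; lia).
  exists (Z.to_nat i * k)%nat, (1 - i * p)%Z.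
  assert (E : INR (Z.to_nat i * k) * rho + IZR (1 - i * p) = 1 - IZR i * z).
  { rewrite mult_INR, Hi', minus_IZR, mult_IZR. unfold z, y. ring. }
  assert (M : (1 <= Z.to_nat i * k)%nat) by (assert (1 <= Z.to_nat i)%nat by lia; assert (1 <= k)%nat by lia; nia).
  split; auto. assert (N := Hirr _ (1 - i * p)%Z M). rewrite E in *.
  unfold z in *. lra.
- easy.
- exists k, (- p)%Z. rewrite opp_IZR. unfold y in *. split; [lia | lra].
Qed.

Definition aperiodic (g : R -> R) : Prop :=
  forall (m : nat) (p : Z) x, (1 <= m)%nat -> iter g m x <> x + IZR p.

Lemma not_aperiodic (g : R -> R) : ~ aperiodic g ->
  exists (q : nat) (p : Z) x, (1 <= q)%nat /\ iter g q x = x + IZR p.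
Proof.
intros H. apply NNPP. intros Hn. apply H. intros q p x Hq Hx. apply Hn. now exists q, p, x.
Qed.

(** Without periodic points [rho] is irrational: if [INR m * rho + IZR j = 0], the iterates of the
    shifted map would stay within 2 of their starting point, whereas a lift without fixed points
    drifts to infinity. With [INR m * rho + IZR j] below [/ (INR L + 1)], the mean advance over [L]
    steps is less than 1; a point moved by 1 or more in [L] steps would be moved by at least [n] in
    [n L] steps. *)
Lemma aperiodic_small_step (g : R -> R) (L : nat) : circle_lift g -> aperiodic g ->
  exists m j, (1 <= m)%nat /\ (forall x, x < shifted_iter g m j x) /\
    forall x, iter (shifted_iter g m j) L x < x + 1.
Proof.
intros Hg Ha.
destruct (rotation_number g Hg) as [rho Hrho].
assert (Hsi : forall m j n x,
  Rabs (iter (shifted_iter g m j) n x - x - INR n * (INR m * rho + IZR j)) <= 2).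
{ intros m j n x. rewrite iter_shifted by auto. specialize (Hrho (n * m)%nat x).
  rewrite mult_INR in Hrho.
  now replace (iter g (n * m) x + INR n * IZR j - x - INR n * (INR m * rho + IZR j))
    with (iter g (n * m) x - x - INR n * INR m * rho) by ring. }
assert (Hsign : forall m j, (1 <= m)%nat ->
  (forall x, x < shifted_iter g m j x) \/ (forall x, shifted_iter g m j x < x)).
{ intros m j Hm. assert (Hs := circle_lift_shifted g m j Hg).
  destruct (cl_displacement_periodic _ Hs) as [Hc _].
  destruct (IVT_sign _ Hc) as [H|H].
  - intros x Hx. apply (Ha m (- j)%Z x Hm). unfold shifted_iter in Hx.
    rewrite opp_IZR. lra.
  - left. intros x. specialize (H x). simpl in H. lra.
  - right. intros x. specialize (H x). simpl in H. lra. }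
assert (Hleft : forall m j n x, (forall y, shifted_iter g m j y < y) ->
  iter (shifted_iter g m j) n x <= x).
{ intros m j n x H. induction n as [|n IH]; [unfold iter; simpl; lra|].
  change (iter (shifted_iter g m j) (S n) x)
    with (shifted_iter g m j (iter (shifted_iter g m j) n x)).
  specialize (H (iter (shifted_iter g m j) n x)). lra. }
assert (Hirr : forall (m : nat) (j : Z), (1 <= m)%nat -> INR m * rho + IZR j <> 0).
{ intros m j Hm H0.
  assert (Hs := circle_lift_shifted g m j Hg).
  assert (HH : forall n x, Rabs (iter (shifted_iter g m j) n x - x) <= 2).
  { intros n x. assert (H := Hsi m j n x). rewrite H0 in H.
    now rewrite Rmult_0_r, Rminus_0_r in H. }
  destruct (Hsign m j Hm) as [H|H].
  - destruct (iter_escapes _ 0 2 Hs H) as [n Hn]. specialize (HH n 0).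
    abs_lra.
  - destruct (cl_displacement_periodic _ Hs) as [Hc Hp].
    destruct (periodic_max _ Hc Hp) as [b Hb].
    set (d := b - shifted_iter g m j b). assert (Hd : 0 < d) by (unfold d; specialize (H b); lra).
    assert (K : forall n, iter (shifted_iter g m j) n 0 <= - (INR n * d)).
    { induction n as [|n IH]; [unfold iter; simpl; lra|].
      rewrite S_INR. change (iter (shifted_iter g m j) (S n) 0)
        with (shifted_iter g m j (iter (shifted_iter g m j) n 0)).
      assert (Hbn := Hb (iter (shifted_iter g m j) n 0)). simpl in Hbn. unfold d in *. lra. }
    assert (d <= 0); [|lra]. apply no_drift with 2. intros n.
    specialize (K n). specialize (HH n 0). abs_lra. }
assert (HL : 0 < / (INR L + 1)) by (apply Rinv_0_lt_compat; assert (Q := pos_INR L); lra).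
destruct (small_multiple rho _ HL Hirr) as [m [j [Hm [Hs1 Hs2]]]].
exists m, j. split; auto.
assert (Hr : forall x, x < shifted_iter g m j x).
{ destruct (Hsign m j Hm) as [H|H]; auto. exfalso.
  assert (INR m * rho + IZR j <= 0); [|lra]. apply no_drift with 2. intros n.
  specialize (Hleft m j n 0 H). specialize (Hsi m j n 0). abs_lra. }
split; auto. intros x.
apply Rnot_le_lt; intros h.
set (G := shifted_iter g m j) in *.
assert (HG : circle_lift G) by now apply circle_lift_shifted.
assert (K : forall n, x + INR n <= iter G (n * L) x).
{ induction n as [|n IH]; [unfold iter; simpl; lra|].
  rewrite S_INR. simpl. rewrite iter_add.
  apply (cl_le _ _ _ (circle_lift_iter G L HG)) in IH.
  rewrite INR_IZR_INZ, (cl_shift _ _ _ (circle_lift_iter G L HG)), <- INR_IZR_INZ in IH. lra. }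
assert (Hlt : INR L * (INR m * rho + IZR j) < 1).
{ assert (Q := pos_INR L).
  apply Rle_lt_trans with (INR L * / (INR L + 1)); [apply Rmult_le_compat_l; lra|].
  apply Rmult_lt_reg_r with (INR L + 1); [lra|]. rewrite Rmult_assoc, Rinv_l; lra. }
assert (1 - INR L * (INR m * rho + IZR j) <= 0); [|lra].
apply no_drift with 2. intros n. specialize (K n). specialize (Hsi m j (n * L)%nat x).
fold G in Hsi. rewrite mult_INR in Hsi. abs_lra.
Qed.

Lemma degree_one_circle_lift (g : R -> R) : (forall x, continuous g x) ->
  (forall x, g (x + 1) = g x + 1) -> (forall x y, g x = g y -> x = y) -> circle_lift g.
Proof.
intros Hc Hd Hi. split; auto. intros x y Hxy.
apply Rnot_le_lt; intros h.
assert (Hn : g x <> g y) by (intros E; apply Hi in E; lra).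
(* [g] takes the value [g x] again beyond [y]. *)
destruct (archimed_nat (Rmax (y - x) (g x - g y) + 1)) as [n Hn0].
assert (M1 := Rmax_l (y - x) (g x - g y)).
assert (E : g (x + INR n) = g x + INR n) by (rewrite (shift_INR g 1 Hd); ring).
destruct (ivt g y (x + INR n) (g x)) as [z [Hz Hgz]]; auto; try lra.
apply Hi in Hgz. lra.
Qed.

(** * Differentiability in c: leaves without periodic points *)

Implicit Types (E P g : R -> R -> R) (alpha : R -> R).

(* [P c] is the primitive [c t + u_c(t)] of the leaf [E c], [g c] a lift of the
   dynamics on that leaf; [fam_ineq] compares the calibrations of two leaves along
   an orbit of the first one. *)
Record family (E P g : R -> R -> R) (alpha : R -> R) : Prop := {
  fam_E : cont2 E;
  fam_P : forall c t, is_derive (P c) t (E c t);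
  fam_P0 : forall c, P c 0 = 0;
  fam_P1 : forall c t, P c (t + 1) = P c t + c;
  fam_g : cont2 g;
  fam_cl : forall c, circle_lift (g c);
  fam_ineq : forall c c' t,
    P c' (g c t) - P c (g c t) <= P c' t - P c t + (alpha c' - alpha c) }.

Arguments fam_E {E P g alpha} _.
Arguments fam_P {E P g alpha} _.
Arguments fam_P0 {E P g alpha} _.
Arguments fam_P1 {E P g alpha} _.
Arguments fam_g {E P g alpha} _.
Arguments fam_cl {E P g alpha} _.
Arguments fam_ineq {E P g alpha} _.

(** What differentiability in [c] uses of a foliation. The annulus map itself is absent: only the
    first component [T] of its [q]-th iterate and the vertical derivative [T_r] are recorded, so
    that the conditions are stable under the symmetry exchanging the two sides of a leaf. *)
Record foliated (E P g : R -> R -> R) (alpha : R -> R) : Prop := {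
  fol_fam : family E P g alpha;
  fol_incr : forall c c' t, c < c' -> E c t < E c' t;
  fol_g_incr : forall c c' t, c < c' -> g c t < g c' t;
  fol_onto : forall q t x, (1 <= q)%nat -> exists c, iter (g c) q t = x;
  fol_per : forall c q p x, (1 <= q)%nat -> iter (g c) q x = x + IZR p ->
    forall y, iter (g c) q y = y + IZR p;
  fol_twist : forall q, (1 <= q)%nat -> exists T T_r, cont2 T_r /\
    (forall t r, is_derive (T t) r (T_r t r)) /\ (forall t r, 0 < T_r t r) /\
    (forall t r, T_r (t + 1) r = T_r t r) /\
    forall c t, iter (g c) q t = T t (E c t) }.

Arguments fol_fam {E P g alpha} _.
Arguments fol_incr {E P g alpha} _.
Arguments fol_g_incr {E P g alpha} _.
Arguments fol_onto {E P g alpha} _.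
Arguments fol_per {E P g alpha} _.
Arguments fol_twist {E P g alpha} _.

Lemma fam_shift {E P g alpha} (c t : R) (k : Z) :
  family E P g alpha -> P c (t + IZR k) = P c t + IZR k * c.
Proof. intros HF. apply shift_IZR, (fam_P1 HF). Qed.

Lemma fam_iter_ineq {E P g alpha} (c c' t : R) (m : nat) :
  family E P g alpha ->
  P c' (iter (g c) m t) - P c (iter (g c) m t)
    <= P c' t - P c t + INR m * (alpha c' - alpha c).
Proof.
intros HF. induction m as [|m IH]; [unfold iter; simpl; lra|].
rewrite S_INR. change (iter (g c) (S m) t) with (g c (iter (g c) m t)).
assert (H := fam_ineq HF c c' (iter (g c) m t)). lra.
Qed.

Lemma fam_P_one {E P g alpha} (c : R) : family E P g alpha -> P c 1 = c.
Proof.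
intros HF. replace 1 with (0 + 1) by ring. rewrite (fam_P1 HF), (fam_P0 HF). ring.
Qed.

Lemma fam_diff_derive {E P g alpha} (c c' t : R) : family E P g alpha ->
  is_derive (fun x => P c' x - P c x) t (E c' t - E c t).
Proof. intros HF. apply (is_derive_minus (P c') (P c)); apply (fam_P HF). Qed.

(** The bound for the growth of [P c' - P c] during one step of [shifted_iter (g c) m j]; the second
    term is the exact gain over the translation by [j]. *)
Definition drift (alpha : R -> R) (m : nat) (j : Z) (c c' : R) : R :=
  INR m * (alpha c' - alpha c) + IZR j * (c' - c).

Lemma fam_shifted_ineq {E P g alpha} (c c' t : R) (m n : nat) (j : Z) : family E P g alpha ->
  P c' (iter (shifted_iter (g c) m j) n t) - P c (iter (shifted_iter (g c) m j) n t)
    <= P c' t - P c t + INR n * drift alpha m j c c'.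
Proof.
intros HF. induction n as [|n IH]; [unfold iter; simpl; lra|].
rewrite S_INR. change (iter (shifted_iter (g c) m j) (S n) t)
  with (iter (g c) m (iter (shifted_iter (g c) m j) n t) + IZR j).
rewrite !(fam_shift _ _ _ HF).
assert (H := fam_iter_ineq c c' (iter (shifted_iter (g c) m j) n t) m HF).
unfold drift in *. lra.
Qed.

Lemma drift_opp (alpha : R -> R) (m : nat) (j : Z) (c c' : R) :
  drift alpha m j c' c = - drift alpha m j c c'.
Proof. unfold drift. ring. Qed.

Lemma cont2_iter (g : R -> R -> R) (n : nat) : cont2 g -> cont2 (fun c t => iter (g c) n t).
Proof.
intros Hg. induction n as [|n IH].
- apply cont2_snd.
- apply (cont2_comp2 g (fun c _ => c) (fun c t => iter (g c) n t) Hg cont2_fst IH).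
Qed.

Lemma cont2_shifted (g : R -> R -> R) (m : nat) (j : Z) : cont2 g ->
  cont2 (fun c t => shifted_iter (g c) m j t).
Proof.
intros Hg. apply (cont2_plus (fun c t => iter (g c) m t) (fun _ _ => IZR j)).
- now apply cont2_iter.
- apply cont2_const.
Qed.

Lemma cont2_shifted_iter (g : R -> R -> R) (m n : nat) (j : Z) : cont2 g ->
  cont2 (fun c t => iter (shifted_iter (g c) m j) n t).
Proof.
intros Hg. exact (cont2_iter (fun c => shifted_iter (g c) m j) n (cont2_shifted g m j Hg)).
Qed.

Lemma fol_P_incr {E P g alpha} (c c' x y : R) :
  foliated E P g alpha -> c < c' -> x <= y -> P c' x - P c x <= P c' y - P c y.
Proof.
intros HF Hc Hxy.
apply (derive_nonneg_le (fun t => P c' t - P c t) (fun t => E c' t - E c t)); auto.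
- intros t. apply (fam_diff_derive c c' t (fol_fam HF)).
- intros t _. assert (H := fol_incr HF c c' t Hc). lra.
Qed.

Lemma continuous_gt (f : R -> R) (c a : R) : continuous f c -> a < f c ->
  exists d, 0 < d /\ forall c', Rabs (c' - c) < d -> a < f c'.
Proof.
intros Hf Ha. destruct (proj1 (continuous_eps f c) Hf (f c - a)) as [d [Hd H]]; [lra|].
exists d; split; auto. intros c' Hc'. specialize (H c' Hc'). abs_lra.
Qed.

Lemma continuous_lt (f : R -> R) (c a : R) : continuous f c -> f c < a ->
  exists d, 0 < d /\ forall c', Rabs (c' - c) < d -> f c' < a.
Proof.
intros Hf Ha. destruct (proj1 (continuous_eps f c) Hf (a - f c)) as [d [Hd H]]; [lra|].
exists d; split; auto. intros c' Hc'. specialize (H c' Hc'). abs_lra.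
Qed.

(* The increments of [P c2 - P c1] are measured by counting steps of [G]: a step of
   the [c1]-dynamics increases it by at most the drift, one of the [c2]-dynamics by
   at least the drift. *)
Lemma step_count {E P g alpha} (c x : R) (m N N' K : nat) (j : Z) :
  foliated E P g alpha ->
  x < iter (shifted_iter (g c) m j) N 0 ->
  1 < iter (shifted_iter (g c) m j) N' x ->
  iter (shifted_iter (g c) m j) K 0 < 1 ->
  exists d, 0 < d /\ forall c1 c2, Rabs (c1 - c) < d -> Rabs (c2 - c) < d -> c1 < c2 ->
    INR K * (P c2 x - P c1 x) <= INR N * (c2 - c1) /\
    INR K * ((c2 - c1) - (P c2 x - P c1 x)) <= INR N' * (c2 - c1) /\
    INR K * drift alpha m j c1 c2 <= c2 - c1.
Proof.
intros HF H1 H2 H3. assert (HA := fol_fam HF). assert (Hg := fam_g HA).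
(* The three step counts are strict inequalities, hence stable under small changes of the
   parameter. *)
destruct (continuous_gt (fun c' => iter (shifted_iter (g c') m j) N 0) c x) as [d1 [D1 K1]]; auto.
{ apply (cont2_left _ c 0 (cont2_shifted_iter g m N j Hg)). }
destruct (continuous_gt (fun c' => iter (shifted_iter (g c') m j) N' x) c 1) as [d2 [D2 K2]]; auto.
{ apply (cont2_left _ c x (cont2_shifted_iter g m N' j Hg)). }
destruct (continuous_lt (fun c' => iter (shifted_iter (g c') m j) K 0) c 1) as [d3 [D3 K3]]; auto.
{ apply (cont2_left _ c 0 (cont2_shifted_iter g m K j Hg)). }
exists (Rmin d1 (Rmin d2 d3)). split; [now repeat apply Rmin_pos|].
intros c1 c2 Hc1 Hc2 H12.
min_bounds (Rmin d1 (Rmin d2 d3)).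
assert (L1 := K1 c1 ltac:(lra)). assert (L2 := K2 c1 ltac:(lra)). assert (L3 := K3 c2 ltac:(lra)).
clear K1 K2 K3. simpl in L1, L2, L3.
assert (I1 := fam_shifted_ineq c1 c2 0 m N j HA).
assert (I2 := fam_shifted_ineq c1 c2 x m N' j HA).
assert (I3 := fam_shifted_ineq c2 c1 0 m K j HA).
rewrite drift_opp in I3. set (s := drift alpha m j c1 c2) in *.
assert (J1 := fol_P_incr c1 c2 x _ HF H12 (Rlt_le _ _ L1)).
assert (J2 := fol_P_incr c1 c2 1 _ HF H12 (Rlt_le _ _ L2)).
assert (J3 := fol_P_incr c1 c2 _ 1 HF H12 (Rlt_le _ _ L3)).
rewrite !(fam_P_one _ HA) in *. rewrite !(fam_P0 HA) in *.
assert (Q1 := pos_INR N). assert (Q2 := pos_INR N'). assert (Q3 := pos_INR K).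
assert (KS : INR K * s <= c2 - c1) by lra.
assert (A1 : P c2 x - P c1 x <= INR N * s) by lra.
assert (A2 : (c2 - c1) - (P c2 x - P c1 x) <= INR N' * s) by lra.
repeat split; auto.
- apply Rle_trans with (INR K * (INR N * s)); [now apply Rmult_le_compat_l|].
  replace (INR K * (INR N * s)) with (INR N * (INR K * s)) by ring.
  now apply Rmult_le_compat_l.
- apply Rle_trans with (INR K * (INR N' * s)); [now apply Rmult_le_compat_l|].
  replace (INR K * (INR N' * s)) with (INR N' * (INR K * s)) by ring.
  now apply Rmult_le_compat_l.
Qed.

(** * Difference quotients in the parameter *)

Definition quot (P : R -> R -> R) (x c c' : R) : R := (P c' x - P c x) / (c' - c).

Lemma quot_sym (P : R -> R -> R) (x c c' : R) : c <> c' -> quot P x c c' = quot P x c' c.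
Proof. intros H. unfold quot. field. lra. Qed.

Definition near_slope (P : R -> R -> R) (x c e l : R) : Prop :=
  exists d, 0 < d /\ forall c', 0 < Rabs (c' - c) < d -> Rabs (quot P x c c' - l) < e.

(* Stronger than differentiability at [c0]: the slopes at all neighbouring
   parameters are controlled, which makes the derivative continuous. *)
Definition uniform_slope (P : R -> R -> R) (c0 x : R) : Prop :=
  forall e, 0 < e -> exists l d, 0 < d /\
    forall c, Rabs (c - c0) < d -> near_slope P x c e l.

Lemma near_slope_unique (P : R -> R -> R) (x c e l e' l' : R) :
  near_slope P x c e l -> near_slope P x c e' l' -> Rabs (l - l') <= e + e'.
Proof.
intros [d [Hd H]] [d' [Hd' H']].
set (c' := c + Rmin d d' / 2).
assert (Hm : 0 < Rmin d d') by now apply Rmin_pos.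
min_bounds (Rmin d d').
assert (Hc : Rabs (c' - c) = Rmin d d' / 2).
{ unfold c'. replace (c + Rmin d d' / 2 - c) with (Rmin d d' / 2) by ring.
  apply Rabs_right. lra. }
specialize (H c' ltac:(lra)). specialize (H' c' ltac:(lra)).
apply Rabs_def2 in H. apply Rabs_def2 in H'. abs_lra.
Qed.

(** The intervals [[l - e, l + e]] of all approximate slopes meet pairwise; the derivative is their
    common point, taken as the supremum of the left end points. *)
Lemma uniform_slope_derive (P : R -> R -> R) (c x : R) : uniform_slope P c x ->
  exists h, is_derive (fun c' => P c' x) c h.
Proof.
intros Hu.
assert (Hn : forall e, 0 < e -> exists l, near_slope P x c e l).
{ intros e He. destruct (Hu e He) as [l [d [Hd H]]]. exists l. apply H.
  replace (c - c) with 0 by ring. now rewrite Rabs_R0. }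
set (X := fun r => exists e l, 0 < e /\ near_slope P x c e l /\ r = l - e).
assert (Hub : forall e l, near_slope P x c e l -> is_upper_bound X (l + e)).
{ intros e l H r [e' [l' [_ [H' ->]]]].
  assert (U := near_slope_unique _ _ _ _ _ _ _ H H'). abs_lra. }
destruct (Hn 1 Rlt_0_1) as [l1 Hl1].
destruct (completeness X) as [h [Hh1 Hh2]].
- exists (l1 + 1). now apply Hub.
- exists (l1 - 1), 1, l1. repeat split; auto. lra.
- exists h. apply is_derive_eps. intros e He.
  destruct (Hn (e / 2) ltac:(lra)) as [l Hl].
  assert (A1 := Hh2 _ (Hub _ _ Hl)).
  assert (A2 : l - e / 2 <= h) by (apply Hh1; exists (e / 2), l; repeat split; auto; lra).
  destruct Hl as [d [Hd Hl]]. exists d; split; auto. intros c' Hc'.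
  destruct (Req_dec c' c) as [->|Hne].
  + replace (P c x - P c x - h * (c - c)) with 0 by ring.
    replace (c - c) with 0 by ring. rewrite !Rabs_R0. lra.
  + assert (Hne' : c' - c <> 0) by lra. assert (Q := Rabs_pos_lt _ Hne').
    specialize (Hl c' (conj Q Hc')). apply Rabs_def2 in Hl.
    replace (P c' x - P c x - h * (c' - c)) with ((quot P x c c' - h) * (c' - c))
      by (unfold quot; field; auto).
    rewrite Rabs_mult. apply Rmult_le_compat_r; [lra|]. abs_lra.
Qed.

Lemma derive_near_slope (P : R -> R -> R) (c x h e l : R) :
  is_derive (fun c' => P c' x) c h -> near_slope P x c e l -> Rabs (h - l) <= e.
Proof.
intros Hd [d [Hd0 H]]. apply le_epsilon. intros e' He'.
destruct (proj1 (is_derive_eps _ _ _) Hd e' He') as [d' [Hd' H']].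
set (c' := c + Rmin d d' / 2).
assert (Hm : 0 < Rmin d d') by now apply Rmin_pos.
min_bounds (Rmin d d').
assert (Hc : c' - c = Rmin d d' / 2) by (unfold c'; ring).
assert (Hc2 : Rabs (c' - c) = Rmin d d' / 2) by (rewrite Hc; apply Rabs_right; lra).
specialize (H c' ltac:(lra)). specialize (H' c' ltac:(lra)).
replace (P c' x - P c x - h * (c' - c)) with ((quot P x c c' - h) * (c' - c)) in H'
  by (unfold quot; field; lra).
rewrite Rabs_mult in H'. apply Rmult_le_reg_r in H'; [|lra].
apply Rabs_def2 in H. apply Rabs_le_between in H'. abs_lra.
Qed.

(** One [l] serves [c0] and all neighbouring parameters, so both derivatives lie within [e / 3] of
    it. *)
Lemma uniform_slope_continuous (P h : R -> R -> R) (c0 x : R) :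
  (forall c, is_derive (fun c' => P c' x) c (h c x)) -> uniform_slope P c0 x ->
  continuous (fun c => h c x) c0.
Proof.
intros Hh Hu. apply continuous_eps. intros e He.
destruct (Hu (e / 3) ltac:(lra)) as [l [d [Hd H]]]. exists d; split; auto.
intros c Hc. assert (A := derive_near_slope _ _ _ _ _ _ (Hh c) (H c Hc)).
assert (Hc0 : Rabs (c0 - c0) < d) by (replace (c0 - c0) with 0 by ring; now rewrite Rabs_R0).
assert (B := derive_near_slope _ _ _ _ _ _ (Hh c0) (H c0 Hc0)).
abs_lra.
Qed.

Lemma uniform_slope_shift {E P g alpha} (c0 x : R) (k : Z) :
  family E P g alpha -> uniform_slope P c0 x -> uniform_slope P c0 (x + IZR k).
Proof.
intros HF Hu e He. destruct (Hu e He) as [l [d [Hd H]]].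
exists (l + IZR k), d. split; auto. intros c Hc. destruct (H c Hc) as [d' [Hd' H']].
exists d'. split; auto. intros c' Hc'. specialize (H' c' Hc').
replace (quot P (x + IZR k) c c' - (l + IZR k)) with (quot P x c c' - l); auto.
unfold quot. rewrite !(fam_shift _ _ _ HF). field.
intros E0. rewrite E0, Rabs_R0 in Hc'. lra.
Qed.

(* The step counts for [x] and its complement add up to [K + 3], so the bounds of
   [step_count] differ by [3 / K]. *)
Lemma step_count_slope {E P g alpha} (c x : R) (m K : nat) (j : Z) :
  foliated E P g alpha -> 0 <= x <= 1 -> (1 <= K)%nat ->
  (forall y, y < shifted_iter (g c) m j y) ->
  (forall y, iter (shifted_iter (g c) m j) (K + 3) y < y + 1) ->
  exists l d, 0 < d /\
    (forall c1 c2, Rabs (c1 - c) < d -> Rabs (c2 - c) < d -> c1 < c2 ->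
      Rabs (quot P x c1 c2 - l) <= 3 / INR K) /\
    forall c1 c2, Rabs (c1 - c) < d -> Rabs (c2 - c) < d -> c1 < c2 ->
      INR K * drift alpha m j c1 c2 <= c2 - c1.
Proof.
intros HF Hx HK Hr Hs.
assert (HG := circle_lift_shifted (g c) m j (fam_cl (fol_fam HF) c)).
set (G := shifted_iter (g c) m j) in *.
destruct (iter_bracket G 0 x HG Hr (proj1 Hx)) as [N [N1 N2]].
destruct (iter_bracket G x 1 HG Hr (proj2 Hx)) as [N' [N1' N2']].
assert (Hsum : iter G (N' + N) 0 <= 1).
{ rewrite iter_add. apply Rle_trans with (2 := N1').
  now apply (cl_le _ _ _ (circle_lift_iter G N' HG)). }
assert (HKN : (K + 3 <= N' + N + 2)%nat).
{ destruct (le_lt_dec (K + 3) (N' + N + 2)) as [h|h]; auto. exfalso.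
  assert (L1 : 1 < iter G (S N' + S N) 0).
  { rewrite iter_add. apply Rlt_le_trans with (1 := N2').
    apply (cl_le _ _ _ (circle_lift_iter G (S N') HG)). lra. }
  assert (L2 := iter_le_mono G 0 (S N' + S N) (K + 3) Hr ltac:(lia)).
  specialize (Hs 0). lra. }
destruct (Nat.eq_dec (N' + N) 0) as [h|h]; [lia|].
(* Subtracting 1 gives the strict inequality that [step_count] requires; the two counts [S N] and
   [S N'] then add up to [K' + 3]. *)
set (K' := (N' + N - 1)%nat).
assert (HK' : iter G K' 0 < 1).
{ apply Rlt_le_trans with (2 := Hsum). replace (N' + N)%nat with (S K') by (unfold K'; lia).
  apply Hr. }
destruct (step_count c x m (S N) (S N') K' j HF N2 N2' HK') as [d [Hd H]].
assert (PK : 0 < INR K) by (apply lt_0_INR; lia).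
assert (PK' : INR K <= INR K') by (apply le_INR; unfold K'; lia).
assert (EK : INR (S N) + INR (S N') = INR K' + 3).
{ rewrite <- plus_INR. replace 3 with (INR 3) by (simpl; ring). rewrite <- plus_INR.
  f_equal. unfold K'. lia. }
exists (INR (S N) / INR K'), d. split; auto. split.
- intros c1 c2 H1 H2 H12. destruct (H c1 c2 H1 H2 H12) as [A [B _]].
  assert (Q1 : INR K' * quot P x c1 c2 <= INR (S N)).
  { apply Rmult_le_reg_r with (c2 - c1); [lra|].
    replace (INR K' * quot P x c1 c2 * (c2 - c1)) with (INR K' * (P c2 x - P c1 x))
      by (unfold quot; field; lra). lra. }
  assert (Q2 : INR K' * (1 - quot P x c1 c2) <= INR (S N')).
  { apply Rmult_le_reg_r with (c2 - c1); [lra|].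
    replace (INR K' * (1 - quot P x c1 c2) * (c2 - c1))
      with (INR K' * ((c2 - c1) - (P c2 x - P c1 x))) by (unfold quot; field; lra). lra. }
  apply Rle_trans with (3 / INR K').
  + apply Rmult_le_reg_l with (INR K'); [lra|].
    rewrite <- (Rabs_right (INR K')) at 1 by lra. rewrite <- Rabs_mult.
    replace (INR K' * (3 / INR K')) with 3 by (field; lra).
    replace (INR K' * (quot P x c1 c2 - INR (S N) / INR K'))
      with (INR K' * quot P x c1 c2 - INR (S N)) by (field; lra).
    abs_lra.
  + unfold Rdiv. apply Rmult_le_compat_l; [lra|]. apply Rinv_le_contravar; lra.
- intros c1 c2 H1 H2 H12. destruct (H c1 c2 H1 H2 H12) as [A [B D]].
  destruct (Rle_dec 0 (drift alpha m j c1 c2)) as [h1|h1].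
  + apply Rle_trans with (2 := D). now apply Rmult_le_compat_r.
  + assert (INR K * drift alpha m j c1 c2 <= 0) by nra. lra.
Qed.

Lemma small_inverse (e : R) : 0 < e -> exists K, (1 <= K)%nat /\ 3 / INR K < e.
Proof.
intros He. destruct (INR_archimed e 3 He) as [K HK]. exists K.
destruct K as [|K]; [simpl in HK; lra|]. split; [lia|].
assert (P : 0 < INR (S K)) by (apply lt_0_INR; lia).
apply Rmult_lt_reg_r with (INR (S K)); auto. unfold Rdiv. rewrite Rmult_assoc, Rinv_l; lra.
Qed.

Lemma aperiodic_slope {E P g alpha} (c0 x : R) :
  foliated E P g alpha -> aperiodic (g c0) -> 0 <= x <= 1 -> uniform_slope P c0 x.
Proof.
intros HF Ha Hx e He.
destruct (small_inverse e He) as [K [HK HKe]].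
destruct (aperiodic_small_step (g c0) (K + 3)
  (fam_cl (fol_fam HF) c0) Ha) as [m [j [Hm [Hr Hs]]]].
destruct (step_count_slope c0 x m K j HF Hx HK Hr Hs) as [l [d [Hd [H _]]]].
exists l, (d / 2). split; [lra|]. intros c Hc. exists (d / 2). split; [lra|].
intros c' [Hc1 Hc2].
assert (Hc' : Rabs (c' - c0) < d).
{ replace (c' - c0) with ((c' - c) + (c - c0)) by ring.
  apply Rle_lt_trans with (1 := Rabs_triang _ _). lra. }
apply Rle_lt_trans with (2 := HKe).
destruct (Rtotal_order c c') as [h|[h|h]].
- apply H; auto. lra.
- rewrite h in Hc1. replace (c' - c') with 0 in Hc1 by ring. rewrite Rabs_R0 in Hc1. lra.
- rewrite quot_sym by lra. apply H; auto. lra.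
Qed.

(** One step of [G] raises [h c0] by at most [/ INR K]: divide the drift bound by [c' - c0] and let
    [c'] tend to [c0]. As [h c0] is nondecreasing, it varies by at most [/ INR K] between the
    preimage of [x] and [x], and again between [x] and [G x]. *)
Lemma aperiodic_continuous {E P g} (h : R -> R -> R) {alpha} (c0 : R) :
  foliated E P g alpha -> aperiodic (g c0) ->
  (forall c x, is_derive (fun c' => P c' x) c (h c x)) ->
  (forall x y, x <= y -> h c0 x <= h c0 y) ->
  forall x, continuous (h c0) x.
Proof.
intros HF Ha Hh Hm x. assert (HA := fol_fam HF).
apply continuous_eps. intros e He.
destruct (small_inverse e He) as [K [HK HKe]].
destruct (aperiodic_small_step (g c0) (K + 3) (fam_cl HA c0) Ha)
  as [m [j [Hm' [Hr Hs]]]].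
(* Only the drift bound is kept, so the base point 0 is arbitrary. *)
destruct (step_count_slope c0 0 m K j HF ltac:(lra) HK Hr Hs)
  as [_ [d [Hd [_ H]]]].
set (G := shifted_iter (g c0) m j) in *.
assert (HG : circle_lift G) by apply (circle_lift_shifted _ _ _ (fam_cl HA c0)).
assert (PK : 0 < INR K) by (apply lt_0_INR; lia).
assert (Hstep : forall y, h c0 (G y) <= h c0 y + / INR K).
{ intros y.
  assert (D := is_derive_minus _ _ _ _ _ (Hh c0 (G y)) (Hh c0 y)).
  unfold minus, plus, opp in D; simpl in D.
  assert (h c0 (G y) + - h c0 y <= / INR K); [|lra].
  apply le_epsilon. intros e' He'.
  destruct (proj1 (is_derive_eps _ _ _) D e' He') as [d' [Hd' H']].
  set (c' := c0 + Rmin d d' / 2).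
  assert (Hmi : 0 < Rmin d d') by now apply Rmin_pos.
  min_bounds (Rmin d d').
  assert (Hc : c' - c0 = Rmin d d' / 2) by (unfold c'; ring).
  assert (Hc2 : Rabs (c' - c0) = Rmin d d' / 2) by (rewrite Hc; apply Rabs_right; lra).
  specialize (H' c' ltac:(lra)).
  assert (Hd0 := H c0 c'). replace (c0 - c0) with 0 in Hd0 by ring. rewrite Rabs_R0 in Hd0.
  specialize (Hd0 Hd ltac:(lra) ltac:(lra)).
  assert (I := fam_shifted_ineq c0 c' y m 1 j HA).
  change (iter (shifted_iter (g c0) m j) 1 y) with (G y) in I. simpl INR in I.
  apply Rabs_le_between in H'. rewrite (Rabs_right (c' - c0)) in H' by lra.
  apply Rmult_le_reg_r with (c' - c0); [lra|].
  assert (Hdr : drift alpha m j c0 c' <= / INR K * (c' - c0)).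
  { apply Rmult_le_reg_l with (INR K); auto. rewrite <- Rmult_assoc, Rinv_r; lra. }
  lra. }
assert (HKe' : / INR K < e).
{ apply Rle_lt_trans with (2 := HKe). unfold Rdiv.
  assert (0 < / INR K) by now apply Rinv_0_lt_compat. lra. }
destruct (cl_surj G x HG) as [y Hy].
assert (Hyx : y < x) by (rewrite <- Hy; apply Hr). assert (Hxr := Hr x). fold G in Hxr.
assert (S1 := Hstep y). rewrite Hy in S1. assert (S2 := Hstep x).
exists (Rmin (x - y) (G x - x)). split; [apply Rmin_pos; lra|]. intros z Hz.
min_bounds (Rmin (x - y) (G x - x)).
apply Rabs_def2 in Hz.
assert (A1 := Hm y z ltac:(lra)). assert (A2 := Hm z (G x) ltac:(lra)).
abs_lra.
Qed.

(** * Differentiability in c: leaves of periodic points *)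

(* A leaf [E c0] all of whose points are periodic of type [p/q]; [T t r] is the first
   component of [F^q(t, r)]. Up to normalisation, [I] turns out to be the derivative of
   [P] in [c] at [c0]. *)
Record resonant (E P g : R -> R -> R) (alpha : R -> R) (c0 : R) (q : nat) (p : Z)
    (T T_r : R -> R -> R) (I : R -> R) : Prop := {
  rs_fol : foliated E P g alpha;
  rs_q : (1 <= q)%nat;
  rs_id : forall y, iter (g c0) q y = y + IZR p;
  rs_Tr : cont2 T_r;
  rs_dT : forall t r, is_derive (T t) r (T_r t r);
  rs_pos : forall t r, 0 < T_r t r;
  rs_per : forall t r, T_r (t + 1) r = T_r t r;
  rs_T : forall c t, iter (g c) q t = T t (E c t);
  rs_I0 : I 0 = 0;
  rs_I : forall t, is_derive I t (/ sqrt (T_r t (E c0 t))) }.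

Arguments rs_fol {E P g alpha c0 q p T T_r I} _.
Arguments rs_q {E P g alpha c0 q p T T_r I} _.
Arguments rs_id {E P g alpha c0 q p T T_r I} _.
Arguments rs_Tr {E P g alpha c0 q p T T_r I} _.
Arguments rs_dT {E P g alpha c0 q p T T_r I} _.
Arguments rs_pos {E P g alpha c0 q p T T_r I} _.
Arguments rs_per {E P g alpha c0 q p T T_r I} _.
Arguments rs_T {E P g alpha c0 q p T T_r I} _.
Arguments rs_I0 {E P g alpha c0 q p T T_r I} _.
Arguments rs_I {E P g alpha c0 q p T T_r I} _.

(** On a leaf of type [p/q] this map is the identity; on neighbouring leaves it is a small
    displacement. *)
Definition Gqp (g : R -> R -> R) (q : nat) (p : Z) (c : R) : R -> R :=
  shifted_iter (g c) q (- p).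

Lemma fol_iter_incr {E P g alpha} (c c' t : R) (q : nat) :
  foliated E P g alpha -> (1 <= q)%nat -> c < c' -> iter (g c) q t < iter (g c') q t.
Proof.
intros HF Hq Hc. assert (HA := fol_fam HF).
induction Hq as [|n Hn IH].
- apply (fol_g_incr HF), Hc.
- change (g c (iter (g c) n t) < g c' (iter (g c') n t)).
  apply Rlt_trans with (g c (iter (g c') n t)).
  + apply (cl_incr _ (fam_cl HA c)), IH.
  + apply (fol_g_incr HF), Hc.
Qed.

Lemma fol_iter_le {E P g alpha} (c c' t : R) (q : nat) :
  foliated E P g alpha -> (1 <= q)%nat -> iter (g c) q t <= iter (g c') q t -> c <= c'.
Proof.
intros HF Hq H. apply Rnot_lt_le; intros h.
assert (H' := fol_iter_incr c' c t q HF Hq ltac:(lra)). lra.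
Qed.

Lemma fol_iter_inj {E P g alpha} (c c' t : R) (q : nat) :
  foliated E P g alpha -> (1 <= q)%nat -> iter (g c) q t = iter (g c') q t -> c = c'.
Proof.
intros HF Hq H. apply Rle_antisym; apply (fol_iter_le _ _ t q HF Hq); lra.
Qed.

Lemma resonant_G {E P g alpha} {c0 : R} (t : R) {q : nat} {p : Z} {T T_r : R -> R -> R}
    {I : R -> R} :
  resonant E P g alpha c0 q p T T_r I -> Gqp g q p c0 t = t.
Proof.
intros H. unfold Gqp, shifted_iter. rewrite (rs_id H), opp_IZR. ring.
Qed.

Lemma resonant_G_right {E P g alpha} {c0 : R} (c t : R) {q : nat} {p : Z} {T T_r : R -> R -> R}
    {I : R -> R} :
  resonant E P g alpha c0 q p T T_r I -> c0 < c -> t < Gqp g q p c t.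
Proof.
intros H Hc. rewrite <- (resonant_G t H) at 1.
apply Rplus_lt_compat_r.
apply (fol_iter_incr _ _ t q (rs_fol H)
  (rs_q H) Hc).
Qed.

(* The action from [x] to [y + p] in [q] steps as calibrated by the leaf [c], minus the
   same quantity for [c0]. *)
Definition act (P : R -> R -> R) (alpha : R -> R) (q : nat) (p : Z) (c0 c x y : R) : R :=
  (P c y - P c0 y) - (P c x - P c0 x) - drift alpha q (- p) c0 c.

(** The comparison inequality along the [c]-orbit of [t]. It makes [act], taken at the leaf joining
    the end points, an upper envelope over the parameter, so that its derivative in [t] can be
    computed with the parameter frozen. *)
Lemma act_max {E P g alpha} (c0 c c' t : R) (q : nat) (p : Z) :
  foliated E P g alpha ->
  act P alpha q p c0 c' t (Gqp g q p c t) <= act P alpha q p c0 c t (Gqp g q p c t).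
Proof.
intros HF.
assert (H := fam_shifted_ineq c c' t q 1 (- p) (fol_fam HF)).
change (iter (shifted_iter (g c) q (- p)) 1 t) with (Gqp g q p c t) in H.
unfold act, drift in *. simpl INR in H. lra.
Qed.

(** Near a point [t0] all factors are close to [T_r t0 (E c0 t0)], once [r] is known to be close to
    [E c0 t]. The bound on [Gqp g q p c t] ensures this: the displacement increases with [c], so a
    small displacement keeps [c] from being far above [c0]. The range up to 2 leaves room for steps
    that start in [0,1] and end beyond 1. *)
Lemma resonant_local {E P g alpha} {c0 : R} (e : R) {q : nat} {p : Z} {T T_r : R -> R -> R}
    {I : R -> R} :
  resonant E P g alpha c0 q p T T_r I -> 0 < e <= 1 ->
  exists d, 0 < d /\ forall t, 0 <= t <= 2 ->
    forall t' c r, t <= t' <= t + d -> Gqp g q p c t <= t + d -> E c0 t <= r <= E c t ->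
    (1 - e) * T_r t r <= sqrt (T_r t (E c0 t)) * sqrt (T_r t' (E c0 t'))
      <= (1 + e) * T_r t r.
Proof.
intros H He. assert (HF := rs_fol H).
assert (HA := fol_fam HF). assert (HE := fam_E HA).
assert (HTr := rs_Tr H).
apply (compact_uniform (fun t d => forall t' c r, t <= t' <= t + d ->
  Gqp g q p c t <= t + d -> E c0 t <= r <= E c t ->
  (1 - e) * T_r t r <= sqrt (T_r t (E c0 t)) * sqrt (T_r t' (E c0 t')) <= (1 + e) * T_r t r)).
{ intros t d d' Hd Hd' t' c r Ht HG Hr. apply (Hd t' c r); auto; lra. }
intros t0 _. set (r0 := E c0 t0). set (m := T_r t0 r0).
assert (Hm : 0 < m) by apply (rs_pos H).
(* A quarter of the relative error suffices: for [0 < e <= 1], [1 + e / 4 <= (1 + e) (1 - e / 4)]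
   and [(1 - e) (1 + e / 4) <= 1 - e / 4]. *)
assert (Hem : 0 < m * e / 4) by nra.
set (s := fun t => sqrt (T_r t (E c0 t))).
assert (Hs : forall t, continuous s t).
{ intros t. apply (continuous_comp (fun t => T_r t (E c0 t)) sqrt).
  - apply (cont2_comp T_r (fun t => t) (E c0)); auto.
    apply continuous_id. now apply cont2_right.
  - apply continuous_sqrt. }
assert (Hss : cont2 (fun t t' => s t * s t')).
{ apply cont2_mult; apply (cont2_of_1 s); auto. apply cont2_fst. apply cont2_snd. }
destruct (cont2_eps T_r t0 r0 _ HTr Hem) as [d1 [D1 K1]].
destruct (cont2_eps _ t0 t0 _ Hss Hem) as [d2 [D2 K2]].
destruct (cont2_eps E c0 t0 d1 HE D1) as [d3 [D3 K3]]. fold r0 in K3.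
assert (E0 : s t0 * s t0 = m).
{ unfold s, m, r0. apply sqrt_sqrt. left; apply (rs_pos H). }
rewrite E0 in K2.
(* The leaf [c1] above [c0] is a barrier: its points near [t0] are moved by more than [b], so a
   parameter whose displacement there is at most [d <= b] cannot exceed [c1]. *)
set (c1 := c0 + d3 / 2).
assert (Hc1 := resonant_G_right c1 t0 H ltac:(unfold c1; lra)).
set (b := (Gqp g q p c1 t0 - t0) / 2).
assert (Hb : 0 < b) by (unfold b; lra).
destruct (continuous_gt (fun t => Gqp g q p c1 t - t) t0 b) as [d4 [D4 K4]].
{ apply (continuous_minus (Gqp g q p c1) (fun t => t)); [|apply continuous_id].
  apply (cl_cont _ (circle_lift_shifted _ _ _ (fam_cl HA c1))). }
{ unfold b in *. lra. }
set (d := Rmin (Rmin d1 (d2 / 2)) (Rmin d3 (Rmin b d4))).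
assert (M : d <= d1 /\ d <= d2 / 2 /\ d <= d3 /\ d <= b /\ d <= d4).
{ min_bounds (Rmin (Rmin d1 (d2 / 2)) (Rmin d3 (Rmin b d4))). unfold d. repeat split; lra. }
exists d. split; [unfold d; repeat apply Rmin_pos; lra|].
intros t Ht t' c r Ht' HG Hr.
assert (Hcc : c <= c1).
{ apply Rnot_lt_le; intros h.
  assert (L := fol_iter_incr c1 c t q HF (rs_q H) ltac:(lra)).
  specialize (K4 t ltac:(lra)). unfold Gqp, shifted_iter in *. lra. }
assert (U : E c t <= E c1 t).
{ destruct Hcc as [h| ->]; [left; now apply (fol_incr HF) | lra]. }
assert (A0 := K3 c0 t). assert (A1 := K3 c1 t).
replace (c0 - c0) with 0 in A0 by ring. rewrite Rabs_R0 in A0.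
specialize (A0 D3 ltac:(lra)).
replace (c1 - c0) with (d3 / 2) in A1 by (unfold c1; ring).
rewrite (Rabs_right (d3 / 2)) in A1 by lra. specialize (A1 ltac:(lra) ltac:(lra)).
apply Rabs_def2 in A0. apply Rabs_def2 in A1.
assert (B1 := K1 t r ltac:(lra) ltac:(abs_lra)).
assert (Ht2 : Rabs (t' - t0) < d2).
{ abs_lra. }
assert (B2 := K2 t t' ltac:(lra) Ht2). fold m in B1. simpl in B2.
apply Rabs_def2 in B1. apply Rabs_def2 in B2.
change (sqrt (T_r t (E c0 t)) * sqrt (T_r t' (E c0 t'))) with (s t * s t').
assert (N1 : m * e * e <= m * e) by nra.
split; nra.
Qed.

Lemma sqrt_Tr_pos {E P g alpha} {c0 : R} (t : R) {q : nat} {p : Z} {T T_r : R -> R -> R}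
    {I : R -> R} :
  resonant E P g alpha c0 q p T T_r I -> 0 < sqrt (T_r t (E c0 t)).
Proof. intros H. apply sqrt_lt_R0, (rs_pos H). Qed.

(** Let [C t] be the parameter whose leaf carries [t] to [y]. By the envelope lemma the relative
    action from [t] to [y] has derivative [- (E (C t) t - E c0 t)] in [t]. The mean value theorem
    writes [y - t] as [T_r] times this difference of heights, and [I y - I t] as [y - t] divided by
    the square root of [T_r]. Up to the factors [1 - e] and [1 + e], the derivative is thus that of
    [(I y - I t)^2 / 2], and both functions vanish at [t = y]. *)
Lemma act_estimate {E P g alpha} {c0 : R} (e : R) {q : nat} {p : Z} {T T_r : R -> R -> R}
    {I : R -> R} :
  resonant E P g alpha c0 q p T T_r I -> 0 < e <= 1 ->
  exists d, 0 < d /\ forall x y c, 0 <= x -> x <= y <= x + d -> y <= 2 -> Gqp g q p c x = y ->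
    (1 - e) * (I y - I x)^2 / 2 <= act P alpha q p c0 c x y <= (1 + e) * (I y - I x)^2 / 2.
Proof.
intros H He. assert (HF := rs_fol H).
assert (Hq := rs_q H).
assert (HA := fol_fam HF). assert (HE := fam_E HA).
destruct (resonant_local e H He) as [d [Hd HL]].
exists d. split; auto. intros x y c Hx Hxy Hy Hc.
assert (HC : forall t, exists c', Gqp g q p c' t = y).
{ intros t. destruct (fol_onto HF q t (y + IZR p) Hq) as [c' Hc'].
  exists c'. unfold Gqp, shifted_iter. rewrite Hc', opp_IZR. ring. }
destruct (functional_choice _ HC) as [C HCy].
assert (Hinj : forall t c', Gqp g q p c' t = y -> C t = c').
{ intros t c' Hc'. apply (fol_iter_inj _ _ t q HF Hq).
  specialize (HCy t). unfold Gqp, shifted_iter in *. lra. }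
assert (HCc : forall t, continuous C t).
{ intros t. apply (implicit_continuous (fun t c => Gqp g q p c t - y)).
  - intros c'. apply (continuous_minus (fun x0 => Gqp g q p c' x0) (fun _ => y)).
    + apply (cl_cont _ (circle_lift_shifted _ _ _ (fam_cl HA c'))).
    + apply continuous_const.
  - intros t' a b Hab. unfold Gqp, shifted_iter.
    assert (L := fol_iter_incr a b t' q HF Hq Hab). lra.
  - intros t'. rewrite HCy. ring. }
assert (Hw : forall t, is_derive (fun t => act P alpha q p c0 (C t) t y) t
          (- (E (C t) t - E c0 t))).
{ intros t.
  apply (envelope (fun c t => act P alpha q p c0 c t y) (fun c t => - (E c t - E c0 t)) C); auto.
  - intros c' t'. unfold act.
    assert (D := is_derive_minus _ _ _ _ _ (fam_P HA c' t') (fam_P HA c0 t')).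
    unfold minus, plus, opp in D; simpl in D.
    apply (is_derive_ext (fun t => - (P c' t + - P c0 t) +
      (P c' y - P c0 y - drift alpha q (- p) c0 c'))).
    { intros z. simpl. ring. }
    replace (- (E c' t' - E c0 t')) with (plus (- (E c' t' + - E c0 t')) 0)
      by (unfold plus; simpl; ring).
    apply (is_derive_plus (V := R_NormedModule)).
    + apply (is_derive_opp (fun t => P c' t + - P c0 t)), D.
    + apply (is_derive_const (V := R_NormedModule)).
  - apply cont2_opp, cont2_minus; auto.
    apply (cont2_of_1 (E c0) (fun _ y => y)); [|apply cont2_snd].
    intros z; now apply cont2_right.
  - intros t1 t2. rewrite <- (HCy t2). rewrite HCy at 1. rewrite <- (HCy t2).
    now apply act_max with (1 := HF). }
assert (HIW : forall k t, is_derive (fun t => k * (I y - I t)^2 / 2) t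
          (- (k * (I y - I t) * / sqrt (T_r t (E c0 t))))).
{ intros k t. assert (D := rs_I H t).
  auto_derive.
  - now exists (/ sqrt (T_r t (E c0 t))).
  - change (Derive (fun x0 : R => I x0) t) with (Derive I t). rewrite (is_derive_unique _ _ _ D). field.
    apply Rgt_not_eq, (sqrt_Tr_pos _ H). }
assert (Hend : act P alpha q p c0 (C y) y y = 0).
{ rewrite (Hinj y c0 (resonant_G _ H)). unfold act, drift. ring. }
assert (Hpt : forall t, x <= t <= y ->
  (1 - e) * (I y - I t) * / sqrt (T_r t (E c0 t)) <= E (C t) t - E c0 t
    <= (1 + e) * (I y - I t) * / sqrt (T_r t (E c0 t))).
{ intros t Ht.
  assert (Hc0 : c0 <= C t).
  { apply (fol_iter_le _ _ t q HF Hq).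
    assert (Q1 := HCy t). assert (Q2 := resonant_G t H).
    unfold Gqp, shifted_iter in *. lra. }
  assert (HEt : E c0 t <= E (C t) t).
  { destruct Hc0 as [h| <-]; [left; now apply (fol_incr HF) | lra]. }
  destruct (mean_value (T t) (T_r t) (E c0 t) (E (C t) t)) as [r [Hr Hmv]]; auto.
  { intros r. apply (rs_dT H). }
  rewrite <- !(rs_T H) in Hmv.
  assert (Q1 := HCy t). assert (Q2 := resonant_G t H).
  unfold Gqp, shifted_iter in Q1, Q2.
  assert (Hyt : y - t = T_r t r * (E (C t) t - E c0 t)) by lra.
  destruct (mean_value I _ t y (rs_I H) (proj2 Ht)) as [t' [Ht' HI]].
  assert (HG : Gqp g q p (C t) t <= t + d) by (rewrite HCy; lra).
  destruct (HL t ltac:(lra) t' (C t) r ltac:(lra) HG Hr) as [B1 B2].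
  assert (P1 := sqrt_Tr_pos t H).
  assert (P2 := sqrt_Tr_pos t' H).
  set (s := sqrt (T_r t (E c0 t))) in *. set (s' := sqrt (T_r t' (E c0 t'))) in *.
  assert (EI : (I y - I t) * / s = T_r t r * (E (C t) t - E c0 t) * / (s * s')).
  { rewrite HI, Hyt. field. lra. }
  rewrite !Rmult_assoc, EI.
  assert (Pp : 0 < s * s') by nra.
  assert (De : 0 <= E (C t) t - E c0 t) by lra.
  set (X := E (C t) t - E c0 t) in *.
  split.
  - apply Rmult_le_reg_r with (s * s'); auto.
    replace ((1 - e) * (T_r t r * X * / (s * s')) * (s * s')) with ((1 - e) * T_r t r * X)
      by (field; lra). nra.
  - apply Rmult_le_reg_r with (s * s'); auto.
    replace ((1 + e) * (T_r t r * X * / (s * s')) * (s * s')) with ((1 + e) * T_r t r * X)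
      by (field; lra). nra. }
rewrite <- (Hinj x c Hc).
split.
- assert (L := derive_nonneg_le
    (fun t => (1 - e) * (I y - I t)^2 / 2 - act P alpha q p c0 (C t) t y)
    (fun t => - ((1 - e) * (I y - I t) * / sqrt (T_r t (E c0 t))) - - (E (C t) t - E c0 t)) x y).
  simpl in L. rewrite Hend in L.
  assert ((1 - e) * ((I y - I x) * ((I y - I x) * 1)) / 2 - act P alpha q p c0 (C x) x y
    <= (1 - e) * ((I y - I y) * ((I y - I y) * 1)) / 2 - 0); [|simpl; lra].
  apply L; [|lra|].
  + intros t. apply (is_derive_minus (V := R_NormedModule)); [apply HIW | apply Hw].
  + intros t Ht. specialize (Hpt t Ht). lra.
- assert (L := derive_nonneg_le
    (fun t => act P alpha q p c0 (C t) t y - (1 + e) * (I y - I t)^2 / 2)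
    (fun t => - (E (C t) t - E c0 t) - - ((1 + e) * (I y - I t) * / sqrt (T_r t (E c0 t)))) x y).
  simpl in L. rewrite Hend in L.
  assert (act P alpha q p c0 (C x) x y - (1 + e) * ((I y - I x) * ((I y - I x) * 1)) / 2
    <= 0 - (1 + e) * ((I y - I y) * ((I y - I y) * 1)) / 2); [|simpl; lra].
  apply L; [|lra|].
  + intros t. apply (is_derive_minus (V := R_NormedModule)); [apply Hw | apply HIW].
  + intros t Ht. specialize (Hpt t Ht). lra.
Qed.

Lemma resonant_I_incr {E P g alpha} {c0 : R} (x y : R) {q : nat} {p : Z} {T T_r : R -> R -> R}
    {I : R -> R} :
  resonant E P g alpha c0 q p T T_r I -> x < y -> I x < I y.
Proof.
intros H Hxy.
destruct (mean_value I _ x y (rs_I H) ltac:(lra)) as [z [_ Hz]].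
assert (0 < / sqrt (T_r z (E c0 z))).
{ apply Rinv_0_lt_compat, (sqrt_Tr_pos _ H). }
nra.
Qed.

Lemma resonant_I_le {E P g alpha} {c0 : R} (x y : R) {q : nat} {p : Z} {T T_r : R -> R -> R}
    {I : R -> R} :
  resonant E P g alpha c0 q p T T_r I -> x <= y -> I x <= I y.
Proof.
intros H [h| ->]; [left; now apply (resonant_I_incr _ _ H) | lra].
Qed.

Lemma resonant_I_lipschitz {E P g alpha} {c0 : R} {q : nat} {p : Z} {T T_r : R -> R -> R}
    {I : R -> R} :
  resonant E P g alpha c0 q p T T_r I -> exists k K, 0 < k /\ 0 < K /\
    forall x y, 0 <= x -> x <= y -> y <= 2 -> k * (y - x) <= I y - I x <= K * (y - x).
Proof.
intros H. assert (HA := fol_fam (rs_fol H)).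
assert (Hp := fun t => sqrt_Tr_pos t H).
set (s := fun t => sqrt (T_r t (E c0 t))) in *.
assert (Hs : forall t, continuous s t).
{ intros t. apply (continuous_comp (fun t => T_r t (E c0 t)) sqrt).
  - apply (cont2_comp T_r (fun t => t) (E c0)).
    apply (rs_Tr H). apply continuous_id.
    apply cont2_right, (fam_E HA).
  - apply continuous_sqrt. }
destruct (ab_max s 0 2 Hs ltac:(lra)) as [a [_ Ha]].
destruct (ab_min s 0 2 Hs ltac:(lra)) as [b [_ Hb]].
exists (/ s a), (/ s b).
split; [apply Rinv_0_lt_compat, Hp|]. split; [apply Rinv_0_lt_compat, Hp|].
intros x y Hx Hxy Hy.
destruct (mean_value I _ x y (rs_I H) Hxy) as [z [Hz ->]].
fold (s z).
split; (apply Rmult_le_compat_r; [lra|]); apply Rinv_le_contravar; try apply Hp.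
- apply Ha; lra.
- apply Hb; lra.
Qed.

Lemma resonant_small_step {E P g alpha} {c0 : R} (e : R) {q : nat} {p : Z}
    {T T_r : R -> R -> R} {I : R -> R} :
  resonant E P g alpha c0 q p T T_r I -> 0 < e ->
  exists d, 0 < d /\ forall c t, c0 < c < c0 + d -> 0 <= t <= 1 -> Gqp g q p c t <= t + e.
Proof.
intros H He. assert (HF := rs_fol H).
assert (HA := fol_fam HF).
destruct (compact_uniform (fun t d => forall c, c0 < c < c0 + d -> Gqp g q p c t <= t + e) 0 1)
  as [d [Hd HG]].
- intros x d d' HG Hd c Hc. apply HG. lra.
- intros t0 _.
  assert (Hc2 := cont2_minus _ _ (cont2_shifted g q (- p) (fam_g HA)) cont2_snd).
  destruct (cont2_eps _ c0 t0 e Hc2 He) as [d [Hd HG]].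
  exists d. split; auto. intros t Ht c Hc.
  specialize (HG c t ltac:(abs_lra) Ht). simpl in HG.
  assert (E0 := resonant_G t0 H). unfold Gqp in *. rewrite E0 in HG.
  abs_lra.
- exists d. split; [exact Hd|]. intros c t Hc Ht. exact (HG t Ht c Hc).
Qed.

(* With [s] the action drift and [a = sqrt (2 s)], AM-GM makes [a] the exchange rate
   between [P c - P c0] and [I]; the free parameter [mu] linearises squares. *)
Lemma resonant_bounds {E P g alpha} {c0 : R} (e : R) {q : nat} {p : Z} {T T_r : R -> R -> R}
    {I : R -> R} :
  resonant E P g alpha c0 q p T T_r I -> 0 < e <= 1 ->
  exists d, 0 < d /\ forall c, c0 < c < c0 + d -> exists a, 0 < a < e /\
    (forall x, 0 <= x <= 1 -> Gqp g q p c x <= 2 /\ I (Gqp g q p c x) - I x <= e) /\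
    (forall x y, 0 <= x -> x <= y -> y <= 1 ->
      (P c y - P c0 y) - (P c x - P c0 x) <= (1 + e) * (a * (I y - I x) + a * a)) /\
    (forall x n mu, 0 <= x -> iter (Gqp g q p c) n x <= 1 ->
      INR n * (a * a / 2) + (1 - e) *
        (2 * mu * (I (iter (Gqp g q p c) n x) - I x) - INR n * (mu * mu)) / 2
      <= (P c (iter (Gqp g q p c) n x) - P c0 (iter (Gqp g q p c) n x)) - (P c x - P c0 x)).
Proof.
intros H He. assert (HF := rs_fol H).
assert (HA := fol_fam HF).
destruct (resonant_I_lipschitz H) as [k [K [Hk [HK HI]]]].
destruct (act_estimate e H He) as [d0 [Hd0 Hact]].
set (d1 := Rmin (Rmin d0 1) (e / K)).
assert (HeK : 0 < e / K) by (apply Rdiv_lt_0_compat; lra).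
assert (Hd1 : 0 < d1 /\ d1 <= d0 /\ d1 <= 1 /\ d1 <= e / K).
{ min_bounds (Rmin (Rmin d0 1) (e / K)). unfold d1.
  split; [repeat apply Rmin_pos; lra|]. repeat split; lra. }
destruct (resonant_small_step d1 H ltac:(lra)) as [d2 [Hd2 Hsm]].
(* This will bound [a]: if [a <= k * d0], a stretch over which [I] grows by at most [a] has length
   at most [d0], where the action estimate applies. *)
set (m := Rmin e (k * d0)).
assert (Hm : 0 < m /\ m <= e /\ m <= k * d0).
{ min_bounds (Rmin e (k * d0)). unfold m.
  split; [apply Rmin_pos; nra|]. split; lra. }
exists (Rmin d2 (m * m / 2)). split; [apply Rmin_pos; nra|].
intros c Hc.
min_bounds (Rmin d2 (m * m / 2)).
assert (Hstep : forall x, 0 <= x <= 1 ->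
  x < Gqp g q p c x /\ Gqp g q p c x <= x + d1).
{ intros x Hx. split; [|apply Hsm; lra].
  apply (resonant_G_right _ _ H). lra. }
set (s := drift alpha q (- p) c0 c).
set (De := fun x => P c x - P c0 x).
(* For arbitrary end points, the relative action of [c] is at most that of the leaf [c'] joining
   them, which the action estimate bounds. *)
assert (Hup : forall x y, 0 <= x -> x <= y -> y <= 2 -> y <= x + d0 ->
  De y - De x <= s + (1 + e) * (I y - I x)^2 / 2).
{ intros x y Hx Hxy Hy Hd.
  destruct (fol_onto HF q x (y + IZR p) (rs_q H)) as [c' Hc'].
  assert (HG : Gqp g q p c' x = y) by (unfold Gqp, shifted_iter; rewrite Hc', opp_IZR; ring).
  destruct (Hact x y c' Hx ltac:(lra) Hy HG) as [_ B].
  assert (M := act_max c0 c' c x q p HF). rewrite HG in M.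
  assert (act P alpha q p c0 c x y = De y - De x - s) by (unfold act, De, s; ring). lra. }
assert (Hlo : forall x, 0 <= x <= 1 ->
  s + (1 - e) * (I (Gqp g q p c x) - I x)^2 / 2 <= De (Gqp g q p c x) - De x).
{ intros x Hx. destruct (Hstep x Hx) as [A B].
  destruct (Hact x (Gqp g q p c x) c ltac:(lra) ltac:(lra) ltac:(lra) eq_refl) as [C _].
  assert (act P alpha q p c0 c x (Gqp g q p c x) = De (Gqp g q p c x) - De x - s)
    by (unfold act, De, s; ring). lra. }
assert (Hmono : forall x y, x <= y -> De x <= De y).
{ intros x y Hxy. apply (fol_P_incr c0 c x y HF ltac:(lra) Hxy). }
assert (D1 : De 1 = c - c0).
{ unfold De. now rewrite !(fam_P_one _ HA). }
assert (D0 : De 0 = 0) by (unfold De; rewrite !(fam_P0 HA); ring).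
(* Without positive drift [De] would be at most quadratic on the right of 0, against its positive
   derivative there. *)
assert (Hs0 : 0 < s).
{ apply Rnot_le_lt; intros h.
  assert (Dd : is_derive De 0 (E c 0 - E c0 0)).
  { apply (fam_diff_derive c0 c 0 HA). }
  assert (Ep := fol_incr HF c0 c 0 ltac:(lra)). set (b := E c 0 - E c0 0) in *.
  assert (Hb : 0 < b) by (unfold b; lra).
  destruct (proj1 (is_derive_eps De 0 b) Dd (b / 2) ltac:(lra)) as [d3 [Hd3 HD]].
  assert (HKK : 0 < b / (4 * (K * K))) by (apply Rdiv_lt_0_compat; nra).
  set (y := Rmin (Rmin (d3 / 2) d1) (b / (4 * (K * K)))).
  assert (Hy : 0 < y /\ y <= d3 / 2 /\ y <= d1 /\ y <= b / (4 * (K * K))).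
  { min_bounds (Rmin (Rmin (d3 / 2) d1) (b / (4 * (K * K)))).
    unfold y. split; [repeat apply Rmin_pos; lra|]. repeat split; lra. }
  specialize (HD y ltac:(rewrite Rminus_0_r, Rabs_right; lra)).
  rewrite D0, !Rminus_0_r, (Rabs_right y) in HD by lra.
  apply Rabs_le_between in HD.
  assert (U := Hup 0 y ltac:(lra) ltac:(lra) ltac:(lra) ltac:(lra)).
  assert (V := HI 0 y ltac:(lra) ltac:(lra) ltac:(lra)). rewrite Rminus_0_r in V.
  assert (V2 : (I y - I 0)^2 <= (K * y)^2).
  { apply pow_incr. split; [|lra]. assert (0 <= k * y) by nra. lra. }
  assert (W : y * (4 * (K * K)) <= b).
  { destruct Hy as [_ [_ [_ Hy]]]. apply Rmult_le_compat_r with (r := 4 * (K * K)) in Hy; [|nra].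
    replace (b / (4 * (K * K)) * (4 * (K * K))) with b in Hy by (field; lra). exact Hy. }
  assert (W2 : (K * y)^2 <= y * b / 4).
  { assert (W3 := Rmult_le_compat_l y _ _ ltac:(lra) W). simpl. lra. }
  assert (B4 : De y <= y * b / 4).
  { rewrite D0 in U. assert (0 <= (I y - I 0)^2) by apply pow2_ge_0.
    assert ((1 + e) * (I y - I 0)^2 <= 2 * (I y - I 0)^2)
      by (apply Rmult_le_compat_r; lra). lra. }
  assert (0 < y * b) by (apply Rmult_lt_0_compat; lra). lra. }
assert (Hs1 : s <= c - c0).
{ specialize (Hlo 0 ltac:(lra)). destruct (Hstep 0 ltac:(lra)) as [A B].
  assert (B1 := Hmono (Gqp g q p c 0) 1 ltac:(lra)).
  assert (B2 := pow2_ge_0 (I (Gqp g q p c 0) - I 0)).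
  rewrite D0 in Hlo. rewrite D1 in B1. nra. }
set (a := sqrt (2 * s)).
assert (Ha : 0 < a) by (apply sqrt_lt_R0; lra).
assert (Haa : a * a = 2 * s) by (apply sqrt_sqrt; lra).
assert (Ham : a < m).
{ apply Rsqr_incrst_0; try lra. unfold Rsqr. lra. }
exists a. split; [lra|]. split; [|split].
- intros x Hx. destruct (Hstep x Hx) as [A B]. split; [lra|].
  destruct (HI x (Gqp g q p c x)) as [_ C]; try lra.
  apply Rle_trans with (1 := C).
  apply Rle_trans with (K * (e / K)); [apply Rmult_le_compat_l; lra|].
  right. field. lra.
(* When [I] grows by [a], the drift and the quadratic term are both about [a^2 / 2], the equality
   case of AM-GM. Longer stretches are therefore cut into pieces of this size. *)
- assert (Hone : forall x y, 0 <= x -> x <= y -> y <= 1 -> I y - I x <= a ->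
    De y - De x <= (1 + e) * (a * a)).
  { intros x y Hx Hxy Hy Hxa.
    assert (V := HI x y Hx Hxy ltac:(lra)).
    assert (y - x <= d0).
    { apply Rmult_le_reg_l with k; auto. lra. }
    assert (U := Hup x y Hx Hxy ltac:(lra) ltac:(lra)).
    assert (V2 : (I y - I x)^2 <= a^2).
    { apply pow_incr. split; [|lra]. assert (0 <= k * (y - x)) by nra. lra. }
    nra. }
  assert (Hn : forall n x y, 0 <= x -> x <= y -> y <= 1 -> I y - I x <= INR n * a ->
    De y - De x <= INR n * ((1 + e) * (a * a))).
  { induction n as [|n IH]; intros x y Hx Hxy Hy Hxa.
    - simpl in *. rewrite Rmult_0_l in *.
      assert (y <= x); [|assert (y = x) as -> by lra; lra].
      destruct (Rle_dec y x) as [h|h]; auto.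
      assert (L := resonant_I_incr x y H ltac:(lra)). lra.
    - rewrite S_INR in *.
      destruct (Rle_dec (I y - I x) a) as [h|h].
      + assert (U := Hone x y Hx Hxy Hy h). assert (N := pos_INR n).
        assert (0 <= INR n * ((1 + e) * (a * a))) by (apply Rmult_le_pos; nra). lra.
      + destruct (ivt I x y (I y - a)) as [z [Hz Hza]]; auto; try lra.
        { intros t. exact (derive_continuous _ _ _ (rs_I H t)). }
        assert (U := Hone z y ltac:(lra) ltac:(lra) Hy ltac:(lra)).
        assert (V := IH x z Hx ltac:(lra) ltac:(lra) ltac:(lra)). lra. }
  intros x y Hx Hxy Hy.
  assert (HIx : 0 <= I y - I x).
  { assert (L := resonant_I_le x y H Hxy). lra. }
  destruct (archimed ((I y - I x) / a)) as [A1 A2].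
  assert (Hz : 0 <= (I y - I x) / a).
  { apply Rmult_le_pos; [lra|]. left. now apply Rinv_0_lt_compat. }
  set (n := Z.to_nat (up ((I y - I x) / a))).
  assert (En : INR n = IZR (up ((I y - I x) / a))).
  { unfold n. rewrite INR_IZR_INZ, Z2Nat.id; auto. apply le_IZR. lra. }
  assert (B1 : I y - I x <= INR n * a).
  { apply Rmult_le_reg_r with (/ a); [now apply Rinv_0_lt_compat|].
    rewrite Rmult_assoc, Rinv_r by lra. unfold Rdiv in *. lra. }
  assert (B2 : INR n * a <= (I y - I x) + a).
  { apply Rmult_le_reg_r with (/ a); [now apply Rinv_0_lt_compat|].
    rewrite Rmult_assoc, Rmult_plus_distr_r, Rinv_r by lra. unfold Rdiv in *. lra. }
  assert (B3 := Hn n x y Hx Hxy Hy B1). fold (De y) (De x).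
  apply Rle_trans with (1 := B3).
  replace (INR n * ((1 + e) * (a * a))) with ((1 + e) * a * (INR n * a)) by ring.
  replace ((1 + e) * (a * (I y - I x) + a * a)) with ((1 + e) * a * ((I y - I x) + a)) by ring.
  apply Rmult_le_compat_l; nra.
- intros x n mu Hx. fold (De x). induction n as [|n IH]; intros Hn.
  + unfold iter; simpl. unfold De. lra.
  + change (iter (Gqp g q p c) (S n) x) with (Gqp g q p c (iter (Gqp g q p c) n x)) in *.
    set (z := iter (Gqp g q p c) n x) in *.
    assert (Hgr : forall t, t < Gqp g q p c t).
    { intros t. apply (resonant_G_right _ _ H). lra. }
    assert (Hz := Hgr z).
    assert (Hz0 : x <= z) by (apply (iter_le_mono (Gqp g q p c) x 0 n Hgr); lia).
    specialize (IH ltac:(lra)). fold (De z) in IH. fold (De (Gqp g q p c z)).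
    assert (L := Hlo z ltac:(lra)). rewrite S_INR.
    set (l := I (Gqp g q p c z) - I z) in *.
    replace (I (Gqp g q p c z) - I x) with (l + (I z - I x)) by (unfold l; ring).
    (* This is [l^2 >= 2 mu l - mu^2], whose right-hand side is affine in [l] and hence
       telescopes. *)
    assert (Sq : 0 <= (1 - e) * (l - mu)^2) by (apply Rmult_le_pos; [lra | apply pow2_ge_0]).
    nra.
Qed.

Lemma ratio_continuity (X0 Y0 e : R) : 0 < Y0 -> 0 < e ->
  exists d, 0 < d /\ forall X Y, Rabs (X - X0) < d -> Rabs (Y - Y0) < d ->
    0 < Y /\ Rabs (X / Y - X0 / Y0) < e.
Proof.
intros HY He.
assert (C := continuity_2d_pt_mult (fun X _ => X) (fun _ Y => / Y) X0 Y0
  (continuity_2d_pt_id1 X0 Y0)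
  (continuity_2d_pt_inv (fun _ Y => Y) X0 Y0 (continuity_2d_pt_id2 X0 Y0) ltac:(lra))).
destruct (C (mkposreal e He)) as [d Hd]. simpl in Hd.
exists (Rmin d Y0). split; [apply Rmin_pos; auto; apply cond_pos|]. intros X Y HX HY'.
min_bounds (Rmin d Y0).
split; [apply Rabs_def2 in HY'; lra|].
apply Hd; lra.
Qed.

(** In the limit [e = a = 0] the hypothesis reads [(X - L)^2 <= 0]; the preliminary bound
    [X <= 4 (J + 1)] makes the perturbation proportional to [e]. It serves for [X = n a], with [L]
    the increment of [I] over [n] steps. *)
Lemma count_inequality (X L J a e : R) : 0 <= X -> 0 <= L <= J -> 0 < a <= e -> e <= 1 ->
  X^2 + (1 - e) * L^2 <= 2 * (1 + e) * (X * L + X * a) ->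
  (X - L)^2 <= e * (J^2 + 8 * J * (J + 1) + 16 * (J + 1)).
Proof.
intros HX HL Ha He H.
assert (HXb : X <= 4 * (J + 1)).
{ destruct (Rle_dec X 0) as [h|h]; [lra|].
  apply Rmult_le_reg_l with X; [lra|].
  assert (0 <= (1 - e) * L^2) by (apply Rmult_le_pos; [lra | apply pow2_ge_0]).
  assert (X * L + X * a <= X * (J + 1)) by nra.
  assert (2 * (1 + e) * (X * L + X * a) <= 4 * (X * (J + 1))).
  { apply Rmult_le_compat; nra. }
  nra. }
assert (B1 : (X - L)^2 <= e * L^2 + 2 * e * (X * L) + 2 * (1 + e) * (X * a)) by nra.
assert (C1 : L^2 <= J^2) by (apply pow_incr; lra).
assert (C2 : X * L <= 4 * (J + 1) * J) by (apply Rmult_le_compat; lra).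
assert (C3 : X * a <= 4 * (J + 1) * e) by (apply Rmult_le_compat; lra).
assert (D1 : e * L^2 <= e * J^2) by (apply Rmult_le_compat_l; lra).
assert (D2 : 2 * e * (X * L) <= 2 * e * (4 * (J + 1) * J)) by (apply Rmult_le_compat_l; lra).
assert (D3 : 2 * (1 + e) * (X * a) <= 4 * (4 * (J + 1) * e)).
{ apply Rmult_le_compat; try lra. nra. }
lra.
Qed.

(** The upper and lower bounds of [resonant_bounds] nearly coincide along an orbit. Being close to
    equality in AM-GM then forces the steps, measured by [I], to have mean almost [a]. *)
Lemma resonant_counts {E P g alpha} {c0 : R} (e : R) {q : nat} {p : Z} {T T_r : R -> R -> R}
    {I : R -> R} :
  resonant E P g alpha c0 q p T T_r I -> 0 < e ->
  exists d, 0 < d /\ forall c, c0 < c < c0 + d -> exists a, 0 < a < e /\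
    (forall x, 0 <= x <= 1 -> I (Gqp g q p c x) - I x <= e) /\
    (forall x, 0 <= x <= 1 -> Rabs ((P c x - P c0 x) / a - I x) <= e) /\
    (forall x n, 0 <= x -> iter (Gqp g q p c) n x <= 1 ->
      Rabs (INR n * a - (I (iter (Gqp g q p c) n x) - I x)) <= e).
Proof.
intros H He. assert (HF := rs_fol H).
assert (HA := fol_fam HF). assert (I0 := rs_I0 H).
set (J := I 1).
assert (HJ : 0 < J).
{ unfold J. rewrite <- I0. apply (resonant_I_incr _ _ H). lra. }
set (M := J^2 + 8 * J * (J + 1) + 16 * (J + 1)).
assert (HM : 0 < M) by (unfold M; nra).
(* [M] is the constant of [count_inequality], so [b * M <= e^2] controls the counts;
   [b * (J + 2) <= e] absorbs the error in the bounds for [P c - P c0]. *)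
set (b := Rmin (Rmin 1 e) (Rmin (e / (J + 2)) (e^2 / M))).
assert (P1 : 0 < e / (J + 2)) by (apply Rdiv_lt_0_compat; lra).
assert (P2 : 0 < e^2 / M) by (apply Rdiv_lt_0_compat; nra).
assert (Hb : 0 < b /\ b <= 1 /\ b <= e /\ b <= e / (J + 2) /\ b <= e^2 / M).
{ min_bounds (Rmin (Rmin 1 e) (Rmin (e / (J + 2)) (e^2 / M))).
  unfold b. split; [repeat apply Rmin_pos; lra|]. repeat split; lra. }
destruct Hb as [Hb0 [Hb1 [Hbe [Hb2 Hb3]]]].
assert (Hb2' : b * (J + 2) <= e).
{ apply Rmult_le_compat_r with (r := J + 2) in Hb2; [|lra].
  replace (e / (J + 2) * (J + 2)) with e in Hb2 by (field; lra). exact Hb2. }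
assert (Hb3' : b * M <= e^2).
{ apply Rmult_le_compat_r with (r := M) in Hb3; [|lra].
  replace (e^2 / M * M) with (e^2) in Hb3 by (field; lra). exact Hb3. }
destruct (resonant_bounds b H (conj Hb0 Hb1)) as [d [Hd HB]].
exists d. split; auto. intros c Hc.
destruct (HB c Hc) as [a [Ha [HG [Hup Hlo]]]]. clear HB.
exists a. split; [lra|].
assert (Hmono : forall x y, x <= y -> P c x - P c0 x <= P c y - P c0 y).
{ intros x y Hxy. apply (fol_P_incr c0 c x y HF ltac:(lra) Hxy). }
assert (Hgr : forall t, t < Gqp g q p c t).
{ intros t. apply (resonant_G_right _ _ H). lra. }
assert (HGl : circle_lift (Gqp g q p c)) by apply (circle_lift_shifted _ _ _ (fam_cl HA c)).
assert (Hz : P c 0 - P c0 0 = 0) by (rewrite !(fam_P0 HA); ring).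
assert (HI1 : forall x, 0 <= x <= 1 -> 0 <= I x <= J).
{ intros x Hx. split; [rewrite <- I0|unfold J];
  apply (resonant_I_le _ _ H); lra. }
split; [|split].
- intros x Hx. destruct (HG x Hx) as [_ A]. lra.
- intros x Hx. specialize (HI1 x Hx).
  assert (U := Hup 0 x ltac:(lra) ltac:(lra) ltac:(lra)). rewrite I0, Hz in U.
  destruct (iter_bracket (Gqp g q p c) 0 x HGl Hgr (proj1 Hx)) as [n [N1 N2]].
  assert (L := Hlo 0 n a ltac:(lra) ltac:(lra)). rewrite I0, Hz in L.
  assert (L2 := Hmono _ _ N1).
  set (z := iter (Gqp g q p c) n 0) in *.
  change (iter (Gqp g q p c) (S n) 0) with (Gqp g q p c z) in N2.
  assert (Hz0 : 0 <= z) by (apply (iter_le_mono (Gqp g q p c) 0 0 n Hgr); lia).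
  destruct (HG z ltac:(lra)) as [_ A].
  assert (B := resonant_I_incr _ _ H N2).
  assert (Nn := pos_INR n).
  set (D := P c x - P c0 x) in *.
  assert (E1 : 0 <= b * (INR n * (a * a) / 2)) by (apply Rmult_le_pos; nra).
  assert (E2 : (1 - b) * (a * I z) <= D) by lra.
  assert (E3 : (1 - b) * (a * (I x - b)) <= D).
  { apply Rle_trans with (2 := E2). apply Rmult_le_compat_l; [lra|].
    apply Rmult_le_compat_l; lra. }
  assert (F1 : D / a <= I x + e).
  { apply Rmult_le_reg_r with a; [lra|].
    replace (D / a * a) with D by (field; lra).
    assert (D <= (1 + b) * (a * (I x + b))).
    { apply Rle_trans with ((1 + b) * (a * (I x - 0) + a * a)); [lra|].
      apply Rmult_le_compat_l; nra. }
    assert ((1 + b) * (I x + b) <= I x + e) by nra. nra. }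
  assert (F2 : I x - e <= D / a).
  { apply Rmult_le_reg_r with a; [lra|].
    replace (D / a * a) with D by (field; lra).
    assert (I x - e <= (1 - b) * (I x - b)) by nra. nra. }
  abs_lra.
- intros x n Hx Hn.
  set (z := iter (Gqp g q p c) n x) in *.
  assert (Hz0 : x <= z) by (apply (iter_le_mono (Gqp g q p c) x 0 n Hgr); lia).
  assert (HIz := resonant_I_le _ _ H Hz0).
  assert (Hz1 := HI1 z ltac:(lra)). assert (Hx1 := HI1 x ltac:(lra)).
  set (L := I z - I x) in *. assert (HL : 0 <= L <= J) by (unfold L; lra).
  destruct n as [|n].
  + unfold L, z, iter; simpl. replace (0 * a - (I x - I x)) with 0 by ring. rewrite Rabs_R0. lra.
  + set (nn := INR (S n)) in *.
    assert (Hnn : 0 < nn) by (apply lt_0_INR; lia).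
    (* The mean increment of [I] per step is the value of [mu] that maximises the lower bound. *)
    assert (A := Hlo x (S n) (L / nn) Hx Hn). fold z L nn in A.
    assert (U := Hup x z Hx Hz0 Hn). fold L in U.
    assert (Sq : (nn * a - L)^2 <= b * M).
    { apply (count_inequality _ _ _ a); try lra; [nra|].
      assert (K : nn * (a * a / 2) + (1 - b) * (2 * (L / nn) * L - nn * (L / nn * (L / nn))) / 2
        <= (1 + b) * (a * L + a * a)) by lra.
      apply Rmult_le_compat_l with (r := 2 * nn) in K; [|lra].
      replace (2 * nn * (nn * (a * a / 2) +
        (1 - b) * (2 * (L / nn) * L - nn * (L / nn * (L / nn))) / 2))
        with ((nn * a)^2 + (1 - b) * L^2) in K by (field; lra).
      replace (2 * nn * ((1 + b) * (a * L + a * a)))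
        with (2 * (1 + b) * (nn * a * L + nn * a * a)) in K by ring. exact K. }
    assert (Sq2 : Rsqr (nn * a - L) <= Rsqr e) by (unfold Rsqr; simpl in Sq, Hb3'; lra).
    apply Rsqr_le_abs_0 in Sq2. now rewrite (Rabs_right e) in Sq2 by lra.
Qed.

(** The quotient based at [c0] results from dividing the estimates of [P c - P c0] at [x] and at 1.
    The slopes at [c] result from step counts: about [I x / a] steps lead from 0 to [x], and about
    [I 1 / a] from 0 to 1. *)
Lemma resonant_right {E P g alpha} {c0 : R} (x e : R) {q : nat} {p : Z} {T T_r : R -> R -> R}
    {I : R -> R} :
  resonant E P g alpha c0 q p T T_r I -> 0 <= x <= 1 -> 0 < e ->
  exists d, 0 < d /\ forall c, c0 < c < c0 + d ->
    Rabs (quot P x c0 c - I x / I 1) < e /\ near_slope P x c e (I x / I 1).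
Proof.
intros H Hx He. assert (HF := rs_fol H).
assert (HA := fol_fam HF). assert (I0 := rs_I0 H).
set (J := I 1).
assert (HJ : 0 < J).
{ unfold J. rewrite <- I0. apply (resonant_I_incr _ _ H). lra. }
destruct (ratio_continuity (I x) J e HJ He) as [d1 [D1 R1]].
destruct (ratio_continuity (J - I x) J e HJ He) as [d2 [D2 R2]].
(* A count times [a] misses the increment of [I] by at most [2 * b], and shifting the count by one
   costs another [a < b]. *)
set (b := Rmin d1 d2 / 4).
assert (Hb : 0 < b /\ 4 * b <= d1 /\ 4 * b <= d2).
{ min_bounds (Rmin d1 d2).
  assert (0 < Rmin d1 d2) by now apply Rmin_pos. unfold b. lra. }
destruct (resonant_counts b H (proj1 Hb)) as [d [Hd HC]].
exists d. split; auto. intros c Hc.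
destruct (HC c Hc) as [a [Ha [Hst [HD HN]]]].
split.
- assert (B1 := HD x Hx). assert (B2 := HD 1 ltac:(lra)). rewrite !(fam_P_one _ HA) in B2. fold J in B2.
  destruct (R1 ((P c x - P c0 x) / a) ((c - c0) / a) ltac:(lra) ltac:(lra)) as [_ B].
  replace (quot P x c0 c) with ((P c x - P c0 x) / a / ((c - c0) / a)); auto.
  unfold quot. field. lra.
- assert (Hgr : forall t, t < Gqp g q p c t).
  { intros t. apply (resonant_G_right _ _ H). lra. }
  assert (HGl : circle_lift (Gqp g q p c)) by apply (circle_lift_shifted _ _ _ (fam_cl HA c)).
  assert (Hcnt : forall y z, 0 <= y -> y <= z -> z <= 1 -> exists n,
    iter (Gqp g q p c) n y <= z < iter (Gqp g q p c) (S n) y /\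
    Rabs (INR n * a - (I z - I y)) <= 2 * b).
  { intros y z Hy Hyz Hz.
    destruct (iter_bracket (Gqp g q p c) y z HGl Hgr Hyz) as [n [N1 N2]].
    exists n. split; [now split|]. assert (A := HN y n Hy ltac:(lra)).
    set (w := iter (Gqp g q p c) n y) in *.
    change (iter (Gqp g q p c) (S n) y) with (Gqp g q p c w) in N2.
    assert (Hw : y <= w) by (apply (iter_le_mono (Gqp g q p c) y 0 n Hgr); lia).
    assert (B := Hst w ltac:(lra)).
    assert (C1 := resonant_I_incr _ _ H N2).
    assert (C2 := resonant_I_le _ _ H N1).
    abs_lra. }
  destruct (Hcnt 0 x ltac:(lra) ltac:(lra) ltac:(lra)) as [N [[_ N1] N2]].
  destruct (Hcnt x 1 ltac:(lra) ltac:(lra) ltac:(lra)) as [N' [[_ N1'] N2']].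
  destruct (Hcnt 0 1 ltac:(lra) ltac:(lra) ltac:(lra)) as [K0 [[K1 _] K2]].
  rewrite I0 in N2, K2. fold J in N2', K2.
  apply Rabs_le_between in N2. apply Rabs_le_between in N2'. apply Rabs_le_between in K2.
  (* [R1] also asserts positivity: at [Y = J - 3 * b] it gives [3 * b < J], so at least one step
     fits into [0,1]. *)
  assert (HK1 : (1 <= K0)%nat).
  { destruct K0; [|lia]. exfalso. simpl in K2.
    destruct (R1 (I x) (J - 3 * b)) as [Q _]; [| |lra].
    - rewrite Rminus_diag, Rabs_R0. lra.
    - replace (J - 3 * b - J) with (- (3 * b)) by ring.
      rewrite Rabs_Ropp, Rabs_right; lra. }
  set (K := (K0 - 1)%nat).
  assert (EK : INR K0 = INR K + 1) by (unfold K; rewrite minus_INR; [simpl; ring | lia]).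
  assert (HK : iter (Gqp g q p c) K 0 < 1).
  { apply Rlt_le_trans with (2 := K1). replace K0 with (S K) by (unfold K; lia).
    apply Hgr. }
  destruct (step_count c x q (S N) (S N') K (- p) HF N1 N1' HK) as [d3 [Hd3 HS]].
  rewrite EK in K2.
  destruct (R1 (INR (S N) * a) (INR K * a)) as [Y1 X1].
  { rewrite S_INR. abs_lra. }
  { abs_lra. }
  destruct (R2 (INR (S N') * a) (INR K * a)) as [_ X2].
  { rewrite S_INR. abs_lra. }
  { abs_lra. }
  assert (PK : 0 < INR K) by (apply Rmult_lt_reg_r with a; lra).
  replace (INR (S N) * a / (INR K * a)) with (INR (S N) / INR K) in X1 by (field; lra).
  replace (INR (S N') * a / (INR K * a)) with (INR (S N') / INR K) in X2 by (field; lra).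
  replace ((J - I x) / J) with (1 - I x / J) in X2 by (field; lra).
  apply Rabs_def2 in X1. apply Rabs_def2 in X2.
  assert (HQ : forall c1 c2, Rabs (c1 - c) < d3 -> Rabs (c2 - c) < d3 -> c1 < c2 ->
    Rabs (quot P x c1 c2 - I x / J) < e).
  { intros c1 c2 H1 H2 H12. destruct (HS c1 c2 H1 H2 H12) as [A [B _]].
    assert (Q1 : quot P x c1 c2 <= INR (S N) / INR K).
    { unfold quot. apply Rmult_le_reg_r with (INR K * (c2 - c1)); [nra|].
      replace ((P c2 x - P c1 x) / (c2 - c1) * (INR K * (c2 - c1)))
        with (INR K * (P c2 x - P c1 x)) by (field; lra).
      replace (INR (S N) / INR K * (INR K * (c2 - c1))) with (INR (S N) * (c2 - c1))
        by (field; lra). exact A. }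
    assert (Q2 : 1 - quot P x c1 c2 <= INR (S N') / INR K).
    { unfold quot. apply Rmult_le_reg_r with (INR K * (c2 - c1)); [nra|].
      replace ((1 - (P c2 x - P c1 x) / (c2 - c1)) * (INR K * (c2 - c1)))
        with (INR K * (c2 - c1 - (P c2 x - P c1 x))) by (field; lra).
      replace (INR (S N') / INR K * (INR K * (c2 - c1))) with (INR (S N') * (c2 - c1))
        by (field; lra). exact B. }
    abs_lra. }
  assert (Z0 : Rabs (c - c) < d3) by (rewrite Rminus_diag, Rabs_R0; exact Hd3).
  exists d3. split; auto. intros c' [Hc1 Hc2].
  destruct (Rtotal_order c c') as [h|[h|h]].
  + now apply HQ.
  + rewrite h, Rminus_diag, Rabs_R0 in Hc1. lra.
  + rewrite quot_sym by lra. now apply HQ.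
Qed.

(** * The reflection symmetry and two-sided slopes *)

Definition reflect (f : R -> R -> R) (x y : R) : R := f (- x) (- y).

Lemma cont2_reflect (f : R -> R -> R) : cont2 f -> cont2 (reflect f).
Proof.
intros Hf. apply (cont2_comp2 f (fun x _ => - x) (fun _ y => - y) Hf);
apply cont2_opp; [apply cont2_fst | apply cont2_snd].
Qed.

Lemma is_derive_reflect (f : R -> R) (x l : R) :
  is_derive f (- x) l -> is_derive (fun y => f (- y)) x (- l).
Proof.
intros H. replace (- l) with (scal (-1) l) by (unfold scal; simpl; unfold mult; simpl; ring).
apply (is_derive_comp f (fun y => - y)); auto.
auto_derive; auto; ring.
Qed.

Lemma continuous_reflect (f : R -> R) (x : R) :
  continuous f (- x) -> continuous (fun y => f (- y)) x.
Proof.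
intros H. apply (continuous_comp (fun y => - y) f); auto.
apply (continuous_opp (fun y : R => y)), continuous_id.
Qed.

Lemma circle_lift_reflect (g : R -> R) : circle_lift g -> circle_lift (fun t => - g (- t)).
Proof.
intros Hg. split.
- intros x y H. assert (L := cl_incr g Hg (- y) (- x) ltac:(lra)). lra.
- intros x. apply (continuous_opp (fun y => g (- y))), continuous_reflect, (cl_cont g Hg).
- intros x. assert (L := cl_deg g Hg (- x - 1)).
  replace (- x - 1 + 1) with (- x) in L by ring.
  replace (- (x + 1)) with (- x - 1) by ring. lra.
Qed.

Lemma iter_reflect (g : R -> R) (n : nat) (t : R) :
  iter (fun t => - g (- t)) n t = - iter g n (- t).
Proof.
induction n as [|n IH]; [unfold iter; simpl; ring|].
change (iter (fun t => - g (- t)) (S n) t) with (- g (- iter (fun t => - g (- t)) n t)).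
rewrite IH, Ropp_involutive. reflexivity.
Qed.

(* The symmetry [(theta, r, c) -> (-theta, -r, -c)] exchanges the two sides of a leaf. *)
Lemma family_reflect {E P g alpha} :
  family E P g alpha ->
  family (fun c t => - reflect E c t) (reflect P) (fun c t => - reflect g c t)
    (fun c => alpha (- c)).
Proof.
intros [H1 H2 H3 H4 H5 H6 H7]. unfold reflect. split.
- apply cont2_opp, (cont2_reflect E H1).
- intros c t. apply (is_derive_reflect (P (- c))), H2.
- intros c. now rewrite Ropp_0, H3.
- intros c t. assert (L := H4 (- c) (- t - 1)).
  replace (- t - 1 + 1) with (- t) in L by ring.
  replace (- (t + 1)) with (- t - 1) by ring. lra.
- apply cont2_opp, (cont2_reflect g H5).
- intros c. apply circle_lift_reflect, H6.
- intros c c' t. rewrite !Ropp_involutive. apply H7.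
Qed.

Lemma foliated_reflect {E P g alpha} :
  foliated E P g alpha ->
  foliated (fun c t => - reflect E c t) (reflect P) (fun c t => - reflect g c t)
    (fun c => alpha (- c)).
Proof.
intros [H1 H2 H3 H4 H5 H6]. split.
- now apply family_reflect.
- intros c c' t Hc. unfold reflect. specialize (H2 (- c') (- c) (- t) ltac:(lra)). lra.
- intros c c' t Hc. unfold reflect. specialize (H3 (- c') (- c) (- t) ltac:(lra)). lra.
- intros q t x Hq. destruct (H4 q (- t) (- x) Hq) as [c Hc]. exists (- c).
  unfold reflect. rewrite iter_reflect, Ropp_involutive, Hc. ring.
- intros c q p x Hq. unfold reflect. rewrite iter_reflect. intros Hx y.
  rewrite iter_reflect, (H5 (- c) q (- p)%Z (- x) Hq), opp_IZR; [ring|].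
  rewrite opp_IZR. lra.
- intros q Hq. destruct (H6 q Hq) as [T [T_r [K1 [K2 [K3 [K4 K5]]]]]].
  exists (fun t r => - reflect T t r), (reflect T_r). unfold reflect.
  split; [|split; [|split; [|split]]].
  + now apply cont2_reflect.
  + intros t r. replace (T_r (- t) (- r)) with (- - T_r (- t) (- r)) by ring.
    apply (is_derive_opp (fun r => T (- t) (- r))), (is_derive_reflect (T (- t))), K2.
  + intros t r. apply K3.
  + intros t r. rewrite <- (K4 (- (t + 1))). f_equal. ring.
  + intros c t. rewrite iter_reflect, K5. now rewrite Ropp_involutive.
Qed.

Lemma fam_E_per {E P g alpha} (c t : R) :
  family E P g alpha -> E c (t + 1) = E c t.
Proof.
intros HF.
assert (D1 : is_derive (fun s => P c (s + 1)) t (E c (t + 1))).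
{ replace (E c (t + 1)) with (scal 1 (E c (t + 1))) by (apply Rmult_1_l).
  apply (is_derive_comp (P c) (fun s => s + 1)); [apply (fam_P HF)|].
  auto_derive; auto; ring. }
assert (D2 : is_derive (fun s => P c (s + 1)) t (E c t)).
{ apply (is_derive_ext (fun s => P c s + c)).
  - intros s. now rewrite (fam_P1 HF).
  - replace (E c t) with (plus (E c t) 0) by (unfold plus; simpl; ring).
    apply (is_derive_plus (V := R_NormedModule)); [apply (fam_P HF)|].
    apply (is_derive_const (V := R_NormedModule)). }
now rewrite <- (is_derive_unique _ _ _ D1), (is_derive_unique _ _ _ D2).
Qed.

Lemma resonant_I_shift {E P g alpha} {c0 : R} (t : R) {q : nat} {p : Z} {T T_r : R -> R -> R}
    {I : R -> R} :
  resonant E P g alpha c0 q p T T_r I -> I (t + 1) = I t + I 1.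
Proof.
intros H. assert (HA := fol_fam (rs_fol H)).
assert (L := derive_zero_const (fun t => I (t + 1) - I t) t 0). simpl in L.
rewrite Rplus_0_l, (rs_I0 H) in L.
assert (D : forall x, is_derive (fun t => I (t + 1) - I t) x 0).
{ intros x. assert (Dx := rs_I H).
  assert (D1 : is_derive (fun s => I (s + 1)) x (/ sqrt (T_r x (E c0 x)))).
  { replace (/ sqrt (T_r x (E c0 x))) with (scal 1 (/ sqrt (T_r x (E c0 x))))
      by (apply Rmult_1_l).
    apply (is_derive_comp I (fun s => s + 1)).
    - rewrite <- (rs_per H), <- (fam_E_per c0 x HA). apply Dx.
    - auto_derive; auto; ring. }
  replace 0 with (minus (/ sqrt (T_r x (E c0 x))) (/ sqrt (T_r x (E c0 x))))
    by (unfold minus, plus, opp; simpl; ring).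
  apply (is_derive_minus (fun s => I (s + 1)) I); auto. }
specialize (L D). lra.
Qed.

Lemma resonant_reflect {E P g alpha} {c0 : R} {q : nat} {p : Z} {T T_r : R -> R -> R}
    {I : R -> R} :
  resonant E P g alpha c0 q p T T_r I ->
  resonant (fun c t => - reflect E c t) (reflect P) (fun c t => - reflect g c t)
    (fun c => alpha (- c)) (- c0) q (- p) (fun t r => - reflect T t r) (reflect T_r)
    (fun t => - I (- t)).
Proof.
intros [H1 H2 H3 H4 H5 H6 H7 H8 H9 H10]. unfold reflect. split; auto.
- now apply foliated_reflect.
- intros y. rewrite iter_reflect, Ropp_involutive, H3, opp_IZR. ring.
- now apply cont2_reflect.
- intros t r. replace (T_r (- t) (- r)) with (- - T_r (- t) (- r)) by ring.
  apply (is_derive_opp (fun r => T (- t) (- r))), (is_derive_reflect (T (- t))), H5.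
- intros t r. rewrite <- (H7 (- (t + 1))). f_equal. ring.
- intros c t. rewrite iter_reflect, H8. now rewrite Ropp_involutive.
- rewrite Ropp_0, H9. ring.
- intros t. rewrite !Ropp_involutive.
  replace (/ sqrt (T_r (- t) (E c0 (- t)))) with (- - / sqrt (T_r (- t) (E c0 (- t)))) by ring.
  apply (is_derive_opp (fun t => I (- t))), (is_derive_reflect I), H10.
Qed.

(** The right-hand estimates for the reflected family are the left-hand ones for the given family.
    The reflected base point is [1 - x] instead of [- x], to stay in [0,1]; this replaces slopes by
    their complements to 1. At [c0] itself the quotients towards both sides are used. *)
Lemma resonant_slope {E P g alpha} {c0 : R} (x e : R) {q : nat} {p : Z} {T T_r : R -> R -> R}
    {I : R -> R} :
  resonant E P g alpha c0 q p T T_r I -> 0 <= x <= 1 -> 0 < e ->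
  exists d, 0 < d /\ forall c, Rabs (c - c0) < d -> near_slope P x c e (I x / I 1).
Proof.
intros H Hx He. assert (HF := rs_fol H).
assert (HA := fol_fam HF). assert (I0 := rs_I0 H).
destruct (resonant_right x e H Hx He) as [d1 [Hd1 R1]].
destruct (resonant_right (1 - x) e (resonant_reflect H)
  ltac:(lra) He) as [d2 [Hd2 R2]].
assert (HJ : 0 < I 1).
{ rewrite <- I0. apply (resonant_I_incr _ _ H). lra. }
assert (El : - I (- (1 - x)) / - I (- (1)) = 1 - I x / I 1).
{ assert (A := resonant_I_shift (- (1 - x)) H).
  assert (B := resonant_I_shift (- (1)) H).
  replace (- (1 - x) + 1) with x in A by ring.
  replace (- (1) + 1) with 0 in B by ring. rewrite I0 in B.
  replace (I (- (1 - x))) with (I x - I 1) by lra.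
  replace (I (- (1))) with (- I 1) by lra. field. lra. }
rewrite El in R2.
assert (Eq : forall a b, a <> b ->
  quot (reflect P) (1 - x) (- a) (- b) - (1 - I x / I 1) = - (quot P x a b - I x / I 1)).
{ intros a b Hab.
  assert (Ep : forall c, P c x = P c (- (1 - x)) + c).
  { intros c. rewrite <- (fam_P1 HA). f_equal. ring. }
  unfold quot, reflect. rewrite !Ropp_involutive, !Ep. field.
  split; [lra|]. split; lra. }
exists (Rmin d1 d2). split; [now apply Rmin_pos|]. intros c Hc.
min_bounds (Rmin d1 d2).
destruct (Rtotal_order c c0) as [h|[->|h]].
- apply Rabs_def2 in Hc. destruct (R2 (- c) ltac:(lra)) as [_ [d [Hd N]]].
  exists d. split; auto. intros c' Hc'.
  assert (Hne : c <> c').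
  { intros <-. rewrite Rminus_diag, Rabs_R0 in Hc'. lra. }
  assert (A := N (- c')). replace (- c' - - c) with (- (c' - c)) in A by ring.
  rewrite Rabs_Ropp in A. specialize (A Hc'). now rewrite Eq, Rabs_Ropp in A.
- exists (Rmin d1 d2). split; [now apply Rmin_pos|]. intros c [Hc1 Hc2].
  apply Rabs_def2 in Hc2.
  destruct (Rtotal_order c c0) as [h|[h|h]].
  + destruct (R2 (- c) ltac:(lra)) as [A _]. rewrite Eq, Rabs_Ropp in A by lra. exact A.
  + rewrite h, Rminus_diag, Rabs_R0 in Hc1. lra.
  + now destruct (R1 c ltac:(lra)).
- apply Rabs_def2 in Hc. now destruct (R1 c ltac:(lra)).
Qed.

Lemma foliated_dichotomy {E P g alpha} (c0 : R) :
  foliated E P g alpha -> aperiodic (g c0) \/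
  exists q p T T_r I, resonant E P g alpha c0 q p T T_r I.
Proof.
intros HF. destruct (classic (aperiodic (g c0))) as [h|h]; [now left | right].
destruct (not_aperiodic _ h) as [q [p [x [Hq Hx]]]]. clear h.
assert (Hid := fol_per HF c0 q p x Hq Hx).
destruct (fol_twist HF q Hq) as [T [T_r [H1 [H2 [H3 [H4 H5]]]]]].
destruct (primitive (fun t => / sqrt (T_r t (E c0 t)))) as [I [HI0 HI]].
- intros t. apply (continuous_comp (fun t => sqrt (T_r t (E c0 t))) Rinv).
  + apply (continuous_comp (fun t => T_r t (E c0 t)) sqrt); [|apply continuous_sqrt].
    apply (cont2_comp T_r (fun t => t) (E c0)); auto. apply continuous_id.
    apply cont2_right, (fam_E (fol_fam HF)).
  + apply continuous_Rinv, Rgt_not_eq, sqrt_lt_R0, H3.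
- exists q, p, T, T_r, I. now split.
Qed.

Lemma foliated_slope {E P g alpha} (c0 x : R) :
  foliated E P g alpha -> uniform_slope P c0 x.
Proof.
intros HF. assert (HA := fol_fam HF).
replace x with (x - IZR (Int_part x) + IZR (Int_part x)) by ring.
apply (uniform_slope_shift _ _ _ HA).
destruct (frac_part_bounds x). set (y := x - IZR (Int_part x)) in *.
destruct (foliated_dichotomy c0 HF) as [h|[q [p [T [T_r [I h]]]]]].
- apply (aperiodic_slope _ _ HF h). lra.
- intros e He. exists (I y / I 1).
  now apply (resonant_slope y e h ltac:(lra)).
Qed.

(** The derivative [h] is continuous in each variable separately, and monotonicity in [x] upgrades
    this to joint continuity: near [(c, x)] the value of [h] lies between those at [x - d / 2] and
    [x + d / 2], where continuity in [c] suffices. *)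
Theorem foliated_C1 {E P g alpha} :
  foliated E P g alpha ->
  exists h, cont2 h /\ forall c x, is_derive (fun c' => P c' x) c (h c x).
Proof.
intros HF. assert (HA := fol_fam HF).
destruct (functional_choice (fun z h => is_derive (fun c' => P c' (snd z)) (fst z) h))
  as [h0 Hh0].
{ intros z. apply uniform_slope_derive, (foliated_slope _ _ HF). }
set (h := fun c x => h0 (c, x)).
assert (Hh : forall c x, is_derive (fun c' => P c' x) c (h c x)).
{ intros c x. apply (Hh0 (c, x)). }
clearbody h. exists h. split; auto.
assert (Hc1 : forall c x, continuous (fun c => h c x) c).
{ intros c x. apply (uniform_slope_continuous P h); auto.
  apply (foliated_slope _ _ HF). }
assert (Hmono : forall c x y, x <= y -> h c x <= h c y).
{ intros c x y Hxy.
  assert (D := is_derive_minus _ _ _ _ _ (Hh c y) (Hh c x)).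
  unfold minus, plus, opp in D; simpl in D.
  apply incr_derive_nonneg in D; [lra|]. intros c' Hc'.
  assert (L := fol_P_incr c c' x y HF Hc' Hxy). lra. }
assert (Hc2 : forall c x, continuous (h c) x).
{ intros c. destruct (foliated_dichotomy c HF) as [k|[q [p [T [T_r [I k]]]]]].
  - apply (aperiodic_continuous h c HF k Hh). apply Hmono.
  - assert (HJ : I 1 <> 0).
    { assert (L := resonant_I_incr 0 1 k ltac:(lra)).
      rewrite (rs_I0 k) in L. lra. }
    assert (Eh : forall x, h c x - I x / I 1 = 0).
    { intros x. destruct (periodic_shift_unit (fun x => h c x - I x / I 1) x) as [y [Hy [<- _]]].
      - intros y. rewrite (resonant_I_shift y k).
        assert (D : is_derive (fun c' => P c' (y + 1)) c (h c y + 1)).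
        { apply (is_derive_ext (fun c' => P c' y + c')).
          - intros c'. now rewrite (fam_P1 HA).
          - apply (is_derive_plus (fun c' => P c' y) (fun c' => c')); [apply Hh|].
            apply (is_derive_id (K := R_AbsRing)). }
        assert (E1 : h c (y + 1) = h c y + 1).
        { now rewrite <- (is_derive_unique _ _ _ D), (is_derive_unique _ _ _ (Hh c (y + 1))). }
        rewrite E1. field. exact HJ.
      - assert (A : forall e, 0 < e -> Rabs (h c y - I y / I 1) <= e).
        { intros e He. destruct (resonant_slope y e k ltac:(lra) He)
            as [d [Hd N]].
          apply (derive_near_slope P c y); auto. apply N. now rewrite Rminus_diag, Rabs_R0. }
        apply Rabs_eq_0, Rle_antisym; [|apply Rabs_pos]. apply le_epsilon.
        intros e He. specialize (A e He). lra. }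
    intros x. apply (continuous_ext (fun x => I x / I 1)).
    + intros y. specialize (Eh y). lra.
    + apply (continuous_mult I (fun _ => / I 1)); [|apply continuous_const].
      exact (derive_continuous _ _ _ (rs_I k x)). }
intros c x e.
destruct (proj1 (continuous_eps (h c) x) (Hc2 c x) (e / 2)) as [d [Hd B]].
{ assert (He := cond_pos e). lra. }
destruct (proj1 (continuous_eps _ _) (Hc1 c (x - d / 2)) (e / 2)) as [d1 [Hd1 B1]].
{ assert (He := cond_pos e). lra. }
destruct (proj1 (continuous_eps _ _) (Hc1 c (x + d / 2)) (e / 2)) as [d2 [Hd2 B2]].
{ assert (He := cond_pos e). lra. }
assert (Hm : 0 < Rmin (d / 2) (Rmin d1 d2)) by (repeat apply Rmin_pos; lra).
exists (mkposreal _ Hm). simpl. intros c' y Hc' Hy.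
min_bounds (Rmin (d / 2) (Rmin d1 d2)).
apply Rabs_def2 in Hy.
assert (A1 := B (x - d / 2) ltac:(abs_lra)).
assert (A2 := B (x + d / 2) ltac:(abs_lra)).
specialize (B1 c' ltac:(lra)). specialize (B2 c' ltac:(lra)).
assert (C1 := Hmono c' (x - d / 2) y ltac:(lra)).
assert (C2 := Hmono c' y (x + d / 2) ltac:(lra)).
abs_lra.
Qed.

(** * Generating functions and calibrated leaves *)

Record generated (s s1 s2 F1 F2 : R -> R -> R) : Prop := {
  gn_d1 : forall x y, is_derive (fun t => s t y) x (s1 x y);
  gn_d2 : forall x y, is_derive (s x) y (s2 x y);
  gn_c1 : cont2 s1;
  gn_c2 : cont2 s2;
  gn_per : forall x y, s (x + 1) (y + 1) = s x y;
  gn_per1 : forall x y, s1 (x + 1) (y + 1) = s1 x y;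
  gn_per2 : forall x y, s2 (x + 1) (y + 1) = s2 x y;
  gn_coercive : forall M, exists K, forall x y, K < Rabs (y - x) -> M * Rabs (y - x) < s x y;
  gn_dec1 : forall x y y', y < y' -> s1 x y' < s1 x y;
  gn_dec2 : forall x x' y, x < x' -> s2 x' y < s2 x y;
  gn_cF1 : cont2 F1;
  gn_cF2 : cont2 F2;
  gn_F : forall x r, r = - s1 x (F1 x r) /\ F2 x r = s2 x (F1 x r);
  gn_F1 : forall x y, F1 x (- s1 x y) = y }.

Arguments gn_d1 {s s1 s2 F1 F2} _.
Arguments gn_d2 {s s1 s2 F1 F2} _.
Arguments gn_c1 {s s1 s2 F1 F2} _.
Arguments gn_c2 {s s1 s2 F1 F2} _.
Arguments gn_per {s s1 s2 F1 F2} _.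
Arguments gn_per1 {s s1 s2 F1 F2} _.
Arguments gn_per2 {s s1 s2 F1 F2} _.
Arguments gn_coercive {s s1 s2 F1 F2} _.
Arguments gn_dec1 {s s1 s2 F1 F2} _.
Arguments gn_dec2 {s s1 s2 F1 F2} _.
Arguments gn_cF1 {s s1 s2 F1 F2} _.
Arguments gn_cF2 {s s1 s2 F1 F2} _.
Arguments gn_F {s s1 s2 F1 F2} _.
Arguments gn_F1 {s s1 s2 F1 F2} _.

Lemma gn_inj1 {s s1 s2 F1 F2 : R -> R -> R} (x y y' : R) :
  generated s s1 s2 F1 F2 -> s1 x y = s1 x y' -> y = y'.
Proof.
intros H E. rewrite <- (gn_F1 H x y), <- (gn_F1 H x y').
now rewrite E.
Qed.

Lemma gn_inj2 {s s1 s2 F1 F2 : R -> R -> R} (x x' y : R) :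
  generated s s1 s2 F1 F2 -> s2 x y = s2 x' y -> x = x'.
Proof.
intros H E. destruct (Rtotal_order x x') as [h|[h|h]]; auto;
apply (fun k => gn_dec2 H _ _ y k) in h; lra.
Qed.

Lemma gn_F1_incr {s s1 s2 F1 F2 : R -> R -> R} (x r r' : R) :
  generated s s1 s2 F1 F2 -> r < r' -> F1 x r < F1 x r'.
Proof.
intros H Hr. apply Rnot_le_lt; intros h.
destruct (gn_F H x r) as [E1 _]. destruct (gn_F H x r') as [E2 _].
destruct (Rle_lt_or_eq_dec (F1 x r') (F1 x r)) as [k|k]; [lra| |].
- apply (gn_dec1 H x) in k. lra.
- rewrite k in E2. lra.
Qed.

Lemma gn_F1_shift {s s1 s2 F1 F2 : R -> R -> R} (x r : R) :
  generated s s1 s2 F1 F2 -> F1 (x + 1) r = F1 x r + 1.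
Proof.
intros H. apply (gn_inj1 (x + 1) _ _ H). rewrite (gn_per1 H).
destruct (gn_F H x r) as [E1 _]. destruct (gn_F H (x + 1) r) as [E2 _].
lra.
Qed.

Lemma gn_F_inj {s s1 s2 F1 F2 : R -> R -> R} (x r x' r' : R) :
  generated s s1 s2 F1 F2 -> F1 x r = F1 x' r' -> F2 x r = F2 x' r' -> x = x' /\ r = r'.
Proof.
intros H E1 E2. destruct (gn_F H x r) as [A B].
destruct (gn_F H x' r') as [A' B'].
assert (Hx : x = x').
{ apply (gn_inj2 x x' (F1 x r) H). rewrite <- B, E2, E1. exact B'. }
split; auto. subst x'. rewrite <- E1 in A'. lra.
Qed.

(** Only the inequality usually called domination; equality along orbits is stated separately. The
    linear term [c t] is part of [P], so no cohomology class appears. *)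
Definition calibrated (s : R -> R -> R) (P : R -> R) (a : R) : Prop :=
  forall x y, P y <= P x + s x y + a.

Lemma derive_at_min (f : R -> R) (x l : R) :
  is_derive f x l -> (forall y, f x <= f y) -> l = 0.
Proof.
intros Hd Hm. apply Rabs_eq_0, Rle_antisym; [|apply Rabs_pos].
apply le_epsilon. intros e He. rewrite Rplus_0_l.
destruct (proj1 (is_derive_eps _ _ _) Hd e He) as [d [Hd0 H]].
assert (A := H (x + d / 2)). assert (B := H (x - d / 2)).
replace (x + d / 2 - x) with (d / 2) in A by ring.
replace (x - d / 2 - x) with (- (d / 2)) in B by ring.
rewrite Rabs_Ropp in B. rewrite (Rabs_right (d / 2)) in A, B by lra.
specialize (A ltac:(lra)). specialize (B ltac:(lra)).
apply Rabs_le_between in A. apply Rabs_le_between in B.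
assert (M1 := Hm (x + d / 2)). assert (M2 := Hm (x - d / 2)).
apply Rabs_le. nra.
Qed.

(** First-order condition at [x] for the minimum of [P z + s z y] over [z]. *)
Lemma touch_left {s s1 s2 F1 F2 : R -> R -> R} (P : R -> R) (a x y e : R) :
  generated s s1 s2 F1 F2 -> calibrated s P a -> P y = P x + s x y + a ->
  is_derive P x e -> e = - s1 x y.
Proof.
intros H Hc Hy Hd.
assert (D := is_derive_plus _ _ _ _ _ Hd (gn_d1 H x y)).
apply derive_at_min in D.
- unfold plus in D; simpl in D. lra.
- intros z. unfold plus; simpl. specialize (Hc z y). lra.
Qed.

(** First-order condition at [y] for the minimum of [s x z - P z] over [z]. *)
Lemma touch_right {s s1 s2 F1 F2 : R -> R -> R} (P : R -> R) (a x y e : R) :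
  generated s s1 s2 F1 F2 -> calibrated s P a -> P y = P x + s x y + a ->
  is_derive P y e -> e = s2 x y.
Proof.
intros H Hc Hy Hd.
assert (D := is_derive_minus _ _ _ _ _ (gn_d2 H x y) Hd).
apply derive_at_min in D.
- unfold minus, plus, opp in D; simpl in D. lra.
- intros z. unfold minus, plus, opp; simpl. specialize (Hc x z). lra.
Qed.

(** Invariant leaves with their primitives; by [lg_P1], [c] is the mean height of the leaf [c]. No
    order between leaves is included, because those given by a C1 map [u] might a priori meet. *)
Record lagrangian (s s1 s2 F1 F2 E P g : R -> R -> R) (alpha : R -> R) : Prop := {
  lg_gen : generated s s1 s2 F1 F2;
  lg_E : cont2 E;
  lg_P : forall c t, is_derive (P c) t (E c t);
  lg_P0 : forall c, P c 0 = 0;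
  lg_P1 : forall c t, P c (t + 1) = P c t + c;
  lg_g : forall c t, g c t = F1 t (E c t);
  lg_cl : forall c, circle_lift (g c);
  lg_F2 : forall c t, F2 t (E c t) = E c (g c t);
  lg_cal : forall c, calibrated s (P c) (alpha c);
  lg_eq : forall c t, P c (g c t) = P c t + s t (g c t) + alpha c }.

Arguments lg_gen {s s1 s2 F1 F2 E P g alpha} _.
Arguments lg_E {s s1 s2 F1 F2 E P g alpha} _.
Arguments lg_P {s s1 s2 F1 F2 E P g alpha} _.
Arguments lg_P0 {s s1 s2 F1 F2 E P g alpha} _.
Arguments lg_P1 {s s1 s2 F1 F2 E P g alpha} _.
Arguments lg_g {s s1 s2 F1 F2 E P g alpha} _.
Arguments lg_cl {s s1 s2 F1 F2 E P g alpha} _.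
Arguments lg_F2 {s s1 s2 F1 F2 E P g alpha} _.
Arguments lg_cal {s s1 s2 F1 F2 E P g alpha} _.
Arguments lg_eq {s s1 s2 F1 F2 E P g alpha} _.

Lemma lagrangian_family {s s1 s2 F1 F2 E P g : R -> R -> R} {alpha} :
  lagrangian s s1 s2 F1 F2 E P g alpha -> family E P g alpha.
Proof.
intros [H1 H2 H3 H4 H5 H6 H7 H8 H9 H10]. split; auto.
- apply (cont2_ext (fun c t => F1 t (E c t))); [now intros|].
  apply (cont2_comp2 F1 (fun _ t => t) E); auto. apply (gn_cF1 H1).
  apply cont2_snd.
- intros c c' t. assert (A := H9 c' t (g c t)). assert (B := H10 c t). lra.
Qed.

Lemma lg_E_s1 {s s1 s2 F1 F2 E P g : R -> R -> R} {alpha} (c t : R) :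
  lagrangian s s1 s2 F1 F2 E P g alpha -> E c t = - s1 t (g c t).
Proof.
intros H. rewrite (lg_g H). apply (gn_F (lg_gen H)).
Qed.

(* A [c]-orbit that is calibrated for [c'] as well lies on the leaf [c']. *)
Lemma common_calibration {s s1 s2 F1 F2 E P g : R -> R -> R} {alpha} (c c' t : R) :
  lagrangian s s1 s2 F1 F2 E P g alpha ->
  P c' t - P c t + (alpha c' - alpha c) <= P c' (g c t) - P c (g c t) -> E c' t = E c t.
Proof.
intros H Hle. assert (A := lg_cal H c' t (g c t)).
assert (B := lg_eq H c t).
rewrite (lg_E_s1 c t H).
apply (touch_left (P c') (alpha c') t (g c t) _ (lg_gen H)).
- apply (lg_cal H).
- lra.
- apply (lg_P H).
Qed.

Lemma common_calibration_iter {s s1 s2 F1 F2 E P g : R -> R -> R} {alpha} (c c' t : R)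
    (q : nat) :
  lagrangian s s1 s2 F1 F2 E P g alpha -> (1 <= q)%nat ->
  P c' t - P c t + INR q * (alpha c' - alpha c)
    <= P c' (iter (g c) q t) - P c (iter (g c) q t) -> E c' t = E c t.
Proof.
intros H Hq Hle. assert (HA := lagrangian_family H).
destruct q as [|q]; [lia|]. rewrite iter_S_r, S_INR in Hle.
apply (common_calibration c c' t H).
assert (L := fam_iter_ineq c c' (g c t) q HA). lra.
Qed.

Lemma leaves_equal {s s1 s2 F1 F2 E P g : R -> R -> R} {alpha} (c c' : R) :
  lagrangian s s1 s2 F1 F2 E P g alpha -> (forall t, E c' t = E c t) -> c' = c.
Proof.
intros H He. assert (HA := lagrangian_family H).
assert (L := derive_zero_const (fun t => P c' t - P c t) 1 0).
assert (D : forall x, is_derive (fun t => P c' t - P c t) x 0).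
{ intros x. replace 0 with (E c' x - E c x) by (rewrite He; ring).
  apply (fam_diff_derive c c' x HA). }
specialize (L D). simpl in L.
rewrite !(fam_P_one _ HA), !(fam_P0 HA) in L. lra.
Qed.

(* A weak KAM solution that is C1 has an invariant graph: every point has a
   calibrated preimage, and the backward map is a degree one homeomorphism. *)
Lemma C1_solution_invariant {s s1 s2 F1 F2 : R -> R -> R} (P E : R -> R) (a : R) :
  generated s s1 s2 F1 F2 ->
  (forall t, is_derive P t (E t)) -> (forall t, continuous E t) ->
  (forall t, E (t + 1) = E t) ->
  calibrated s P a -> (forall y, exists x, P y = P x + s x y + a) ->
  circle_lift (fun t => F1 t (E t)) /\ forall t,
    F2 t (E t) = E (F1 t (E t)) /\ P (F1 t (E t)) = P t + s t (F1 t (E t)) + a.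
Proof.
intros H HP HE Hper Hcal Hat.
destruct (functional_choice _ Hat) as [b Hb].
assert (B1 : forall y, E (b y) = - s1 (b y) y).
{ intros y. apply (touch_left P a _ _ _ H Hcal (Hb y)), HP. }
assert (B2 : forall y, E y = s2 (b y) y).
{ intros y. apply (touch_right P a _ _ _ H Hcal (Hb y)), HP. }
assert (B3 : forall y, F1 (b y) (E (b y)) = y).
{ intros y. rewrite B1. apply (gn_F1 H). }
assert (Hbl : circle_lift b).
{ apply degree_one_circle_lift.
  - intros y. apply (implicit_continuous (fun y x => E y - s2 x y)).
    + intros x. apply (continuous_minus E (s2 x)); [apply HE|].
      apply cont2_right, (gn_c2 H).
    + intros z x x' Hx. assert (L := gn_dec2 H x x' z Hx). lra.
    + intros z. rewrite <- B2. ring.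
  - intros y. apply (gn_inj2 _ _ (y + 1) H).
    rewrite (gn_per2 H), <- !B2. apply Hper.
  - intros x y Hxy. now rewrite <- (B3 x), <- (B3 y), Hxy. }
assert (Hg : forall t, exists y, t = b y /\ F1 t (E t) = y).
{ intros t. destruct (cl_surj b t Hbl) as [y Hy]. exists y. split; auto.
  rewrite <- Hy. apply B3. }
split.
- split.
  + intros x y Hxy. destruct (Hg x) as [x' [Ex ->]]. destruct (Hg y) as [y' [Ey ->]].
    apply Rnot_le_lt; intros h.
    assert (L := cl_le b y' x' Hbl ltac:(lra)). lra.
  + intros x. apply (cont2_comp F1 (fun t => t) E); auto.
    apply (gn_cF1 H). apply continuous_id.
  + intros x. now rewrite Hper, (gn_F1_shift _ _ H).
- intros t. destruct (Hg t) as [y [-> Ey]]. rewrite Ey.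
  destruct (gn_F H (b y) (E (b y))) as [_ ->]. rewrite B3.
  split; [symmetry; apply B2 | apply Hb].
Qed.

Lemma lagrangian_orbits_agree {s s1 s2 F1 F2 E P g : R -> R -> R} {alpha} (c c' t : R) :
  lagrangian s s1 s2 F1 F2 E P g alpha -> E c t = E c' t ->
  forall n, iter (g c) n t = iter (g c') n t /\ E c (iter (g c) n t) = E c' (iter (g c) n t).
Proof.
intros H He. induction n as [|n [IH1 IH2]]; [now split|].
change (g c (iter (g c) n t) = g c' (iter (g c') n t) /\
  E c (g c (iter (g c) n t)) = E c' (g c (iter (g c) n t))).
rewrite <- IH1. set (z := iter (g c) n t) in *.
assert (Eg : g c z = g c' z) by (rewrite !(lg_g H), IH2; reflexivity).
split; auto. rewrite <- (lg_F2 H), Eg, <- (lg_F2 H).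
now rewrite IH2.
Qed.

(** * C1 families of solutions are foliations *)

Record smooth_lagrangian (s s1 s2 F1 F2 E P g h : R -> R -> R) (alpha : R -> R) : Prop := {
  sl_lg : lagrangian s s1 s2 F1 F2 E P g alpha;
  sl_ch : cont2 h;
  sl_h : forall c x, is_derive (fun c' => P c' x) c (h c x) }.

Arguments sl_lg {s s1 s2 F1 F2 E P g h alpha} _.
Arguments sl_ch {s s1 s2 F1 F2 E P g h alpha} _.
Arguments sl_h {s s1 s2 F1 F2 E P g h alpha} _.

Lemma sl_h0 {s s1 s2 F1 F2 E P g h : R -> R -> R} {alpha} (c : R) :
  smooth_lagrangian s s1 s2 F1 F2 E P g h alpha -> h c 0 = 0.
Proof.
intros H. assert (D := sl_h H c 0).
rewrite <- (is_derive_unique _ _ _ D). apply is_derive_unique.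
apply (is_derive_ext (fun _ => 0)).
- intros c'. now rewrite (lg_P0 (sl_lg H)).
- apply (is_derive_const (V := R_NormedModule)).
Qed.

Lemma sl_h1 {s s1 s2 F1 F2 E P g h : R -> R -> R} {alpha} (c t : R) :
  smooth_lagrangian s s1 s2 F1 F2 E P g h alpha -> h c (t + 1) = h c t + 1.
Proof.
intros H. assert (D := sl_h H c (t + 1)).
rewrite <- (is_derive_unique _ _ _ D). apply is_derive_unique.
apply (is_derive_ext (fun c' => P c' t + c')).
- intros c'. now rewrite (lg_P1 (sl_lg H)).
- apply (is_derive_plus (fun c' => P c' t) (fun c' => c')).
  apply (sl_h H). apply (is_derive_id (K := R_AbsRing)).
Qed.

(** For fixed [t], [alpha c] is the maximum over [y] of [P c y - P c t - s t y], attained at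
    [y = g c t]. Differentiating with [y] frozen gives [h c (g c t) - h c t]; being the derivative
    of [alpha], it does not depend on [t]. *)
Lemma semiconjugacy {s s1 s2 F1 F2 E P g h : R -> R -> R} {alpha} :
  smooth_lagrangian s s1 s2 F1 F2 E P g h alpha ->
  exists rho, forall c t, h c (g c t) = h c t + rho c.
Proof.
intros H. assert (HL := sl_lg H).
assert (D : forall c t, is_derive alpha c (h c (g c t) - h c t)).
{ intros c t.
  apply (envelope (fun y c => P c y - P c t - s t y) (fun y c => h c y - h c t)
    (fun c => g c t)).
  - intros y c'.
    apply (is_derive_ext (fun c => (P c y - P c t) + - s t y)); [intros z; simpl; ring|].
    replace (h c' y - h c' t) with (plus (h c' y - h c' t) 0) by (unfold plus; simpl; ring).
    apply (is_derive_plus (V := R_NormedModule)).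
    + apply (is_derive_minus (fun c => P c y) (fun c => P c t));
      apply (sl_h H).
    + apply (is_derive_const (V := R_NormedModule)).
  - apply cont2_minus.
    + apply cont2_swap, (sl_ch H).
    + apply (cont2_of_1 (fun c => h c t) (fun _ c => c)); [|apply cont2_snd].
      intros x. apply cont2_left, (sl_ch H).
  - apply cont2_left, (fam_g (lagrangian_family HL)).
  - intros c'. rewrite (lg_eq HL). ring.
  - intros c1 c2. assert (A := lg_cal HL c2 t (g c1 t)). lra. }
exists (fun c => h c (g c 0) - h c 0). intros c t.
assert (A := is_derive_unique _ _ _ (D c t)).
rewrite (is_derive_unique _ _ _ (D c 0)) in A. lra.
Qed.

Lemma semiconjugacy_iter (g h : R -> R -> R) (rho : R -> R) (c t : R) (n : nat) :
  (forall c t, h c (g c t) = h c t + rho c) -> h c (iter (g c) n t) = h c t + INR n * rho c.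
Proof.
intros Hr. induction n as [|n IH]; [unfold iter; simpl; ring|].
rewrite S_INR. change (iter (g c) (S n) t) with (g c (iter (g c) n t)). rewrite Hr, IH. ring.
Qed.

Lemma sl_h_bounded {s s1 s2 F1 F2 E P g h : R -> R -> R} {alpha} (c : R) :
  smooth_lagrangian s s1 s2 F1 F2 E P g h alpha ->
  exists B, 0 < B /\ forall t, Rabs (h c t - t) <= B.
Proof.
intros H. apply (periodic_bounded (fun t => h c t - t)).
- intros x. apply (continuous_minus (h c) (fun t => t)); [|apply continuous_id].
  apply cont2_right, (sl_ch H).
- intros x. rewrite (sl_h1 _ _ H). ring.
Qed.

(** Along [n] steps of the [c]-dynamics [P c' - P c] grows by at most [n (alpha c' - alpha c)]. It
    also grows by [(c' - c) n rho c] up to a bounded error, since it differs from [(c' - c) t], and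
    [h c t] from [t], by periodic functions. Thus [rho c] is a subgradient of [alpha] at [c]. *)
Lemma sl_alpha_convex {s s1 s2 F1 F2 E P g h : R -> R -> R} {alpha} (rho : R -> R) (c c' : R) :
  smooth_lagrangian s s1 s2 F1 F2 E P g h alpha ->
  (forall c t, h c (g c t) = h c t + rho c) ->
  (c' - c) * rho c <= alpha c' - alpha c.
Proof.
intros H Hr. assert (HL := sl_lg H).
assert (HA := lagrangian_family HL).
destruct (sl_h_bounded c H) as [B [HB0 HB]].
destruct (periodic_bounded (fun t => P c' t - P c t - (c' - c) * t)) as [B' [HB'0 HB']].
{ intros x. apply (continuous_minus (fun t => P c' t - P c t) (fun t => (c' - c) * t)).
  - apply (continuous_minus (P c') (P c));
    exact (derive_continuous _ _ _ (fam_P HA _ x)).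
  - apply (continuous_mult (fun _ => c' - c) (fun t => t)).
    apply continuous_const. apply continuous_id. }
{ intros x. rewrite !(fam_P1 HA). ring. }
assert ((c' - c) * rho c - (alpha c' - alpha c) <= 0); [|lra].
apply no_drift with (Rabs (c' - c) * B + B'). intros n.
assert (I := fam_iter_ineq c c' 0 n HA).
rewrite !(fam_P0 HA) in I.
set (y := iter (g c) n 0) in *.
assert (Hy : h c y = INR n * rho c).
{ unfold y. rewrite (semiconjugacy_iter g h rho c 0 n Hr).
  rewrite (sl_h0 c H). ring. }
assert (Q := HB' y). simpl in Q. apply Rabs_le_between in Q.
assert (Q2 : Rabs ((c' - c) * (h c y - y)) <= Rabs (c' - c) * B).
{ rewrite Rabs_mult. apply Rmult_le_compat_l; [apply Rabs_pos | apply HB]. }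
apply Rabs_le_between in Q2. rewrite Hy in Q2.
replace (INR n * ((c' - c) * rho c - (alpha c' - alpha c)))
  with ((c' - c) * (INR n * rho c - y) + (c' - c) * y - INR n * (alpha c' - alpha c)) by ring.
lra.
Qed.

(** [h c] and [h c'] both stay at bounded distance from the identity along the common orbit, whose
    mean speed is therefore both [rho c] and [rho c']. *)
Lemma rho_common_orbit {s s1 s2 F1 F2 E P g h : R -> R -> R} {alpha} (rho : R -> R)
    (c c' t : R) :
  smooth_lagrangian s s1 s2 F1 F2 E P g h alpha ->
  (forall c t, h c (g c t) = h c t + rho c) -> E c t = E c' t -> rho c = rho c'.
Proof.
intros H Hr He. assert (HL := sl_lg H).
destruct (sl_h_bounded c H) as [B [HB0 HB]].
destruct (sl_h_bounded c' H) as [B' [HB'0 HB']].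
assert (K : forall n, Rabs (INR n * rho c - INR n * rho c') <= 2 * (B + B')).
{ intros n.
  assert (A1 := semiconjugacy_iter g h rho c t n Hr).
  assert (A2 := semiconjugacy_iter g h rho c' t n Hr).
  destruct (lagrangian_orbits_agree _ _ _ HL He n) as [Eo _].
  rewrite <- Eo in A2. set (y := iter (g c) n t) in *.
  assert (Q1 := HB y). assert (Q2 := HB' y). assert (Q3 := HB t). assert (Q4 := HB' t).
  abs_lra. }
assert (A1 : rho c - rho c' <= 0).
{ apply no_drift with (2 * (B + B')). intros n. specialize (K n).
  abs_lra. }
assert (A2 : rho c' - rho c <= 0).
{ apply no_drift with (2 * (B + B')). intros n. specialize (K n).
  abs_lra. }
lra.
Qed.

(** * Functions monotone along orbits, and gaps between periodic points *)

Lemma periodic_uniform (f : R -> R) (e : R) : (forall x, continuous f x) ->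
  (forall x, f (x + 1) = f x) -> 0 < e ->
  exists d, 0 < d /\ forall x y, Rabs (y - x) < d -> Rabs (f y - f x) < e.
Proof.
intros Hc Hp He.
destruct (compact_uniform (fun x d => forall y, Rabs (y - x) < d -> Rabs (f y - f x) < e) 0 1)
  as [d [Hd H]].
- intros x d d' H Hd y Hy. apply H. lra.
- intros x0 _. destruct (proj1 (continuous_eps f x0) (Hc x0) (e / 2) ltac:(lra)) as [d [Hd H]].
  exists (d / 2). split; [lra|]. intros x Hx y Hy.
  assert (A := H x ltac:(lra)).
  assert (B : Rabs (y - x0) < d).
  { replace (y - x0) with ((y - x) + (x - x0)) by ring.
    apply Rle_lt_trans with (1 := Rabs_triang _ _). lra. }
  specialize (H y B). abs_lra.
- exists d. split; [exact Hd|]. intros x y Hxy.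
  set (k := Int_part x). destruct (frac_part_bounds x). fold k in H0, H1.
  assert (A := H (x - IZR k) ltac:(lra) (y - IZR k)).
  rewrite <- (periodic_IZR f Hp k (x - IZR k)) in A.
  rewrite <- (periodic_IZR f Hp k (y - IZR k)) in A.
  replace (x - IZR k + IZR k) with x in A by ring.
  replace (y - IZR k + IZR k) with y in A by ring.
  apply A. now replace (y - IZR k - (x - IZR k)) with (y - x) by ring.
Qed.

(* Without periodic points some power [G] of [g], up to translation, moves every point
   very little; a point [y] is then reached from [x] by iterating [G] from one of the
   short intervals between consecutive iterates of [x]. *)
Lemma aperiodic_subinvariant (g k : R -> R) (x y : R) :
  circle_lift g -> aperiodic g -> (forall z, continuous k z) ->
  (forall z, k (z + 1) = k z) -> (forall z, k (g z) <= k z) -> k y <= k x.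
Proof.
intros Hg Ha Hc Hp Hk. apply le_epsilon. intros e He.
destruct (periodic_uniform k e Hc Hp He) as [d [Hd Hu]].
destruct (small_inverse d Hd) as [L [HL HLd]].
assert (PL : 0 < INR L) by (apply lt_0_INR; lia).
destruct (aperiodic_small_step g L Hg Ha) as [m [j [Hm [Hr Hs]]]].
assert (HG := circle_lift_shifted g m j Hg). set (G := shifted_iter g m j) in *.
assert (HkG : forall n z, k (iter G n z) <= k z).
{ intros n z. induction n as [|n IH]; [unfold iter; simpl; lra|].
  apply Rle_trans with (2 := IH). change (iter G (S n) z) with (iter g m (iter G n z) + IZR j).
  rewrite (periodic_IZR k Hp). generalize (iter G n z). clear - Hk.
  intros w. induction m as [|m IH]; [unfold iter; simpl; lra|].
  apply Rle_trans with (2 := IH). apply Hk. }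
assert (Hi : exists i, (i < L)%nat /\ iter G (S i) x - iter G i x < d).
{ apply NNPP. intros Hn.
  assert (K : forall n, (n <= L)%nat -> x + INR n * d <= iter G n x).
  { induction n as [|n IH]; intros HnL; [unfold iter; simpl; lra|].
    rewrite S_INR. specialize (IH ltac:(lia)).
    destruct (Rlt_dec (iter G (S n) x - iter G n x) d) as [h|h]; [|lra].
    exfalso. apply Hn. exists n. split; [lia | exact h]. }
  specialize (K L (Nat.le_refl _)). specialize (Hs x).
  assert (INR L * (3 / INR L) < INR L * d) by (apply Rmult_lt_compat_l; lra).
  replace (INR L * (3 / INR L)) with 3 in H by (field; lra). lra. }
destruct Hi as [i [HiL Hi]].
set (M := up (iter G L x - y)). destruct (archimed (iter G L x - y)) as [A1 _]. fold M in A1.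
rewrite <- (periodic_IZR k Hp M y). set (y' := y + IZR M).
assert (Hy' : iter G L x <= y') by (unfold y'; lra).
assert (Hxy' : x <= y').
{ apply Rle_trans with (2 := Hy'). apply (iter_le_mono G x 0 L Hr). lia. }
destruct (iter_bracket G x y' HG Hr Hxy') as [i0 [B1 B2]].
assert (Hi0 : (L <= i0)%nat).
{ destruct (le_lt_dec L i0) as [h|h]; auto. exfalso.
  assert (Q := iter_le_mono G x (S i0) L Hr ltac:(lia)). lra. }
set (l := (i0 - i)%nat).
assert (HGl := circle_lift_iter G l HG).
destruct (cl_surj (iter G l) y' HGl) as [z Hz].
assert (C1 : iter G i x <= z).
{ apply Rnot_lt_le; intros h.
  assert (Q := cl_incr _ HGl z (iter G i x) ltac:(lra)).
  rewrite Hz, <- iter_add in Q. replace (l + i)%nat with i0 in Q by (unfold l; lia). lra. }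
assert (C2 : z < iter G (S i) x).
{ apply Rnot_le_lt; intros h.
  assert (Q := cl_le _ (iter G (S i) x) z HGl ltac:(lra)).
  rewrite Hz, <- iter_add in Q. replace (l + S i)%nat with (S i0) in Q by (unfold l; lia). lra. }
rewrite <- Hz. apply Rle_trans with (k z); [apply HkG|].
assert (Q : Rabs (k z - k (iter G i x)) < e) by (apply Hu, Rabs_def1; lra).
assert (Q2 := HkG i x). abs_lra.
Qed.

Lemma last_zero (f : R -> R) (a t : R) : (forall x, continuous f x) -> f a = 0 -> a <= t ->
  exists x, a <= x <= t /\ f x = 0 /\ forall z, x < z <= t -> f z <> 0.
Proof.
intros Hc Ha Hat.
destruct (completeness (fun z => a <= z <= t /\ f z = 0)) as [x [H1 H2]].
- exists t. intros z [Hz _]. lra.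
- exists a. split; [lra | exact Ha].
- assert (Hax : a <= x) by (apply H1; split; [lra | exact Ha]).
  assert (Hxt : x <= t) by (apply H2; intros z [Hz _]; lra).
  exists x. split; [lra|]. split.
  + apply NNPP. intros Hn. assert (Hp := Rabs_pos_lt _ Hn).
    destruct (proj1 (continuous_eps f x) (Hc x) _ Hp) as [d [Hd Hcl]].
    assert (x <= x - d); [|lra]. apply H2. intros z [Hz Hfz].
    assert (Hzx : z <= x) by (apply H1; now split).
    apply Rnot_lt_le; intros h.
    specialize (Hcl z ltac:(abs_lra)). rewrite Hfz, Rminus_0_l, Rabs_Ropp in Hcl.
    lra.
  + intros z Hz Hfz. assert (z <= x); [|lra]. apply H1. split; [lra | exact Hfz].
Qed.

Lemma gap (f : R -> R) (t : R) : (forall x, continuous f x) -> (forall x, f (x + 1) = f x) ->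
  (exists a, f a = 0) -> f t <> 0 ->
  exists x y, x < t < y /\ f x = 0 /\ f y = 0 /\ forall z, x < z < y -> f z <> 0.
Proof.
intros Hc Hp [a Ha] Ht.
assert (Hn : forall n, f (a + IZR n) = 0) by (intros n; now rewrite (periodic_IZR f Hp)).
destruct (last_zero f (a + IZR (- up (a - t))) t Hc) as [x [X1 [X2 X3]]].
{ apply Hn. } { rewrite opp_IZR. destruct (archimed (a - t)). lra. }
destruct (last_zero (fun z => f (- z)) (- (a + IZR (up (t - a)))) (- t)) as [y [Y1 [Y2 Y3]]].
{ intros z. apply continuous_reflect, Hc. }
{ rewrite Ropp_involutive. apply Hn. } { destruct (archimed (t - a)). lra. }
exists x, (- y). split; [|split; [|split]]; auto.
- assert (x <> t) by (intros ->; auto). assert (- y <> t) by (intros E0; rewrite E0 in Y2; auto).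
  lra.
- intros z Hz. destruct (Rle_dec z t) as [h|h]; [apply X3; lra|].
  rewrite <- (Ropp_involutive z). apply Y3. lra.
Qed.

(** The iterates of [z] increase to a fixed point of [G] beyond [z], which can only be [y]; [h] is
    constant along them and continuous. *)
Lemma orbit_to_fixed_point (G h : R -> R) (z y : R) :
  circle_lift G -> (forall t, continuous h t) -> (forall t, h (G t) = h t) ->
  G y = y -> z <= y -> z < G z -> (forall w, z < w < y -> G w <> w) -> h z = h y.
Proof.
intros HG Hc Hh Hy Hzy Hz Hn.
assert (Hle : forall n, iter G n z <= y).
{ induction n as [|n IH]; [exact Hzy|]. rewrite <- Hy. apply (cl_le G _ _ HG IH). }
assert (Hinc : forall n, iter G n z < iter G (S n) z).
{ induction n as [|n IH]; [exact Hz|]. apply (cl_incr G HG), IH. }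
assert (Hge : forall n, z <= iter G n z).
{ induction n as [|n IH]; [apply Rle_refl|]. specialize (Hinc n). lra. }
assert (Hhn : forall n, h (iter G n z) = h z).
{ induction n as [|n IH]; [reflexivity|]. rewrite <- IH. apply Hh. }
destruct (completeness (fun r => exists n, r = iter G n z)) as [w [H1 H2]].
- exists y. intros r [n ->]. apply Hle.
- exists z. now exists O.
- assert (Hwy : w <= y) by (apply H2; intros r [n ->]; apply Hle).
  assert (Hzw : z < w).
  { apply Rlt_le_trans with (1 := Hz). apply H1. now exists 1%nat. }
  assert (Happ : forall d, 0 < d -> exists n, w - d < iter G n z <= w).
  { intros d Hd. apply NNPP. intros Hno. assert (w <= w - d); [|lra].
    apply H2. intros r [n ->]. apply Rnot_lt_le; intros k. apply Hno. exists n. split; [lra|]. apply H1. now exists n. }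
  assert (HGw : G w = w).
  { destruct (Rtotal_order (G w) w) as [k|[k|k]]; auto; exfalso.
    - destruct (Happ (w - G w) ltac:(lra)) as [n [Hn1 Hn2]].
      assert (Q := cl_le G _ _ HG Hn2). assert (Q2 := Hinc n).
      change (iter G (S n) z) with (G (iter G n z)) in Q2. lra.
    - destruct (continuous_gt G w w (cl_cont G HG w) ltac:(lra)) as [d [Hd Hd']].
      destruct (Happ d Hd) as [n [Hn1 Hn2]].
      specialize (Hd' (iter G n z) ltac:(abs_lra)).
      assert (G (iter G n z) <= w); [|lra]. apply H1. now exists (S n). }
  assert (Ew : w = y).
  { destruct Hwy as [k|k]; auto. exfalso. now apply (Hn w). }
  subst w. apply cond_eq. intros e He.
  destruct (proj1 (continuous_eps h y) (Hc y) e He) as [d [Hd Hd']].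
  destruct (Happ d Hd) as [n [Hn1 Hn2]].
  rewrite <- (Hhn n). apply Hd', Rabs_def1; lra.
Qed.

(* Inside the gap every orbit tends to one of the end points, so [h] takes only two
   values there. *)
Lemma constant_on_gap (G h : R -> R) (x y z : R) :
  circle_lift G -> (forall t, continuous h t) -> (forall t, h (G t) = h t) ->
  G x = x -> G y = y -> (forall w, x < w < y -> G w <> w) -> x <= z <= y -> h z = h x.
Proof.
intros HG Hc Hh Hx Hy Hn Hz.
assert (Htwo : forall w, x <= w <= y -> h w = h x \/ h w = h y).
{ intros w Hw. destruct (Rtotal_order w (G w)) as [k|[k|k]].
  - right. apply (orbit_to_fixed_point G h w y); auto; [lra|].
    intros v Hv. apply Hn. lra.
  - destruct (proj1 Hw) as [k1| <-]; [|now left]. destruct (proj2 Hw) as [k2| ->]; [|now right].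
    exfalso. apply (Hn w); auto.
  - left.
    rewrite <- (Ropp_involutive w), <- (Ropp_involutive x).
    apply (orbit_to_fixed_point (fun t => - G (- t)) (fun t => h (- t)) (- w) (- x)).
    + now apply circle_lift_reflect.
    + intros a. apply continuous_reflect, Hc.
    + intros a. now rewrite Ropp_involutive.
    + now rewrite Ropp_involutive, Hx.
    + lra.
    + rewrite Ropp_involutive. lra.
    + intros v Hv Ev. apply (Hn (- v)); lra. }
destruct (Req_dec (h x) (h y)) as [k|k].
{ destruct (Htwo z Hz); lra. }
exfalso. destruct (IVT_gen h x y ((h x + h y) / 2)) as [v [Hv Ev]].
- intros t. now apply continuous_pt.
- unfold Rmin, Rmax. destruct (Rle_dec (h x) (h y)); lra.
- rewrite Rmin_left, Rmax_right in Hv by lra. destruct (Htwo v Hv); lra.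
Qed.

Lemma derive_locally_const (f : R -> R) (t l d : R) : 0 < d ->
  is_derive f t l -> (forall y, t <= y <= t + d -> f y = f t) -> l = 0.
Proof.
intros Hd Hf Hc. apply Rabs_eq_0, Rle_antisym; [|apply Rabs_pos].
apply le_epsilon. intros e He. rewrite Rplus_0_l.
destruct (proj1 (is_derive_eps _ _ _) Hf e He) as [d' [Hd' H]].
set (r := Rmin d (d' / 2)).
assert (Hr : 0 < r) by (apply Rmin_pos; lra).
min_bounds (Rmin d (d' / 2)). fold r in Hmin, Hmin0.
specialize (H (t + r)). replace (t + r - t) with r in H by ring.
rewrite (Rabs_right r) in H by lra. specialize (H ltac:(lra)).
rewrite (Hc (t + r)) in H by lra.
replace (f t - f t - l * r) with (- (l * r)) in H by ring.
rewrite Rabs_Ropp, Rabs_mult, (Rabs_right r) in H by lra.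
apply Rmult_le_reg_r in H; auto.
Qed.

Lemma leaves_disjoint {s s1 s2 F1 F2 E P g h : R -> R -> R} {alpha} (c c' t : R) :
  smooth_lagrangian s s1 s2 F1 F2 E P g h alpha -> c < c' -> E c t <> E c' t.
Proof.
intros H Hcc He. assert (HL := sl_lg H).
assert (HA := lagrangian_family HL).
destruct (semiconjugacy H) as [rho Hr].
assert (Hrr := rho_common_orbit _ _ _ _ H Hr He).
assert (Hconv := fun a b => sl_alpha_convex rho a b H Hr).
(* Adding the subgradient inequalities at two parameters shows that [rho] is monotone, and it takes
   the same value at both ends. *)
assert (Hrho : forall k, c <= k <= c' -> rho k = rho c).
{ intros k [K1 K2]. apply Rle_antisym.
  - rewrite Hrr. destruct K2 as [K2| ->]; [|lra].
    assert (A := Hconv k c'). assert (B := Hconv c' k).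
    apply Rmult_le_reg_l with (c' - k); lra.
  - destruct K1 as [K1| <-]; [|lra].
    assert (A := Hconv k c). assert (B := Hconv c k).
    apply Rmult_le_reg_l with (k - c); lra. }
assert (Haff : forall k k', c <= k <= c' -> c <= k' <= c' ->
  alpha k' - alpha k = (k' - k) * rho c).
{ intros k k' Hk Hk'. assert (A := Hconv k k'). assert (B := Hconv k' k).
  rewrite (Hrho k Hk) in A. rewrite (Hrho k' Hk') in B. lra. }
assert (Hall : forall x, E c' x = E c x).
2:{ assert (Q := leaves_equal c c' HL Hall). lra. }
assert (Hch := sl_ch H).
destruct (classic (aperiodic (g c))) as [Hap|Hap].
(* [k] is periodic and does not increase along orbits, hence constant. The comparison inequality is
   then an equality at every point, and [common_calibration] identifies the leaves. *)
- set (k := fun x => P c' x - P c x - (c' - c) * h c x).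
  assert (Hk1 : forall z, k (z + 1) = k z).
  { intros z. unfold k. rewrite !(fam_P1 HA), (sl_h1 _ _ H). ring. }
  assert (Hkc : forall z, continuous k z).
  { intros z. apply (continuous_minus (fun x => P c' x - P c x) (fun x => (c' - c) * h c x)).
    - apply (continuous_minus (P c') (P c));
      exact (derive_continuous _ _ _ (fam_P HA _ z)).
    - apply (continuous_mult (fun _ => c' - c) (h c)).
      apply continuous_const. now apply cont2_right. }
  assert (Hk : forall z, k (g c z) <= k z).
  { intros z. unfold k. rewrite Hr. assert (I := fam_ineq HA c c' z).
    rewrite (Haff c c') in I by lra. lra. }
  intros x. apply (common_calibration c c' x HL).
  assert (Q2 := aperiodic_subinvariant (g c) k (g c x) x (fam_cl HA c) Hap Hkc Hk1 Hk).
  unfold k in Q2. rewrite Hr in Q2. rewrite (Haff c c') by lra. lra.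
- apply not_aperiodic in Hap. destruct Hap as [q [p [x0 [Hq Hap]]]].
  assert (Hshift : forall k x, h k (x + IZR p) = h k x + IZR p).
  { intros k x. rewrite (shift_IZR (h k) 1); [ring|].
    intros y. apply (sl_h1 _ _ H). }
  assert (Hqp : INR q * rho c = IZR p).
  { assert (A := semiconjugacy_iter g h rho c x0 q Hr).
    rewrite Hap, Hshift in A. lra. }
  (* [alpha] has slope [p/q] between [c] and [c'], so around a closed orbit of one leaf the
     comparison with any other leaf of this range is an equality: all these leaves share their
     periodic points of this type. *)
  assert (Hfix : forall k k' x, c <= k <= c' -> c <= k' <= c' ->
    iter (g k) q x = x + IZR p -> E k' x = E k x /\ iter (g k') q x = x + IZR p).
  { intros k k' x Hk Hk' Hx.
    assert (Ee : E k' x = E k x).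
    { apply (common_calibration_iter k k' x q HL Hq).
      rewrite Hx, !(fam_shift _ _ _ HA), (Haff k k' Hk Hk').
      replace (INR q * ((k' - k) * rho c)) with ((k' - k) * IZR p) by (rewrite <- Hqp; ring).
      lra. }
    split; auto.
    destruct (lagrangian_orbits_agree k k' x HL (eq_sym Ee) q) as [<- _].
    exact Hx. }
  set (G := fun k => shifted_iter (g k) q (- p)).
  assert (HG : forall k, circle_lift (G k)).
  { intros k. apply (circle_lift_shifted _ _ _ (fam_cl HA k)). }
  assert (HGfix : forall k x, G k x = x <-> iter (g k) q x = x + IZR p).
  { intros k x. unfold G, shifted_iter. rewrite opp_IZR. split; intros; lra. }
  intros x.
  destruct (Req_dec (G c x - x) 0) as [Hx|Hx].
  { apply (Hfix c c' x); try lra. apply HGfix. lra. }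
  destruct (cl_displacement_periodic _ (HG c)) as [Hdc Hdp].
  destruct (gap (fun z => G c z - z) x Hdc Hdp) as [a [b [Hab [Ha [Hb Hno]]]]]; auto.
  { exists x0. assert (Q := proj2 (HGfix c x0) Hap). lra. }
  assert (Ha' := proj1 (HGfix c a) ltac:(lra)). assert (Hb' := proj1 (HGfix c b) ltac:(lra)).
  assert (Hconst : forall k z, c <= k <= c' -> a <= z <= b -> h k z = h k a).
  { intros k z Hk Hz. apply (constant_on_gap (G k) (h k) a b z); auto.
    - intros w. now apply cont2_right.
    - intros w. unfold G, shifted_iter. rewrite opp_IZR.
      replace (iter (g k) q w + - IZR p) with (iter (g k) q w + IZR (- p))
        by (rewrite opp_IZR; ring).
      rewrite (shift_IZR (h k) 1); [|intros y; apply (sl_h1 _ _ H)].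
      rewrite (semiconjugacy_iter g h rho k w q Hr).
      rewrite (Hrho k Hk), Hqp, opp_IZR. ring.
    - apply HGfix. apply (Hfix c k a); auto; lra.
    - apply HGfix. apply (Hfix c k b); auto; lra.
    - intros w Hw Ew. apply (Hno w Hw). apply HGfix in Ew.
      assert (Q := proj2 (HGfix c w) (proj2 (Hfix k c w Hk ltac:(lra) Ew))). lra. }
  (* The derivative of [P k z - P k a] in [k] is [h k z - h k a], which vanishes for [z] in the
     gap. *)
  assert (HD : forall z, a <= z <= b -> P c' z - P c z = P c' a - P c a).
  { intros z Hz.
    destruct (mean_value (fun k => P k z - P k a) (fun k => h k z - h k a) c c') as [k [Hk Ek]].
    - intros k. apply (is_derive_minus (fun k => P k z) (fun k => P k a));
      apply (sl_h H).
    - lra.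
    - rewrite (Hconst k z Hk Hz) in Ek. lra. }
  assert (Q : E c' x - E c x = 0); [|lra].
  apply (derive_locally_const (fun z => P c' z - P c z) x _ (b - x)); [lra| |].
  + apply (fam_diff_derive c c' x HA).
  + intros y Hy. rewrite (HD y), (HD x) by lra. reflexivity.
Qed.

(** Disjointness gives [E c' - E c] a constant sign, and its mean over a period is [c' - c]. *)
Lemma leaves_increasing {s s1 s2 F1 F2 E P g h : R -> R -> R} {alpha} (c c' t : R) :
  smooth_lagrangian s s1 s2 F1 F2 E P g h alpha -> c < c' -> E c t < E c' t.
Proof.
intros H Hcc. assert (HL := sl_lg H).
assert (HA := lagrangian_family HL).
destruct (IVT_sign (fun x => E c' x - E c x)) as [K|K].
- intros x. apply (continuous_minus (E c') (E c)); apply cont2_right, (fam_E HA).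
- intros x Hx. apply (leaves_disjoint c c' x H Hcc). lra.
- specialize (K t). simpl in K. lra.
- exfalso. destruct (mean_value (fun x => P c' x - P c x) (fun x => E c' x - E c x) 0 1)
    as [x [_ Ex]].
  + intros x. apply (fam_diff_derive c c' x HA).
  + lra.
  + rewrite !(fam_P_one _ HA), !(fam_P0 HA) in Ex. specialize (K x). simpl in K. lra.
Qed.

(* Some point of the leaf [c] has height [c]; as [g c] has degree one, all the others
   are moved by a comparable amount. *)
Lemma leaves_exhaust {s s1 s2 F1 F2 E P g h : R -> R -> R} {alpha} (t r : R) :
  smooth_lagrangian s s1 s2 F1 F2 E P g h alpha -> exists c, E c t = r.
Proof.
intros H. assert (HL := sl_lg H).
assert (HA := lagrangian_family HL).
assert (Hgen := lg_gen HL).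
assert (Hmean : forall c, exists x, t <= x <= t + 1 /\ E c x = c).
{ intros c. destruct (mean_value (P c) (E c) t (t + 1)) as [x [Hx Ex]].
  - apply (fam_P HA). - lra.
  - exists x. split; auto. rewrite (fam_P1 HA) in Ex. lra. }
assert (Hs1 : forall y x, continuous (fun x => s1 x y) x).
{ intros y x. apply cont2_left, (gn_c1 Hgen). }
assert (Hup : exists c, r <= E c t).
{ apply NNPP. intros Hn.
  assert (Hlt : forall c, E c t < r).
  { intros c. apply Rnot_le_lt; intros k. apply Hn. exists c. lra. }
  destruct (ab_min (fun x => s1 x (F1 t r + 1)) t (t + 1) (Hs1 _) ltac:(lra)) as [b [_ Hb]].
  (* [- s1 x y] is the height at which [x] is sent to [y]; [c] is the largest such height over [x]
     in [t, t + 1] for the target [F1 t r + 1]. *)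
  set (c := - s1 b (F1 t r + 1)).
  destruct (Hmean c) as [x [Hx Ex]].
  assert (A1 : g c t < F1 t r).
  { rewrite (lg_g HL). apply (gn_F1_incr _ _ _ Hgen), Hlt. }
  assert (A2 := cl_le _ _ _ (fam_cl HA c) (proj2 Hx)).
  rewrite (cl_deg _ (fam_cl HA c)) in A2.
  assert (A3 := gn_dec1 Hgen x (g c x) (F1 t r + 1) ltac:(lra)).
  assert (A4 := lg_E_s1 c x HL).
  assert (A5 := Hb x Hx). simpl in A5. unfold c in *. lra. }
assert (Hlo : exists c, E c t <= r).
{ apply NNPP. intros Hn.
  assert (Hlt : forall c, r < E c t).
  { intros c. apply Rnot_le_lt; intros k. apply Hn. exists c. lra. }
  destruct (ab_max (fun x => s1 x (F1 t r)) t (t + 1) (Hs1 _) ltac:(lra)) as [b [_ Hb]].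
  set (c := - s1 b (F1 t r)).
  destruct (Hmean c) as [x [Hx Ex]].
  assert (A1 : F1 t r < g c t).
  { rewrite (lg_g HL). apply (gn_F1_incr _ _ _ Hgen), Hlt. }
  assert (A2 := cl_le _ _ _ (fam_cl HA c) (proj1 Hx)).
  assert (A3 := gn_dec1 Hgen x (F1 t r) (g c x) ltac:(lra)).
  assert (A4 := lg_E_s1 c x HL).
  assert (A5 := Hb x Hx). simpl in A5. unfold c in *. lra. }
destruct Hup as [c2 H2]. destruct Hlo as [c1 H1].
assert (H12 : c1 <= c2).
{ apply Rnot_lt_le; intros k.
  assert (Q := leaves_increasing c2 c1 t H ltac:(lra)). lra. }
destruct (ivt (fun c => E c t) c1 c2 r) as [c [_ Hc]]; auto.
- intros c. apply cont2_left, (fam_E HA).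
- now exists c.
Qed.

(** * Foliations give weak KAM solutions *)

(* For fixed [x] the action [P x + s x y - P y] is minimal at [y = g x]; its minimal
   value is independent of [x] because the envelope lemma gives it derivative 0. *)
Lemma invariant_graph_calibrated {s s1 s2 F1 F2 : R -> R -> R} (P E : R -> R) :
  generated s s1 s2 F1 F2 ->
  (forall t, is_derive P t (E t)) -> (forall t, continuous E t) ->
  (forall t, E (t + 1) = E t) ->
  (forall t, F2 t (E t) = E (F1 t (E t))) ->
  circle_lift (fun t => F1 t (E t)) /\
  exists a, calibrated s P a /\ forall t, P (F1 t (E t)) = P t + s t (F1 t (E t)) + a.
Proof.
intros H HP HE Hper Hinv. set (g := fun t => F1 t (E t)).
assert (Hg : circle_lift g).
{ apply degree_one_circle_lift.
  - intros t. apply (cont2_comp F1 (fun t => t) E); auto.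
    apply (gn_cF1 H). apply continuous_id.
  - intros t. unfold g. now rewrite Hper, (gn_F1_shift _ _ H).
  - intros x y Hxy. apply (gn_F_inj x (E x) y (E y) H); auto.
    rewrite !Hinv. unfold g in Hxy. now rewrite Hxy. }
split; [exact Hg|].
assert (H2 : forall t, E (g t) = s2 t (g t)).
{ intros t. unfold g. rewrite <- Hinv. apply (gn_F H). }
assert (H1 : forall t, E t = - s1 t (g t)) by (intros t; apply (gn_F H)).
assert (Hdy : forall x y, is_derive (fun y => s x y - P y) y (s2 x y - E y)).
{ intros x y. apply (is_derive_minus (s x) P); [apply (gn_d2 H) | apply HP]. }
assert (Hmin : forall x y, s x (g x) - P (g x) <= s x y - P y).
{ intros x y. destruct (Rle_dec (g x) y) as [h|h].
  - apply (derive_nonneg_le (fun y => s x y - P y) (fun y => s2 x y - E y)); auto.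
    intros z Hz. destruct (cl_surj g z Hg) as [w <-]. rewrite H2.
    destruct (Rle_dec x w) as [[k| ->]|k]; [|lra|].
    + assert (L := gn_dec2 H x w (g w) k). lra.
    + assert (L := cl_incr g Hg w x ltac:(lra)). lra.
  - assert (L := derive_nonneg_le (fun y => - (s x y - P y)) (fun y => - (s2 x y - E y)) y (g x)).
    simpl in L. assert (- (s x y - P y) <= - (s x (g x) - P (g x))); [|lra].
    apply L; [|lra|].
    + intros z. apply (is_derive_opp (fun y => s x y - P y)), Hdy.
    + intros z Hz. destruct (cl_surj g z Hg) as [w <-]. rewrite H2.
      destruct (Rle_dec w x) as [[k| <-]|k]; [|lra|].
      * assert (L2 := gn_dec2 H w x (g w) k). lra.
      * assert (L2 := cl_incr g Hg x w ltac:(lra)). lra. }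
set (w := fun t => P (g t) - P t - s t (g t)).
assert (Hw : forall t, is_derive w t 0).
{ intros t. replace 0 with (- E t - s1 t (g t)) by (rewrite H1; ring).
  apply (envelope (fun y t => P y - P t - s t y) (fun y t => - E t - s1 t y) g).
  - intros y x. apply (is_derive_ext (fun t => P y + (- P t - s t y))).
    + intros z. simpl. ring.
    + replace (- E x - s1 x y) with (plus 0 (- E x - s1 x y)) by (unfold plus; simpl; ring).
      apply (is_derive_plus (V := R_NormedModule)).
      * apply (is_derive_const (V := R_NormedModule)).
      * apply (is_derive_minus (fun t => - P t) (fun t => s t y)); [|apply (gn_d1 H)].
        apply (is_derive_opp P), HP.
  - apply cont2_minus.
    + apply cont2_opp, (cont2_of_1 E (fun _ t => t)); auto. apply cont2_snd.
    + apply cont2_swap, (gn_c1 H).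
  - apply (cl_cont g Hg).
  - reflexivity.
  - intros x y. unfold w. specialize (Hmin y (g x)). lra. }
exists (w 0). split.
- intros x y. specialize (Hmin x y). assert (Q := derive_zero_const w x 0 Hw). unfold w at 1 in Q.
  lra.
- intros t. assert (Q := derive_zero_const w t 0 Hw). unfold w at 1 in Q.
  change (P (g t) = P t + s t (g t) + w 0). lra.
Qed.

(** Intermediate values in [c]. Let [z] be the image of [t] after [q - 1] steps on the leaf 0, and
    [c1] the leaf sending [z] to [x] in one step. By monotonicity in [c], the images of [t] after
    [q] steps on the leaves [Rmin 0 c1] and [Rmax 0 c1] bracket [x]. *)
Lemma fol_onto_of_leaves {s s1 s2 F1 F2 E P g : R -> R -> R} {alpha} (q : nat) (t x : R) :
  lagrangian s s1 s2 F1 F2 E P g alpha ->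
  (forall c c' t, c < c' -> E c t < E c' t) -> (forall t r, exists c, E c t = r) ->
  (1 <= q)%nat -> exists c, iter (g c) q t = x.
Proof.
intros HL Hinc Honto Hq. assert (HA := lagrangian_family HL).
assert (Hgen := lg_gen HL).
assert (Hg : forall c c' y, c <= c' -> g c y <= g c' y).
{ intros c c' y [h| ->]; [|lra]. left. rewrite !(lg_g HL).
  now apply (gn_F1_incr _ _ _ Hgen), Hinc. }
assert (Hit : forall c c' n, c <= c' -> iter (g c) n t <= iter (g c') n t).
{ intros c c' n Hc. induction n as [|n IH]; [apply Rle_refl|].
  apply Rle_trans with (g c (iter (g c') n t)).
  - apply (cl_le _ _ _ (fam_cl HA c) IH).
  - now apply Hg. }
destruct q as [|q]; [lia|].
set (z := iter (g 0) q t).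
destruct (Honto z (- s1 z x)) as [c1 Hc1].
assert (Ex : g c1 z = x).
{ rewrite (lg_g HL), Hc1. apply (gn_F1 Hgen). }
min_bounds (Rmin 0 c1).
assert (N1 := Rmax_l 0 c1). assert (N2 := Rmax_r 0 c1).
destruct (ivt (fun c => iter (g c) (S q) t) (Rmin 0 c1) (Rmax 0 c1) x) as [c [_ Hc]].
- intros c. apply (cont2_left _ c t (cont2_iter g (S q) (fam_g HA))).
- lra.
- rewrite <- Ex. split.
  + apply Rle_trans with (g (Rmin 0 c1) z); [|now apply Hg].
    apply (cl_le _ _ _ (fam_cl HA _)), Hit, Rmin_l.
  + apply Rle_trans with (g (Rmax 0 c1) z); [now apply Hg|].
    apply (cl_le _ _ _ (fam_cl HA _)), Hit, N1.
- now exists c.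
Qed.

(* Minimality on both leaves forces two periodic orbits of the same type [p/q] to have
   the same action, hence to lie on the same leaf. *)
Lemma fol_per_of_leaves {s s1 s2 F1 F2 E P g : R -> R -> R} {alpha} (c : R) (q : nat) (p : Z)
    (x y : R) :
  lagrangian s s1 s2 F1 F2 E P g alpha ->
  (forall c c' t, c < c' -> E c t < E c' t) -> (forall t r, exists c, E c t = r) ->
  (1 <= q)%nat -> iter (g c) q x = x + IZR p -> iter (g c) q y = y + IZR p.
Proof.
intros HL Hinc Honto Hq Hx. assert (HA := lagrangian_family HL).
destruct (fol_onto_of_leaves q y (y + IZR p) HL Hinc Honto Hq) as [c' Hc'].
assert (A := fam_iter_ineq c c' x q HA).
rewrite Hx, !(fam_shift _ _ _ HA) in A.
assert (Ee : E c y = E c' y).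
{ apply (common_calibration_iter c' c y q HL Hq).
  rewrite Hc', !(fam_shift _ _ _ HA). lra. }
assert (Hcc : c = c').
{ apply (strict_mono_inj (fun c => E c y)); auto. }
now subst c'.
Qed.

(** * Periodic leaves: density and uniqueness of the solution *)

(** A closing argument. An orbit on the middle leaf [m] almost returns modulo 1. Passing to the leaf
    [a] or [b] changes the last step alone by at least [d1] or [d2], more than the error of the
    return, so some leaf in between closes the orbit exactly. *)
Lemma periodic_leaves_dense {s s1 s2 F1 F2 E P g : R -> R -> R} {alpha} (c1 c2 : R) :
  lagrangian s s1 s2 F1 F2 E P g alpha ->
  (forall c c' t, c < c' -> E c t < E c' t) -> c1 < c2 ->
  exists c q p x, c1 < c < c2 /\ (1 <= q)%nat /\ iter (g c) q x = x + IZR p.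
Proof.
intros HL Hinc Hcc. assert (HA := lagrangian_family HL).
assert (Hgen := lg_gen HL).
assert (Hg : forall c c' y, c < c' -> g c y < g c' y).
{ intros c c' y h. rewrite !(lg_g HL).
  now apply (gn_F1_incr _ _ _ Hgen), Hinc. }
assert (Hsep : forall k k', k < k' -> exists d, 0 < d /\ forall x, g k x + d <= g k' x).
{ intros k k' Hk. destruct (periodic_min (fun x => g k' x - g k x)) as [a Ha].
  - intros x. apply (continuous_minus (g k') (g k)); apply cont2_right, (fam_g HA).
  - intros x. rewrite !(cl_deg _ (fam_cl HA _)). ring.
  - exists (g k' a - g k a). split; [specialize (Hg k k' a Hk); lra|].
    intros x. specialize (Ha x). simpl in Ha. lra. }
set (m := (c1 + c2) / 2).
set (a := (c1 + m) / 2). set (b := (m + c2) / 2).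
destruct (Hsep a m ltac:(unfold a, m; lra)) as [d1 [Hd1 S1]].
destruct (Hsep m b ltac:(unfold b, m; lra)) as [d2 [Hd2 S2]].
destruct (close_mod_one (fun n => iter (g m) n 0) (Rmin d1 d2)) as [n [n' [p [Hn Hp]]]].
{ now apply Rmin_pos. }
min_bounds (Rmin d1 d2).
set (x := iter (g m) n 0) in *. set (q := (n' - n)%nat).
assert (Eq : iter (g m) n' 0 = iter (g m) q x).
{ unfold x. rewrite <- iter_add. f_equal. unfold q. lia. }
rewrite Eq in Hp. apply Rabs_def2 in Hp.
assert (Hq : (1 <= q)%nat) by (unfold q; lia).
assert (Hle : forall k k' j, k <= k' -> iter (g k) j x <= iter (g k') j x).
{ intros k k' j Hk. induction j as [|j IH]; [apply Rle_refl|].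
  apply Rle_trans with (g k (iter (g k') j x)).
  - apply (cl_le _ _ _ (fam_cl HA k) IH).
  - destruct Hk as [h| ->]; [left; now apply Hg | apply Rle_refl]. }
destruct q as [|q]; [lia|].
change (iter (g m) (S q) x) with (g m (iter (g m) q x)) in Hp.
assert (La : iter (g a) (S q) x <= x + IZR p).
{ assert (Q := cl_le _ _ _ (fam_cl HA a) (Hle a m q ltac:(unfold a, m; lra))).
  specialize (S1 (iter (g m) q x)).
  change (iter (g a) (S q) x) with (g a (iter (g a) q x)). lra. }
assert (Lb : x + IZR p <= iter (g b) (S q) x).
{ assert (Q := cl_le _ _ _ (fam_cl HA b) (Hle m b q ltac:(unfold b, m; lra))).
  specialize (S2 (iter (g m) q x)).
  change (iter (g b) (S q) x) with (g b (iter (g b) q x)). lra. }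
destruct (ivt (fun c => iter (g c) (S q) x) a b (x + IZR p)) as [c [Hc Ec]].
- intros c. apply (cont2_left _ c x (cont2_iter g (S q) (fam_g HA))).
- unfold a, b, m. lra.
- lra.
- exists c, (S q), p, x. split; [unfold a, b, m in Hc; lra|]. now split.
Qed.

Lemma squeeze_derive (f lo hi : R -> R) (x l : R) :
  is_derive lo x l -> is_derive hi x l -> lo x = f x -> hi x = f x ->
  (forall y, lo y <= f y <= hi y) -> is_derive f x l.
Proof.
intros H1 H2 E1 E2 Hs. apply is_derive_eps. intros e He.
destruct (proj1 (is_derive_eps _ _ _) H1 e He) as [d1 [Hd1 K1]].
destruct (proj1 (is_derive_eps _ _ _) H2 e He) as [d2 [Hd2 K2]].
exists (Rmin d1 d2). split; [now apply Rmin_pos|]. intros y Hy.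
min_bounds (Rmin d1 d2).
specialize (K1 y ltac:(lra)). specialize (K2 y ltac:(lra)). specialize (Hs y).
abs_lra.
Qed.

(* Along a periodic leaf the two calibrations agree up to a constant; calibration from
   both sides then makes [V] differentiable with the slope of the leaf. *)
Lemma periodic_leaf_unique {s s1 s2 F1 F2 E P g : R -> R -> R} {alpha} (c a : R) (q : nat)
    (p : Z) (V : R -> R) :
  lagrangian s s1 s2 F1 F2 E P g alpha -> (1 <= q)%nat ->
  (forall y, iter (g c) q y = y + IZR p) ->
  (forall t, continuous V t) -> V 0 = 0 -> (forall t, V (t + 1) = V t + c) ->
  calibrated s V a -> (forall y, exists x, V y = V x + s x y + a) ->
  forall t, V t = P c t.
Proof.
intros HL Hq Hid HVc HV0 HV1 Hcal Hat. assert (HA := lagrangian_family HL).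
assert (Hgen := lg_gen HL).
set (k := fun t => V t - P c t).
assert (Hkc : forall t, continuous k t).
{ intros t. apply (continuous_minus V (P c)); [apply HVc|].
  exact (derive_continuous _ _ _ (fam_P HA c t)). }
assert (Hkp : forall t, k (t + 1) = k t).
{ intros t. unfold k. rewrite HV1, (fam_P1 HA). ring. }
assert (Hk : forall t, k (g c t) <= k t + (a - alpha c)).
{ intros t. assert (A := Hcal t (g c t)). assert (B := lg_eq HL c t).
  unfold k. lra. }
assert (Hki : forall n t, k (iter (g c) n t) <= k t + INR n * (a - alpha c)).
{ induction n as [|n IH]; intros t; [unfold iter; simpl; lra|].
  rewrite S_INR. change (iter (g c) (S n) t) with (g c (iter (g c) n t)).
  specialize (IH t). specialize (Hk (iter (g c) n t)). lra. }
(* One inequality comes from a predecessor, calibrated for [V], of a minimum of [k]; the other from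
   following a periodic orbit once around. *)
assert (Ha : a = alpha c).
{ apply Rle_antisym.
  - destruct (periodic_min k Hkc Hkp) as [y Hy]. destruct (Hat y) as [x Hx].
    assert (B := lg_cal HL c x y). specialize (Hy x). unfold k in Hy. lra.
  - assert (Q := Hki q 0). rewrite Hid, (periodic_IZR k Hkp) in Q.
    assert (0 < INR q) by (apply lt_0_INR; lia).
    assert (0 <= INR q * (a - alpha c)) by lra.
    apply Rnot_lt_le; intros h. nra. }
assert (Hkeq : forall t, k (g c t) = k t).
{ intros t. apply Rle_antisym; [specialize (Hk t); lra|].
  destruct q as [|q]; [lia|].
  assert (Q := Hki q (g c t)). rewrite <- iter_S_r, Hid, (periodic_IZR k Hkp), Ha in Q. lra. }
assert (Heq : forall t, V (g c t) = V t + s t (g c t) + a).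
{ intros t. assert (B := lg_eq HL c t). specialize (Hkeq t).
  unfold k in Hkeq. lra. }
assert (HD : forall t, is_derive V t (E c t)).
{ intros t. destruct (cl_surj (g c) t (fam_cl HA c)) as [b Hb].
  assert (E1 := lg_E_s1 c t HL).
  assert (E2 : E c t = s2 b t).
  { rewrite <- Hb at 1. rewrite <- (lg_F2 HL).
    destruct (gn_F Hgen b (E c b)) as [_ ->].
    now rewrite <- (lg_g HL), Hb. }
  (* Domination towards the next point of the orbit bounds [V] from below, and from the previous
     point it bounds [V] from above; both barriers touch [V] at [t] with slope [E c t]. *)
  apply (squeeze_derive V (fun y => (V (g c t) - a) - s y (g c t)) (fun y => s b y + (V b + a))).
  - rewrite E1. replace (- s1 t (g c t)) with (minus 0 (s1 t (g c t)))
      by (unfold minus, plus, opp; simpl; ring).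
    apply (is_derive_minus (V := R_NormedModule)).
    + apply (is_derive_const (V := R_NormedModule)).
    + apply (gn_d1 Hgen).
  - rewrite E2. replace (s2 b t) with (plus (s2 b t) 0) by (unfold plus; simpl; ring).
    apply (is_derive_plus (V := R_NormedModule)).
    + apply (gn_d2 Hgen).
    + apply (is_derive_const (V := R_NormedModule)).
  - rewrite Heq. ring.
  - rewrite <- Hb at 2. rewrite Heq, Hb. ring.
  - intros y. assert (A := Hcal y (g c t)). assert (B := Hcal b y). lra. }
intros t.
assert (Q := derive_zero_const k t 0).
unfold k in Q. rewrite HV0, (fam_P0 HA) in Q.
assert (V t - P c t = 0 - 0); [|lra]. apply Q. intros x.
replace 0 with (minus (E c x) (E c x)) by (unfold minus, plus, opp; simpl; ring).
apply (is_derive_minus V (P c)); [apply HD | apply (fam_P HA)].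
Qed.

(** * Vertical derivatives of the iterates *)

Lemma chain_rule_2d (G Gx Gy : R -> R -> R) (X Y : R -> R) (t x' y' : R) :
  (forall x y, is_derive (fun z => G z y) x (Gx x y)) ->
  (forall x y, is_derive (G x) y (Gy x y)) -> cont2 Gx ->
  is_derive X t x' -> is_derive Y t y' ->
  is_derive (fun z => G (X z) (Y z)) t (Gx (X t) (Y t) * x' + Gy (X t) (Y t) * y').
Proof.
intros H1 H2 Hc HX HY. apply is_derive_Reals.
apply derivable_pt_lim_comp_2d; [|now apply is_derive_Reals | now apply is_derive_Reals].
apply filterdiff_differentiable_pt_lim.
assert (D := is_derive_filterdiff G (X t) (Y t) Gx (Gy (X t) (Y t))).
apply D.
- apply filter_forall. intros [u v]. apply H1.
- apply H2.
- apply (proj1 (cont2_continuous Gx) Hc (X t, Y t)).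
Qed.

Record smooth_twist (s s1 s2 F1 F2 a b s21 s22 : R -> R -> R) : Prop := {
  st_gen : generated s s1 s2 F1 F2;
  st_a : forall x r, is_derive (fun z => F1 z r) x (a x r);
  st_b : forall x r, is_derive (F1 x) r (b x r);
  st_ca : cont2 a;
  st_cb : cont2 b;
  st_bpos : forall x r, 0 < b x r;
  st_s21 : forall x y, is_derive (fun z => s2 z y) x (s21 x y);
  st_s22 : forall x y, is_derive (s2 x) y (s22 x y);
  st_c21 : cont2 s21;
  st_c22 : cont2 s22;
  st_neg : forall x y, s21 x y < 0 }.

Arguments st_gen {s s1 s2 F1 F2 a b s21 s22} _.
Arguments st_a {s s1 s2 F1 F2 a b s21 s22} _.
Arguments st_b {s s1 s2 F1 F2 a b s21 s22} _.
Arguments st_ca {s s1 s2 F1 F2 a b s21 s22} _.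
Arguments st_cb {s s1 s2 F1 F2 a b s21 s22} _.
Arguments st_bpos {s s1 s2 F1 F2 a b s21 s22} _.
Arguments st_s21 {s s1 s2 F1 F2 a b s21 s22} _.
Arguments st_s22 {s s1 s2 F1 F2 a b s21 s22} _.
Arguments st_c21 {s s1 s2 F1 F2 a b s21 s22} _.
Arguments st_c22 {s s1 s2 F1 F2 a b s21 s22} _.
Arguments st_neg {s s1 s2 F1 F2 a b s21 s22} _.

Fixpoint orb (F1 F2 : R -> R -> R) (n : nat) (x r : R) : R * R :=
  match n with
  | O => (x, r)
  | S m => (F1 (fst (orb F1 F2 m x r)) (snd (orb F1 F2 m x r)),
            F2 (fst (orb F1 F2 m x r)) (snd (orb F1 F2 m x r)))
  end.

(* The derivative of [orb] in [r]; the second component uses [F2 = s2 (x, F1)]. *)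
Fixpoint dorb (F1 F2 a b s21 s22 : R -> R -> R) (n : nat) (x r : R) : R * R :=
  match n with
  | O => (0, 1)
  | S m =>
      let z := orb F1 F2 m x r in
      let v := dorb F1 F2 a b s21 s22 m x r in
      let v' := a (fst z) (snd z) * fst v + b (fst z) (snd z) * snd v in
      (v', s21 (fst z) (F1 (fst z) (snd z)) * fst v + s22 (fst z) (F1 (fst z) (snd z)) * v')
  end.

Lemma orb_cont {s s1 s2 F1 F2 : R -> R -> R} (n : nat) : generated s s1 s2 F1 F2 ->
  cont2 (fun x r => fst (orb F1 F2 n x r)) /\ cont2 (fun x r => snd (orb F1 F2 n x r)).
Proof.
intros H. induction n as [|n [IH1 IH2]]; simpl.
- split; [apply cont2_fst | apply cont2_snd].
- split.
  + apply (cont2_comp2 F1); auto. apply (gn_cF1 H).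
  + apply (cont2_comp2 F2); auto. apply (gn_cF2 H).
Qed.

Lemma orb_derive {s s1 s2 F1 F2 a b s21 s22 : R -> R -> R} (n : nat) (x r : R) :
  smooth_twist s s1 s2 F1 F2 a b s21 s22 ->
  is_derive (fun r => fst (orb F1 F2 n x r)) r (fst (dorb F1 F2 a b s21 s22 n x r)) /\
  is_derive (fun r => snd (orb F1 F2 n x r)) r (snd (dorb F1 F2 a b s21 s22 n x r)).
Proof.
intros H. assert (Hg := st_gen H).
induction n as [|n [IH1 IH2]]; simpl.
- split; [apply (is_derive_const (V := R_NormedModule)) | apply (is_derive_id (K := R_AbsRing))].
- assert (D1 := chain_rule_2d F1 a b _ _ r _ _ (st_a H)
    (st_b H) (st_ca H) IH1 IH2).
  split; [exact D1|].
  apply (is_derive_ext (fun r => s2 (fst (orb F1 F2 n x r))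
    (F1 (fst (orb F1 F2 n x r)) (snd (orb F1 F2 n x r))))).
  + intros z. symmetry. apply (gn_F Hg).
  + apply (chain_rule_2d s2 s21 s22 _ _ r _ _ (st_s21 H)
      (st_s22 H) (st_c21 H) IH1 D1).
Qed.

Lemma dorb_cont {s s1 s2 F1 F2 a b s21 s22 : R -> R -> R} (n : nat) :
  smooth_twist s s1 s2 F1 F2 a b s21 s22 ->
  cont2 (fun x r => fst (dorb F1 F2 a b s21 s22 n x r)) /\
  cont2 (fun x r => snd (dorb F1 F2 a b s21 s22 n x r)).
Proof.
intros H. assert (Hg := st_gen H).
induction n as [|n [IH1 IH2]]; simpl.
- split; apply cont2_const.
- destruct (orb_cont n Hg) as [O1 O2].
  assert (OF : cont2 (fun x r => F1 (fst (orb F1 F2 n x r)) (snd (orb F1 F2 n x r)))).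
  { apply (cont2_comp2 F1); auto. apply (gn_cF1 Hg). }
  assert (K : cont2 (fun x r =>
    a (fst (orb F1 F2 n x r)) (snd (orb F1 F2 n x r)) * fst (dorb F1 F2 a b s21 s22 n x r) +
    b (fst (orb F1 F2 n x r)) (snd (orb F1 F2 n x r)) * snd (dorb F1 F2 a b s21 s22 n x r))).
  { apply cont2_plus; apply cont2_mult; auto.
    - apply (cont2_comp2 a); auto. apply (st_ca H).
    - apply (cont2_comp2 b); auto. apply (st_cb H). }
  split; [exact K|].
  apply cont2_plus; apply cont2_mult; auto.
  + apply (cont2_comp2 s21); auto. apply (st_c21 H).
  + apply (cont2_comp2 s22); auto. apply (st_c22 H).
Qed.

(* Monotonicity of all the iterates excludes conjugate points: where the first component
   vanishes the second one is negative, and the next first component would be too. *)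
Lemma dorb_pos {s s1 s2 F1 F2 a b s21 s22 : R -> R -> R} (n : nat) (x r : R) :
  smooth_twist s s1 s2 F1 F2 a b s21 s22 ->
  (forall m r r', r < r' -> fst (orb F1 F2 m x r) <= fst (orb F1 F2 m x r')) ->
  0 < fst (dorb F1 F2 a b s21 s22 (S n) x r).
Proof.
intros H Hm. set (v := fun n => dorb F1 F2 a b s21 s22 n x r).
assert (Hnn : forall m, 0 <= fst (v m)).
{ intros m. exact (incr_derive_nonneg _ _ _ (proj1 (orb_derive m x r H)) (Hm m r)). }
change (0 < fst (v (S n))).
assert (B := st_bpos H). assert (N := st_neg H).
induction n as [|n IH].
- unfold v. simpl. specialize (B x r). lra.
- destruct (Hnn (S (S n))) as [h|h]; auto. exfalso.
  assert (W : snd (v (S (S n))) < 0).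
  { change (snd (v (S (S n)))) with
      (s21 (fst (orb F1 F2 (S n) x r)) (F1 (fst (orb F1 F2 (S n) x r)) (snd (orb F1 F2 (S n) x r)))
         * fst (v (S n)) +
       s22 (fst (orb F1 F2 (S n) x r)) (F1 (fst (orb F1 F2 (S n) x r)) (snd (orb F1 F2 (S n) x r)))
         * fst (v (S (S n)))).
    rewrite <- h. rewrite Rmult_0_r, Rplus_0_r. rewrite <- (Rmult_0_l (fst (v (S n)))).
    apply Rmult_lt_compat_r; auto. }
  assert (Q := Hnn (S (S (S n)))).
  change (fst (v (S (S (S n))))) with
    (a (fst (orb F1 F2 (S (S n)) x r)) (snd (orb F1 F2 (S (S n)) x r)) * fst (v (S (S n))) +
     b (fst (orb F1 F2 (S (S n)) x r)) (snd (orb F1 F2 (S (S n)) x r)) * snd (v (S (S n)))) in Q.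
  rewrite <- h, Rmult_0_r, Rplus_0_l in Q.
  specialize (B (fst (orb F1 F2 (S (S n)) x r)) (snd (orb F1 F2 (S (S n)) x r))). nra.
Qed.

Lemma orb_shift {s s1 s2 F1 F2 : R -> R -> R} (n : nat) (x r : R) :
  generated s s1 s2 F1 F2 ->
  fst (orb F1 F2 n (x + 1) r) = fst (orb F1 F2 n x r) + 1 /\
  snd (orb F1 F2 n (x + 1) r) = snd (orb F1 F2 n x r).
Proof.
intros H. induction n as [|n [IH1 IH2]]; simpl; [now split|]. rewrite IH1, IH2.
split; [now rewrite (gn_F1_shift _ _ H)|].
destruct (gn_F H (fst (orb F1 F2 n x r) + 1) (snd (orb F1 F2 n x r))) as [_ ->].
destruct (gn_F H (fst (orb F1 F2 n x r)) (snd (orb F1 F2 n x r))) as [_ ->].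
now rewrite (gn_F1_shift _ _ H), (gn_per2 H).
Qed.

Lemma orb_leaf {s s1 s2 F1 F2 E P g : R -> R -> R} {alpha} (c t : R) (n : nat) :
  lagrangian s s1 s2 F1 F2 E P g alpha ->
  fst (orb F1 F2 n t (E c t)) = iter (g c) n t /\
  snd (orb F1 F2 n t (E c t)) = E c (iter (g c) n t).
Proof.
intros H. induction n as [|n [IH1 IH2]]; [now split|].
change (iter (g c) (S n) t) with (g c (iter (g c) n t)). simpl. rewrite IH1, IH2.
rewrite (lg_F2 H), (lg_g H). now split.
Qed.

Lemma lagrangian_foliated {s s1 s2 F1 F2 a b s21 s22 E P g : R -> R -> R} {alpha} :
  smooth_twist s s1 s2 F1 F2 a b s21 s22 ->
  lagrangian s s1 s2 F1 F2 E P g alpha ->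
  (forall c c' t, c < c' -> E c t < E c' t) -> (forall t r, exists c, E c t = r) ->
  foliated E P g alpha.
Proof.
intros Hst HL Hinc Honto. assert (HA := lagrangian_family HL).
assert (Hgen := lg_gen HL).
assert (Hg : forall c c' t, c < c' -> g c t < g c' t).
{ intros c c' t Hc. rewrite !(lg_g HL).
  now apply (gn_F1_incr _ _ _ Hgen), Hinc. }
split; auto.
- intros q t x Hq. apply (fol_onto_of_leaves q t x HL Hinc Honto Hq).
- intros c q p x Hq Hx y. apply (fol_per_of_leaves c q p x y HL Hinc Honto Hq Hx).
- intros q Hq.
  exists (fun x r => fst (orb F1 F2 q x r)), (fun x r => fst (dorb F1 F2 a b s21 s22 q x r)).
  assert (HD : forall x r, is_derive (fun r => fst (orb F1 F2 q x r)) r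
    (fst (dorb F1 F2 a b s21 s22 q x r))).
  { intros x r. apply (orb_derive q x r Hst). }
  split; [|split; [exact HD|split; [|split]]].
  + apply (dorb_cont q Hst).
  + intros x r. destruct q as [|q]; [lia|]. apply (dorb_pos q x r Hst).
    (* Every height lies on a leaf, so monotonicity of the iterates in [r] reduces to that of
       [iter (g c) m] in [c]. *)
    intros m r1 r2 Hr. destruct (Honto x r1) as [c1 <-]. destruct (Honto x r2) as [c2 <-].
    destruct (orb_leaf c1 x m HL) as [-> _].
    destruct (orb_leaf c2 x m HL) as [-> _].
    assert (Hc : c1 < c2).
    { apply (strict_mono_lt (fun c => E c x)); auto. }
    induction m as [|m IH]; [apply Rle_refl|].
    apply Rle_trans with (g c1 (iter (g c2) m x)).
    * apply (cl_le _ _ _ (fam_cl HA c1) IH).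
    * left. apply Hg, Hc.
  + intros x r. rewrite <- (is_derive_unique _ _ _ (HD (x + 1) r)).
    apply is_derive_unique.
    apply (is_derive_ext (fun r => fst (orb F1 F2 q x r) + 1)).
    * intros z. symmetry. apply (orb_shift q x z Hgen).
    * replace (fst (dorb F1 F2 a b s21 s22 q x r))
        with (plus (fst (dorb F1 F2 a b s21 s22 q x r)) 0) by (unfold plus; simpl; ring).
      apply (is_derive_plus (V := R_NormedModule)); [apply HD|].
      apply (is_derive_const (V := R_NormedModule)).
  + intros c t. symmetry. apply (orb_leaf c t q HL).
Qed.

(* The leaves, indexed by an arbitrary transverse parameter, are reindexed by their
   mean height [c]. *)
Lemma leaves_lagrangian {s s1 s2 F1 F2 : R -> R -> R} (E0 A0 : R -> R -> R) :
  generated s s1 s2 F1 F2 -> cont2 E0 -> cont2 A0 ->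
  (forall a t, E0 a (t + 1) = E0 a t) ->
  (forall r t, E0 (A0 r t) t = r) ->
  (forall a a' t, a < a' -> E0 a t < E0 a' t) ->
  (forall a t, F2 t (E0 a t) = E0 a (F1 t (E0 a t))) ->
  exists E P g alpha, lagrangian s s1 s2 F1 F2 E P g alpha /\
    (forall c c' t, c < c' -> E c t < E c' t) /\ (forall t r, exists c, E c t = r) /\
    (forall c, exists a, forall t, E c t = E0 a t).
Proof.
intros H HE HA Hper HAE Hinc Hinv.
destruct (functional_choice _ (fun a => primitive (E0 a) (fun t => cont2_right E0 a t HE)))
  as [Q HQ].
assert (HQ0 := fun a => proj1 (HQ a)). assert (HQ1 := fun a => proj2 (HQ a)). clear HQ.
set (M := fun a => Q a 1).
assert (HMc : forall a, continuous M a).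
{ intros a. apply (primitive_param_continuous E0 Q a 1 HE HQ0 HQ1). lra. }
assert (HM : forall a, exists x, 0 <= x <= 1 /\ M a = E0 a x).
{ intros a. destruct (mean_value (Q a) (E0 a) 0 1 (HQ1 a) ltac:(lra)) as [x [Hx Ex]].
  exists x. split; auto. rewrite HQ0 in Ex. unfold M. lra. }
assert (HMi : forall a a', a < a' -> M a < M a').
{ intros a a' Ha.
  destruct (mean_value (fun x => Q a' x - Q a x) (fun x => E0 a' x - E0 a x) 0 1) as [x [_ Ex]].
  - intros x. apply (is_derive_minus (Q a') (Q a)); apply HQ1.
  - lra.
  - rewrite !HQ0 in Ex. unfold M. specialize (Hinc a a' x Ha). lra. }
(* Among the leaves that meet the horizontal circle of height [c], the lowest stays below that
   circle and the highest above it, so their means bracket [c]. *)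
assert (HMo : forall c, exists a, M a = c).
{ intros c.
  assert (HAc : forall t, continuous (fun t => A0 c t) t) by (intros t; now apply cont2_right).
  destruct (ab_max (A0 c) 0 1 HAc ltac:(lra)) as [x2 [_ H2]].
  destruct (ab_min (A0 c) 0 1 HAc ltac:(lra)) as [x1 [H10 H1]].
  assert (Hle : forall a a' t, a <= a' -> E0 a t <= E0 a' t).
  { intros a a' t [k| ->]; [left; now apply Hinc | lra]. }
  destruct (ivt M (A0 c x1) (A0 c x2) c HMc) as [a [_ Ha]].
  - apply H2. lra.
  - split.
    + destruct (HM (A0 c x1)) as [x [Hx ->]]. rewrite <- (HAE c x) at 2.
      apply Hle, H1, Hx.
    + destruct (HM (A0 c x2)) as [x [Hx ->]]. rewrite <- (HAE c x) at 1.
      apply Hle, H2, Hx.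
  - now exists a. }
destruct (functional_choice _ HMo) as [m Hm].
assert (Hmi : forall c c', c < c' -> m c < m c').
{ intros c c' Hc. rewrite <- (Hm c), <- (Hm c') in Hc.
  apply (strict_mono_lt M); auto. }
assert (Hmc : forall c, continuous m c).
{ intros c. apply (implicit_continuous (fun c a => M a - c)).
  - intros a. apply (continuous_minus (fun _ => M a) (fun c : R => c)).
    apply continuous_const. apply continuous_id.
  - intros x a a' Ha. specialize (HMi a a' Ha). lra.
  - intros x. rewrite Hm. ring. }
set (E := fun c t => E0 (m c) t). set (P := fun c => Q (m c)).
assert (HEc : cont2 E).
{ apply (cont2_comp2 E0 (fun c _ => m c) (fun _ t => t) HE).
  - apply (cont2_of_1 m); auto. apply cont2_fst.
  - apply cont2_snd. }
assert (Hcal : forall c, circle_lift (fun t => F1 t (E c t)) /\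
  exists a, calibrated s (P c) a /\
    forall t, P c (F1 t (E c t)) = P c t + s t (F1 t (E c t)) + a).
{ intros c. apply (invariant_graph_calibrated (P c) (E c) H).
  - intros t. apply HQ1.
  - intros t. now apply cont2_right.
  - intros t. apply Hper.
  - intros t. apply Hinv. }
destruct (functional_choice _ (fun c => proj2 (Hcal c))) as [alpha Hal].
exists E, P, (fun c t => F1 t (E c t)), alpha.
split; [|split; [|split]].
- split; auto.
  + intros c t. apply HQ1.
  + intros c. apply HQ0.
  + intros c t.
    assert (K := derive_zero_const (fun t => P c (t + 1) - P c t) t 0).
    assert (D : forall x, is_derive (fun t => P c (t + 1) - P c t) x 0).
    { intros x. replace 0 with (minus (scal 1 (E0 (m c) (x + 1))) (E0 (m c) x)).
      - apply (is_derive_minus (fun t => P c (t + 1)) (P c)); [|apply HQ1].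
        apply (is_derive_comp (P c) (fun t => t + 1)); [apply HQ1|].
        auto_derive; auto; ring.
      - rewrite Hper. unfold minus, plus, opp, scal; simpl. unfold mult; simpl. ring. }
    specialize (K D). simpl in K. rewrite Rplus_0_l in K. unfold P in *.
    rewrite HQ0 in K. fold (M (m c)) in K. rewrite Hm in K. lra.
  + intros c. apply (proj1 (Hcal c)).
  + intros c t. apply Hinv.
  + intros c. apply (proj1 (Hal c)).
  + intros c. apply (proj2 (Hal c)).
- intros c c' t Hc. apply Hinc, Hmi, Hc.
- intros t r. exists (M (A0 r t)).
  assert (K : m (M (A0 r t)) = A0 r t).
  { apply (strict_mono_inj M); auto. }
  unfold E. rewrite K. apply HAE.
- intros c. now exists (m c).
Qed.

(** * Lifting to the annulus *)

Lemma circle_ext (t t' : circle) : repr t = repr t' -> t = t'.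
Proof.
destruct t as [x Hx], t' as [y Hy]; simpl. intros <-. f_equal. apply proof_irrelevance.
Qed.

Lemma Int_part_unique (x : R) (k : Z) : 0 <= x - IZR k < 1 -> Int_part x = k.
Proof.
intros H. destruct (frac_part_bounds x) as [A B].
assert (IZR (Int_part x) < IZR (k + 1)) by (rewrite plus_IZR; lra).
assert (IZR k < IZR (Int_part x + 1)) by (rewrite plus_IZR; lra).
apply lt_IZR in H0. apply lt_IZR in H1. lia.
Qed.

Lemma proj_eq (x y : R) : proj x = proj y <-> exists k : Z, x = y + IZR k.
Proof.
split.
- intros H. apply (f_equal repr) in H. simpl in H. unfold frac_part in H.
  exists (Int_part x - Int_part y)%Z. rewrite minus_IZR. lra.
- intros [k ->]. apply circle_ext. simpl. unfold frac_part.
  rewrite (Int_part_unique (y + IZR k) (Int_part y + k)).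
  + rewrite plus_IZR. ring.
  + rewrite plus_IZR. destruct (frac_part_bounds y). lra.
Qed.

Lemma proj_repr (t : circle) : proj (repr t) = t.
Proof.
apply circle_ext. simpl. unfold frac_part.
rewrite (Int_part_unique (repr t) 0); [simpl; ring|].
assert (H := repr_bound t). simpl. lra.
Qed.

Lemma repr_proj (x : R) : exists k : Z, x = repr (proj x) + IZR k.
Proof. exists (Int_part x). simpl. unfold frac_part. ring. Qed.

Lemma proj_period (x : R) : proj (x + 1) = proj x.
Proof. apply proj_eq. now exists 1%Z. Qed.

Lemma periodic_repr {A : Type} (f : R -> A) (x : R) :
  (forall y, f (y + 1) = f y) -> f (repr (proj x)) = f x.
Proof.
intros Hf. destruct (repr_proj x) as [k Hk]. set (y := repr (proj x)) in *. rewrite Hk.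
assert (Hn : forall n y, f (y + INR n) = f y).
{ induction n as [|n IH]; intros z; [simpl; now rewrite Rplus_0_r|].
  rewrite S_INR, <- Rplus_assoc, Hf. apply IH. }
destruct (Z_le_gt_dec 0 k) as [h|h].
- rewrite <- (Z2Nat.id k h), <- INR_IZR_INZ. symmetry. apply Hn.
- rewrite <- (Hn (Z.to_nat (- k)) (y + IZR k)), INR_IZR_INZ, Z2Nat.id, opp_IZR by lia.
  f_equal. ring.
Qed.

Lemma projA_repr (x : annulus) : projA (repr (fst x), snd x) = x.
Proof. destruct x as [t c]. unfold projA; simpl. now rewrite proj_repr. Qed.

Lemma continuous_pair {U V W : UniformSpace} (f : U -> V) (g : U -> W) (x : U) :
  continuous f x -> continuous g x -> continuous (fun y => (f y, g y)) x.
Proof.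
intros Hf Hg. apply (continuous_comp_2 f g (fun a b => (a, b)) x Hf Hg).
apply (continuous_ext (fun z : V * W => z)); [now intros [a b] | apply continuous_id].
Qed.

Lemma continuous_proj (x : R) : continuous proj x.
Proof.
apply filterlim_locally. intros e. exists e. intros y Hy.
exists (Int_part x - Int_part y)%Z. simpl. unfold frac_part. rewrite minus_IZR.
replace (y - IZR (Int_part y) - (x - IZR (Int_part x)) -
  (IZR (Int_part x) - IZR (Int_part y))) with (y - x) by ring.
exact Hy.
Qed.

Lemma continuous_projA (p : R * R) : continuous projA p.
Proof.
apply (continuous_pair (fun p : R * R => proj (fst p)) (fun p : R * R => snd p)).
- apply (continuous_comp fst proj); [apply continuous_fst | apply continuous_proj].
- apply continuous_snd.
Qed.

Lemma circle_near (t s : circle) (e : R) : circle_ball t e s ->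
  exists y, proj y = s /\ Rabs (y - repr t) < e.
Proof.
intros [k Hk]. exists (repr s - IZR k). split.
- rewrite <- (proj_repr s) at 2. apply proj_eq. exists (- k)%Z. rewrite opp_IZR. ring.
- now replace (repr s - IZR k - repr t) with (repr s - repr t - IZR k) by ring.
Qed.

(** [repr] jumps at the class of 0, so continuity is tested after composition with [proj]: every
    point near [t] has a lift near [repr t]. *)
Lemma continuous_circle {U : UniformSpace} (f : circle -> U) :
  (forall x, continuous (fun y => f (proj y)) x) -> forall t, continuous f t.
Proof.
intros H t P HP. rewrite <- (proj_repr t) in HP.
destruct (H (repr t) P HP) as [e He]. exists e. intros s Hs.
destruct (circle_near t s e Hs) as [y [<- Hy]]. apply He, Hy.
Qed.

Lemma continuous_annulus {U : UniformSpace} (f : annulus -> U) :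
  (forall p, continuous (fun q => f (projA q)) p) -> forall x, continuous f x.
Proof.
intros H x P HP. rewrite <- (projA_repr x) in HP.
destruct (H (repr (fst x), snd x) P HP) as [e He]. exists e. intros [s c] [Hs Hc].
simpl in Hs, Hc. destruct (circle_near (fst x) s e Hs) as [y [<- Hy]].
apply (He (y, c)). now split.
Qed.

Lemma cont2_of_pair (G : R * R -> R) :
  (forall p, continuous G p) -> cont2 (fun x y => G (x, y)).
Proof.
intros H. apply cont2_continuous. intros p.
apply (continuous_ext G); [now intros [a b] | apply H].
Qed.

Lemma C1_R2_cont2 (G : R * R -> R) : C1_R2 G ->
  cont2 (fun x y => d1 G (x, y)) /\ cont2 (fun x y => d2 G (x, y)).
Proof. intros [_ [_ [H1 H2]]]. split; now apply cont2_of_pair. Qed.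

Lemma C1_R2_d1 (G : R * R -> R) (x y : R) : C1_R2 G ->
  is_derive (fun t => G (t, y)) x (d1 G (x, y)).
Proof. intros [H _]. apply Derive_correct, H. Qed.

Lemma C1_R2_d2 (G : R * R -> R) (x y : R) : C1_R2 G ->
  is_derive (fun t => G (x, t)) y (d2 G (x, y)).
Proof. intros [_ [H _]]. apply Derive_correct, H. Qed.

(** * Lifted twist maps and their generating functions *)

Lemma generating_generated (f : annulus -> annulus) (F : R * R -> R * R) (S : R * R -> R) :
  is_lift f F -> generating_function F S ->
  generated (fun x y => S (x, y)) (fun x y => d1 S (x, y)) (fun x y => d2 S (x, y))
    (fun x r => fst (F (x, r))) (fun x r => snd (F (x, r))).
Proof.
intros [HF _] [[HS [HS1 HS2]] [Hper [Hco [Hd2 [Hd1 HFS]]]]].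
assert (D1 : forall x y, is_derive (fun t => S (t, y)) x (d1 S (x, y)))
  by (intros; now apply C1_R2_d1).
assert (D2 : forall x y, is_derive (fun t => S (x, t)) y (d2 S (x, y)))
  by (intros; now apply C1_R2_d2).
assert (Hsh : forall (k : R -> R) x l, is_derive k (x + 1) l -> is_derive (fun t => k (t + 1)) x l).
{ intros k x l Hk. replace l with (scal 1 l) by apply Rmult_1_l.
  apply (is_derive_comp k (fun t => t + 1)); auto. auto_derive; auto; ring. }
assert (HFr : forall x r, F (x, r) = (fst (F (x, r)), snd (F (x, r))))
  by (intros; now destruct (F (x, r))).
split; auto.
- apply (C1_R2_cont2 S HS).
- apply (C1_R2_cont2 S HS).
- intros x y. apply eq_trans with (2 := is_derive_unique _ _ _ (D1 x y)). symmetry. apply is_derive_unique.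
  apply (is_derive_ext (fun t => S (t + 1, y + 1))); [intros t; apply Hper|].
  apply (Hsh (fun t => S (t, y + 1))), D1.
- intros x y. apply eq_trans with (2 := is_derive_unique _ _ _ (D2 x y)). symmetry. apply is_derive_unique.
  apply (is_derive_ext (fun t => S (x + 1, t + 1))); [intros t; apply Hper|].
  apply (Hsh (fun t => S (x + 1, t))), D2.
- intros M. destruct (Hco M) as [K HK]. exists (Rmax K 0). intros x y Hxy.
  assert (M1 := Rmax_l K 0). assert (M2 := Rmax_r K 0).
  specialize (HK x y ltac:(lra)).
  apply Rmult_lt_compat_r with (r := Rabs (y - x)) in HK; [|lra].
  replace (S (x, y) / Rabs (y - x) * Rabs (y - x)) with (S (x, y)) in HK by (field; lra).
  exact HK.
- intros x y y' Hy. now apply (proj2 (Hd1 x)).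
- intros x x' y Hx. now apply (proj2 (Hd2 y)).
- apply (cont2_of_pair (fun p => fst (F p))). intros p.
  apply (continuous_comp F fst); [apply HF | apply continuous_fst].
- apply (cont2_of_pair (fun p => snd (F p))). intros p.
  apply (continuous_comp F snd); [apply HF | apply continuous_snd].
- intros x r. exact (proj1 (HFS x r _ _) (HFr x r)).
- intros x y. assert (E := proj2 (HFS x (- d1 S (x, y)) y (d2 S (x, y))) (conj eq_refl eq_refl)).
  now rewrite E.
Qed.

Lemma diffeo_derive_neq_0 (phi : R -> R) (x : R) : C1_diffeo_R phi -> Derive phi x <> 0.
Proof.
intros [[H1 _] [psi [[H2 _] [H3 _]]]] H0.
assert (D := is_derive_comp psi phi x _ _ (Derive_correct _ _ (H2 (phi x)))
  (Derive_correct _ _ (H1 x))).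
assert (D2 : is_derive (fun y => psi (phi y)) x 1).
{ apply (is_derive_ext (fun y => y)); [intros; now rewrite H3 | apply (is_derive_id (K := R_AbsRing))]. }
apply is_derive_unique in D. apply is_derive_unique in D2. rewrite D2, H0 in D.
unfold scal in D; simpl in D. unfold mult in D; simpl in D. lra.
Qed.

Lemma integer_valued_const (f : R -> R) : (forall x, continuous f x) ->
  (forall x, exists k : Z, f x = IZR k) -> forall x y, f x = f y.
Proof.
intros Hc Hz.
assert (K : forall x y, f x < f y -> False).
{ intros x y Hxy. destruct (Hz x) as [k Hk]. destruct (Hz y) as [l Hl].
  assert (Hkl : (k + 1 <= l)%Z) by (rewrite Hk, Hl in Hxy; apply lt_IZR in Hxy; lia).
  apply IZR_le in Hkl. rewrite plus_IZR in Hkl.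
  destruct (IVT_gen f x y (IZR k + 1 / 2)) as [z [_ Ez]].
  - intros t. now apply continuous_pt.
  - rewrite Rmin_left, Rmax_right; lra.
  - destruct (Hz z) as [m Hm]. rewrite Hm in Ez.
    assert (A : IZR k < IZR m) by lra. assert (B : IZR m < IZR (k + 1)) by (rewrite plus_IZR; lra).
    apply lt_IZR in A. apply lt_IZR in B. lia. }
intros x y. destruct (Rtotal_order (f x) (f y)) as [h|[h|h]]; auto; exfalso; eauto.
Qed.

(* Two lifts differ by a deck transformation, so the given lift is C1 as well. *)
Lemma lifts_differ (f : annulus -> annulus) (F F0 : R * R -> R * R) :
  is_lift f F -> is_lift f F0 ->
  exists k, forall x r, fst (F (x, r)) = fst (F0 (x, r)) + k.
Proof.
intros [HF HFf] [HF0 HFf0].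
set (D := fun p => fst (F p) - fst (F0 p)).
assert (HD : forall p, continuous D p).
{ intros p. apply (continuous_minus (fun p => fst (F p)) (fun p => fst (F0 p))).
  - apply (continuous_comp F fst); [apply HF | apply continuous_fst].
  - apply (continuous_comp F0 fst); [apply HF0 | apply continuous_fst]. }
assert (HZ : forall p, exists k : Z, D p = IZR k).
{ intros p. assert (E : projA (F p) = projA (F0 p)) by now rewrite HFf, HFf0.
  apply (f_equal fst) in E. simpl in E. apply proj_eq in E. destruct E as [k Hk].
  exists k. unfold D. lra. }
exists (D (0, 0)). intros x r.
assert (E := integer_valued_const (fun t => D (t * x, t * r))
  ltac:(intros t; apply (continuous_comp (fun t => (t * x, t * r)) D); [|apply HD];
    apply continuous_pair;
    [ apply (continuous_mult (fun t => t) (fun _ => x))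
    | apply (continuous_mult (fun t => t) (fun _ => r)) ];
    first [apply continuous_id | apply continuous_const]) ltac:(intros; apply HZ) 1 0).
simpl in E. rewrite !Rmult_1_l, !Rmult_0_l in E. unfold D in *. lra.
Qed.

(** Monotonicity alone gives the derivatives weak signs; the existence of a C1 inverse excludes the
    value 0. *)
Lemma twist_smooth (f : annulus -> annulus) (F : R * R -> R * R) (S : R * R -> R) :
  symplectic_twist_diffeo f -> is_lift f F -> generating_function F S ->
  exists a b s21 s22,
    smooth_twist (fun x y => S (x, y)) (fun x y => d1 S (x, y)) (fun x y => d2 S (x, y))
      (fun x r => fst (F (x, r))) (fun x r => snd (F (x, r))) a b s21 s22.
Proof.
intros [[[F0 [HF0 [C1 _]]] _] [_ [_ Htw]]] HF HS.
assert (Hgen := generating_generated f F S HF HS).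
destruct HS as [[_ [_ HS2]] [_ [_ [Hd2 _]]]].
destruct (lifts_differ f F F0 HF HF0) as [k Hk].
set (G := fun p => fst (F0 p)).
assert (Ha : forall x r, is_derive (fun z => fst (F (z, r))) x (d1 G (x, r))).
{ intros x r. apply (is_derive_ext (fun z => G (z, r) + k)).
  - intros z. symmetry. apply Hk.
  - replace (d1 G (x, r)) with (plus (d1 G (x, r)) 0) by (unfold plus; simpl; ring).
    apply (is_derive_plus (V := R_NormedModule)); [now apply C1_R2_d1|].
    apply (is_derive_const (V := R_NormedModule)). }
assert (Hb : forall x r, is_derive (fun z => fst (F (x, z))) r (d2 G (x, r))).
{ intros x r. apply (is_derive_ext (fun z => G (x, z) + k)).
  - intros z. symmetry. apply Hk.
  - replace (d2 G (x, r)) with (plus (d2 G (x, r)) 0) by (unfold plus; simpl; ring).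
    apply (is_derive_plus (V := R_NormedModule)); [now apply C1_R2_d2|].
    apply (is_derive_const (V := R_NormedModule)). }
exists (fun x r => d1 G (x, r)), (fun x r => d2 G (x, r)),
  (fun x y => d1 (d2 S) (x, y)), (fun x y => d2 (d2 S) (x, y)).
split; auto; try apply (C1_R2_cont2 _ C1); try apply (C1_R2_cont2 _ HS2).
- intros x r. destruct (Htw F HF x) as [Hdiff Hinc].
  assert (N : d2 G (x, r) <> 0).
  { intros N0. apply (diffeo_derive_neq_0 _ r Hdiff).
    exact (eq_trans (is_derive_unique _ _ _ (Hb x r)) N0). }
  assert (P := incr_derive_nonneg _ _ _ (Hb x r) (fun y h => Rlt_le _ _ (Hinc r y h))).
  destruct P as [P|P]; [exact P | now destruct N].
- intros x y. now apply (C1_R2_d1 (d2 S)).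
- intros x y. now apply (C1_R2_d2 (d2 S)).
- intros x y. destruct (Hd2 y) as [Hdiff Hdec].
  assert (D := C1_R2_d1 (d2 S) x y HS2).
  assert (N : d1 (d2 S) (x, y) <> 0).
  { intros N0. apply (diffeo_derive_neq_0 _ x Hdiff).
    exact (eq_trans (is_derive_unique _ _ _ D) N0). }
  assert (P := incr_derive_nonneg _ _ _ (is_derive_opp _ _ _ D)).
  assert (K : 0 <= - d1 (d2 S) (x, y)).
  { apply P. intros z Hz. apply Ropp_le_contravar, Rlt_le, Hdec, Hz. }
  lra.
Qed.

(* The infimum is attained because [S] is superlinear while the rest of the
   expression grows at most linearly. *)
Lemma weak_kam_calibrated (f : annulus -> annulus) (F : R * R -> R * R) (S : R * R -> R)
    (c a : R) (u : circle -> R) :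
  is_lift f F -> generating_function F S ->
  (forall t, continuous u t) -> weak_kam_equation S c a u ->
  calibrated (fun x y => S (x, y)) (fun t => u (proj t) + c * t) a /\
  forall y, exists x, u (proj y) + c * y = u (proj x) + c * x + S (x, y) + a.
Proof.
intros HF HS Hu Hk. assert (Hgen := generating_generated f F S HF HS).
split.
- intros x y. destruct (Hk y) as [Hlb _].
  specialize (Hlb _ (ex_intro _ x eq_refl)). simpl in Hlb. lra.
- intros y. destruct (Hk y) as [Hlb Hglb].
  assert (Huc : forall x, continuous (fun t => u (proj t)) x).
  { intros x. apply (continuous_comp proj u); [apply continuous_proj | apply Hu]. }
  destruct (periodic_bounded (fun t => u (proj t)) Huc) as [B [HB0 HB]].
  { intros x. now rewrite proj_period. }
  destruct (gn_coercive Hgen (Rabs c + 1)) as [K HK].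
  set (w := fun x => u (proj x) + S (x, y) + c * (x - y) + a).
  set (L := u (proj y)).
  assert (Hw : forall x, continuous w x).
  { intros x. apply (continuous_plus (fun x => u (proj x) + S (x, y) + c * (x - y)) (fun _ => a)).
    2: apply continuous_const.
    apply (continuous_plus (fun x => u (proj x) + S (x, y)) (fun x => c * (x - y))).
    - apply (continuous_plus (fun x => u (proj x)) (fun x => S (x, y))); [apply Huc|].
      exact (derive_continuous _ _ _ (gn_d1 Hgen x y)).
    - apply (continuous_mult (fun _ => c) (fun x => x - y)); [apply continuous_const|].
      apply (continuous_minus (fun x : R => x) (fun _ => y)).
      apply continuous_id. apply continuous_const. }
  (* Coercivity with constant [Rabs c + 1] absorbs the linear term and leaves [Rabs (y - x)], which
     beyond [K'] exceeds [B - a + L + 1]; hence [w] is at least [L + 1] there. *)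
  set (K' := Rmax (Rmax K 0) (B - a + L + 1)).
  assert (M1 := Rmax_l (Rmax K 0) (B - a + L + 1)).
  assert (M2 := Rmax_r (Rmax K 0) (B - a + L + 1)).
  assert (M3 := Rmax_l K 0). assert (M4 := Rmax_r K 0). fold K' in M1, M2.
  assert (Hfar : forall x, K' < Rabs (y - x) -> L + 1 <= w x).
  { intros x Hx. specialize (HK x y ltac:(lra)). specialize (HB x). simpl in HB.
    apply Rabs_le_between in HB.
    assert (Q : Rabs (c * (x - y)) <= Rabs c * Rabs (y - x)).
    { rewrite Rabs_mult, (Rabs_minus_sym x y). lra. }
    apply Rabs_le_between in Q. unfold w. lra. }
  destruct (ab_min w (y - K') (y + K') Hw ltac:(lra)) as [x [_ Hx]].
  exists x.
  assert (A1 : L <= w x).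
  { specialize (Hlb (w x) (ex_intro _ x eq_refl)). exact Hlb. }
  assert (A2 : w x <= L).
  (* If the minimum exceeded [L], then [Rmin (w x) (L + 1)] would be a lower bound larger than the
     infimum. *)
  { apply Rnot_lt_le; intros h.
    assert (Hb : is_lb_Rbar (fun z => exists theta', z =
      u (proj theta') + S (theta', y) + c * (theta' - y) + a) (Rmin (w x) (L + 1))).
    { intros z [x' ->]. simpl. change (Rmin (w x) (L + 1) <= w x').
      destruct (Rlt_dec K' (Rabs (y - x'))) as [k|k].
      - apply Rle_trans with (1 := Rmin_r _ _). now apply Hfar.
      - apply Rle_trans with (1 := Rmin_l _ _). apply Hx.
        apply Rnot_lt_le, Rabs_le_between in k. lra. }
    specialize (Hglb _ Hb). simpl in Hglb. fold L in Hglb.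
    unfold Rmin in Hglb. destruct (Rle_dec (w x) (L + 1)); lra. }
  unfold w, L in *. lra.
Qed.

Arguments proj x : simpl never.

(** * Families of solutions and foliations on the annulus *)

Definition leaf_primitive (u : annulus -> R) (c t : R) : R := u (proj t, c) + c * t.

Lemma weak_kam_family_calibrated (f : annulus -> annulus) (F : R * R -> R * R) (S : R * R -> R)
    (u : annulus -> R) :
  is_lift f F -> generating_function F S -> weak_kam_family S u ->
  exists alpha, forall c, calibrated (fun x y => S (x, y)) (leaf_primitive u c) (alpha c) /\
    forall y, exists x, leaf_primitive u c y = leaf_primitive u c x + S (x, y) + alpha c.
Proof.
intros HF HS [_ [_ Hu]].
assert (K : forall c, exists a, calibrated (fun x y => S (x, y)) (leaf_primitive u c) a /\
  forall y, exists x, leaf_primitive u c y = leaf_primitive u c x + S (x, y) + a).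
{ intros c. destruct (Hu c) as [Hc [a Ha]]. exists a.
  apply (weak_kam_calibrated f F S c a (fun t => u (t, c)) HF HS Hc Ha). }
exact (functional_choice _ K).
Qed.

Lemma leaf_primitive_0 (S : R * R -> R) (u : annulus -> R) (c : R) :
  weak_kam_family S u -> leaf_primitive u c 0 = 0.
Proof. intros [_ [H _]]. unfold leaf_primitive. rewrite H. ring. Qed.

Lemma leaf_primitive_1 (u : annulus -> R) (c t : R) :
  leaf_primitive u c (t + 1) = leaf_primitive u c t + c.
Proof. unfold leaf_primitive. rewrite proj_period. ring. Qed.

Lemma C1_family_lagrangian (f : annulus -> annulus) (F : R * R -> R * R) (S : R * R -> R)
    (u : annulus -> R) :
  is_lift f F -> generating_function F S -> weak_kam_family S u -> C1_annulus_fun u ->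
  let U := fun p => u (projA p) in
  let E := fun c t => c + d1 U (t, c) in
  exists alpha,
    smooth_lagrangian (fun x y => S (x, y)) (fun x y => d1 S (x, y)) (fun x y => d2 S (x, y))
      (fun x r => fst (F (x, r))) (fun x r => snd (F (x, r)))
      E (leaf_primitive u) (fun c t => fst (F (t, E c t))) (fun c t => d2 U (t, c) + t) alpha.
Proof.
intros HF HS Hu HU U E.
assert (Hgen := generating_generated f F S HF HS).
destruct (C1_R2_cont2 U HU) as [HC1 HC2].
assert (HE : cont2 E).
{ apply cont2_plus; [apply cont2_fst|]. exact (cont2_swap (fun t c => d1 U (t, c)) HC1). }
assert (HP : forall c t, is_derive (leaf_primitive u c) t (E c t)).
{ intros c t. replace (E c t) with (plus (d1 U (t, c)) c)
    by (unfold E, plus; simpl; ring).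
  apply (is_derive_plus (fun t => u (proj t, c)) (fun t => c * t)).
  - apply (C1_R2_d1 U t c HU).
  - auto_derive; auto; ring. }
assert (Hh : forall c t, is_derive (fun c' => leaf_primitive u c' t) c (d2 U (t, c) + t)).
{ intros c t. apply (is_derive_plus (fun c => u (proj t, c)) (fun c => c * t)).
  - apply (C1_R2_d2 U t c HU).
  - auto_derive; auto; ring. }
assert (Hper : forall c t, E c (t + 1) = E c t).
{ intros c t. unfold E. f_equal. unfold d1, U; simpl.
  apply eq_trans with (Derive (fun s => u (projA (s + 1, c))) t).
  - unfold Derive. f_equal. apply Lim_ext. intros h.
    now replace (t + h + 1) with (t + 1 + h) by ring.
  - apply Derive_ext. intros s. unfold projA; simpl. now rewrite proj_period. }
destruct (weak_kam_family_calibrated f F S u HF HS Hu) as [alpha Ha].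
assert (Hinv := fun c => C1_solution_invariant (leaf_primitive u c) (E c) (alpha c)
  Hgen (HP c) (fun t => cont2_right E c t HE) (Hper c) (proj1 (Ha c)) (proj2 (Ha c))).
exists alpha. split.
- split; auto.
  + intros c. now apply (leaf_primitive_0 S).
  + intros c t. apply leaf_primitive_1.
  + intros c. apply Hinv.
  + intros c t. apply (proj2 (Hinv c) t).
  + intros c. apply Ha.
  + intros c t. apply (proj2 (Hinv c) t).
- apply cont2_plus; [|apply cont2_snd]. exact (cont2_swap (fun t c => d2 U (t, c)) HC2).
- exact Hh.
Qed.

Lemma lift_proj (f : annulus -> annulus) (F : R * R -> R * R) (t r : R) :
  is_lift f F -> f (proj t, r) = (proj (fst (F (t, r))), snd (F (t, r))).
Proof. intros [_ H]. change (proj t, r) with (projA (t, r)). rewrite <- H. reflexivity. Qed.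

Lemma leaves_foliation (f : annulus -> annulus) (F : R * R -> R * R) (E g : R -> R -> R) :
  is_lift f F -> cont2 E -> (forall c t, E c (t + 1) = E c t) ->
  (forall c c' t, c < c' -> E c t < E c' t) -> (forall t r, exists c, E c t = r) ->
  (forall c, circle_lift (g c)) -> (forall c t, F (t, E c t) = (g c t, E c (g c t))) ->
  invariant_foliation f (fun c t => E c (repr t)).
Proof.
intros HF HE Hper Hinc Honto Hg Hinv.
assert (HEr : forall c t, E c (repr (proj t)) = E c t).
{ intros c t. apply (periodic_repr (E c) t). apply Hper. }
assert (Hinj : forall c c' t, E c t = E c' t -> c = c').
{ intros c c' t. apply (strict_mono_inj (fun c => E c t)); auto. }
split; [|split].
- intros a. apply continuous_circle. intros x.
  apply (continuous_ext (E a)); [intros y; now rewrite HEr | now apply cont2_right].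
- split.
  + apply continuous_annulus. intros p.
    apply (continuous_pair (fun q => fst (projA q))
      (fun q => E (snd (projA q)) (repr (fst (projA q))))).
    * apply (continuous_comp fst proj); [apply continuous_fst | apply continuous_proj].
    * apply (continuous_ext (fun q : R * R => E (snd q) (fst q))).
      { intros [x c]. simpl. symmetry; apply HEr. }
      apply (cont2_comp E); auto. apply continuous_snd. apply continuous_fst.
  + destruct (functional_choice (fun z c => E c (fst z) = snd z)) as [C0 HC0].
    { intros z. apply Honto. }
    set (C := fun t r => C0 (t, r)).
    assert (HC : forall t r, E (C t r) t = r) by (intros t r; apply (HC0 (t, r))).
    clearbody C.
    assert (HCr : forall t r, C (repr (proj t)) r = C t r).
    { intros t r. apply (Hinj _ _ t). rewrite HC, <- HEr. apply HC. }
    exists (fun x => (fst x, C (repr (fst x)) (snd x))). split; [|split].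
    * apply continuous_annulus. intros p.
      apply (continuous_pair (fun q => fst (projA q))
        (fun q => C (repr (fst (projA q))) (snd (projA q)))).
      { apply (continuous_comp fst proj); [apply continuous_fst | apply continuous_proj]. }
      apply (continuous_ext (fun q : R * R => C (fst q) (snd q))).
      { intros [x c]. symmetry; apply HCr. }
      (* The inverse chart sends a height to the parameter of its leaf, the root of an increasing
         function, and roots depend continuously on the point. *)
      apply (implicit_continuous (fun (q : R * R) c => E c (fst q) - snd q)).
      { intros c. apply (continuous_minus (fun q : R * R => E c (fst q)) (fun q => snd q)).
        - apply (continuous_comp fst (E c)); [apply continuous_fst | now apply cont2_right].
        - apply continuous_snd. }
      { intros q c c' Hc. apply Rplus_lt_compat_r, Hinc, Hc. }
      { intros q. apply Rminus_diag_eq, HC. }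
    * intros [t c]. simpl. f_equal. apply (Hinj _ _ (repr t)), HC.
    * intros [t r]. simpl. f_equal. apply HC.
- intros c [t r]. unfold graph; simpl. split.
  + intros ->. destruct (cl_surj (g c) (repr t) (Hg c)) as [x Hx].
    exists (proj x, E c x). split; [symmetry; apply HEr|].
    rewrite (lift_proj f F) by auto. rewrite Hinv; simpl. now rewrite Hx, proj_repr.
  + intros [[t' r'] [Hr Hf]]. simpl in Hr. subst r'.
    rewrite <- (proj_repr t') in Hf at 1.
    rewrite (lift_proj f F), Hinv in Hf by auto. simpl in Hf.
    injection Hf as <- <-. symmetry. apply HEr.
Qed.

(** The pair [(0, 1)] moves to [(x, y)] along a segment of pairs that never meets the diagonal, so
    by injectivity the difference of the two values keeps its sign. *)
Lemma injective_same_direction (A : R -> R) : (forall x, continuous A x) ->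
  (forall x y, A x = A y -> x = y) -> A 0 < A 1 -> forall x y, x < y -> A x < A y.
Proof.
intros Hc Hi H01 x y Hxy.
apply Rnot_le_lt; intros h.
destruct (ivt (fun s => A (s * x) - A ((1 - s) + s * y)) 0 1 0) as [s [Hs Es]].
- intros s. apply (continuous_minus (fun s => A (s * x)) (fun s => A ((1 - s) + s * y))).
  + apply (continuous_comp (fun s => s * x) A); [|apply Hc].
    exact (derive_continuous (fun s => s * x) s x ltac:(auto_derive; auto; ring)).
  + apply (continuous_comp (fun s => (1 - s) + s * y) A); [|apply Hc].
    exact (derive_continuous (fun s => (1 - s) + s * y) s (y - 1) ltac:(auto_derive; auto; ring)).
- lra.
- rewrite !Rmult_0_l, !Rmult_1_l. replace (1 - 0 + 0) with 1 by ring.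
  replace (1 - 1 + y) with y by ring. lra.
- cbv beta in Es. assert (E : s * x = 1 - s + s * y) by (apply Hi, Rminus_diag_uniq, Es).
  assert (0 <= s * (y - x)) by (apply Rmult_le_pos; lra).
  assert (s = 1) as -> by lra. lra.
Qed.

(** The chart of the foliation may index the leaves downwards. The sign of [E0 1 - E0 0], constant
    on the circle, decides; in the decreasing case [a] is replaced by [- a]. *)
Lemma foliation_leaves (f : annulus -> annulus) (F : R * R -> R * R) (S : R * R -> R)
    (eta : R -> circle -> R) :
  is_lift f F -> generating_function F S -> invariant_foliation f eta ->
  exists E P g alpha,
    lagrangian (fun x y => S (x, y)) (fun x y => d1 S (x, y)) (fun x y => d2 S (x, y))
      (fun x r => fst (F (x, r))) (fun x r => snd (F (x, r))) E P g alpha /\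
    (forall c c' t, c < c' -> E c t < E c' t) /\ (forall t r, exists c, E c t = r) /\
    (forall c, exists a, forall t, E c t = eta a (proj t)).
Proof.
intros HF HS [_ [[Hc [G [HGc [HG1 HG2]]]] Hinv]].
assert (Hgen := generating_generated f F S HF HS).
set (E0 := fun a t => eta a (proj t)). set (A0 := fun r t => snd (G (proj t, r))).
assert (HE0 : cont2 E0).
{ apply (cont2_swap (fun t a => E0 a t)).
  apply (cont2_of_pair (fun p => snd (fst (projA p), eta (snd (projA p)) (fst (projA p))))).
  intros p.
  apply (continuous_comp (fun p => (fst (projA p), eta (snd (projA p)) (fst (projA p)))) snd);
    [|apply continuous_snd].
  apply (continuous_comp projA (fun x => (fst x, eta (snd x) (fst x))));
    [apply continuous_projA | apply Hc]. }
assert (HA0 : cont2 A0).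
{ apply (cont2_swap (fun t r => A0 r t)). apply (cont2_of_pair (fun p => snd (G (projA p)))).
  intros p. apply (continuous_comp (fun p => G (projA p)) snd); [|apply continuous_snd].
  apply (continuous_comp projA G); [apply continuous_projA | apply HGc]. }
assert (HEA : forall r t, E0 (A0 r t) t = r).
{ intros r t. assert (Q := HG2 (proj t, r)). simpl in Q.
  destruct (G (proj t, r)) as [t' a] eqn:EG. simpl in Q. injection Q as -> Q2.
  unfold E0, A0. rewrite EG. exact Q2. }
assert (HAE : forall a t, A0 (E0 a t) t = a).
{ intros a t. unfold A0, E0. assert (Q := HG1 (proj t, a)). simpl in Q. now rewrite Q. }
assert (Hper : forall a t, E0 a (t + 1) = E0 a t).
{ intros a t. unfold E0. now rewrite proj_period. }
assert (Hin : forall a t, snd (F (t, E0 a t)) = E0 a (fst (F (t, E0 a t)))).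
{ intros a t. assert (Q := proj2 (Hinv a (f (proj t, E0 a t)))).
  unfold graph in Q. rewrite (lift_proj f F) in Q by auto. simpl in Q. apply Q.
  exists (proj t, E0 a t). split; [reflexivity|]. now apply lift_proj. }
assert (Hinj : forall t a a', E0 a t = E0 a' t -> a = a').
{ intros t a a' H. now rewrite <- (HAE a t), <- (HAE a' t), H. }
destruct (IVT_sign (fun t => E0 1 t - E0 0 t)) as [Hs|Hs].
{ intros t. apply (continuous_minus (E0 1) (E0 0)); now apply cont2_right. }
{ intros t H. assert (1 = 0); [|lra]. apply (Hinj t). lra. }
- destruct (leaves_lagrangian E0 A0 Hgen HE0 HA0 Hper HEA) as [E [P [g [al K]]]].
  + intros a a' t Ha. apply (injective_same_direction (fun a => E0 a t)); auto.
    * intros x. now apply cont2_left.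
    * intros x y. apply Hinj.
    * specialize (Hs t). simpl in Hs. lra.
  + exact Hin.
  + now exists E, P, g, al.
- destruct (leaves_lagrangian (fun a t => E0 (- a) t) (fun r t => - A0 r t) Hgen)
    as [E [P [g [al [K1 [K2 [K3 K4]]]]]]].
  + apply (cont2_comp2 E0 (fun a _ => - a) (fun _ t => t) HE0); [|apply cont2_snd].
    apply cont2_opp, cont2_fst.
  + now apply cont2_opp.
  + intros a t. apply Hper.
  + intros r t. rewrite Ropp_involutive. apply HEA.
  + intros a a' t Ha.
    (* The orientation lemma compares values at 0 and 1; the reparametrisation [1 - a] exchanges
       these two labels. *)
    replace (- a) with (1 - (1 + a)) by ring. replace (- a') with (1 - (1 + a')) by ring.
    apply (injective_same_direction (fun a => E0 (1 - a) t)); try lra.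
    * intros x. apply (continuous_comp (fun a => 1 - a) (fun a => E0 a t)).
      { exact (derive_continuous (fun a => 1 - a) x (-1) ltac:(auto_derive; auto; ring)). }
      now apply cont2_left.
    * intros x y H. apply Hinj in H. lra.
    * specialize (Hs t). simpl in Hs. replace (1 - 0) with 1 by ring.
      replace (1 - 1) with 0 by ring. lra.
  + intros a t. apply Hin.
  + exists E, P, g, al. split; [exact K1|]. split; [exact K2|]. split; [exact K3|].
    intros c. destruct (K4 c) as [a Ha]. exists (- a). exact Ha.
Qed.

(* Uniqueness on the dense set of periodic leaves extends by continuity in [c]. *)
Lemma family_on_leaves (f : annulus -> annulus) (F : R * R -> R * R) (S : R * R -> R)
    (v : annulus -> R) (E P g : R -> R -> R) (alpha : R -> R) (c t : R) :
  is_lift f F -> generating_function F S -> weak_kam_family S v ->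
  lagrangian (fun x y => S (x, y)) (fun x y => d1 S (x, y)) (fun x y => d2 S (x, y))
      (fun x r => fst (F (x, r))) (fun x r => snd (F (x, r))) E P g alpha ->
  (forall c c' t, c < c' -> E c t < E c' t) -> (forall t r, exists c, E c t = r) ->
  leaf_primitive v c t = P c t.
Proof.
intros HF HS Hv HL Hinc Honto.
assert (HA := lagrangian_family HL).
destruct (weak_kam_family_calibrated f F S v HF HS Hv) as [a Ha].
assert (Hvc := proj1 Hv).
assert (Hbase : forall x, 0 <= x <= 1 -> leaf_primitive v c x = P c x).
{ intros x Hx. apply NNPP. intros Hne.
  set (D := fun k => leaf_primitive v k x - P k x).
  assert (HD : forall k, continuous D k).
  { intros k. apply (continuous_minus (fun k => leaf_primitive v k x) (fun k => P k x)).
    - apply (continuous_plus (fun k => v (proj x, k)) (fun k => k * x)).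
      + apply (continuous_comp (fun k => (proj x, k)) v); [|apply Hvc].
        apply continuous_pair; [apply continuous_const | apply continuous_id].
      + exact (derive_continuous (fun k => k * x) k x ltac:(auto_derive; auto; ring)).
    - apply (primitive_param_continuous E P k x (fam_E HA) (fam_P0 HA)
        (fam_P HA) Hx). }
  assert (Hp : 0 < Rabs (D c)) by (apply Rabs_pos_lt; unfold D; lra).
  destruct (proj1 (continuous_eps D c) (HD c) _ Hp) as [d [Hd H]].
  destruct (periodic_leaves_dense (c - d) (c + d) HL Hinc ltac:(lra))
    as [k [q [p [y [Hk [Hq Hy]]]]]].
  specialize (H k ltac:(abs_lra)).
  assert (E0 : leaf_primitive v k x = P k x).
  { apply (periodic_leaf_unique k (a k) q p (leaf_primitive v k) HL Hq).
    - intros z. apply (fol_per_of_leaves k q p y z HL Hinc Honto Hq Hy).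
    - intros z. apply (continuous_plus (fun z => v (proj z, k)) (fun z => k * z)).
      + apply (continuous_comp (fun z => (proj z, k)) v); [|apply Hvc].
        apply continuous_pair; [apply continuous_proj | apply continuous_const].
      + exact (derive_continuous (fun z => k * z) z k ltac:(auto_derive; auto; ring)).
    - now apply (leaf_primitive_0 S).
    - intros z. apply leaf_primitive_1.
    - apply Ha.
    - apply Ha. }
  replace (D k) with 0 in H by (unfold D; lra).
  rewrite Rminus_0_l, Rabs_Ropp in H. lra. }
destruct (periodic_shift_unit (fun t => leaf_primitive v c t - P c t) t) as [x [Hx [Ex _]]].
- intros y. rewrite leaf_primitive_1, (fam_P1 HA). ring.
- simpl in Ex. rewrite Hbase in Ex by lra. lra.
Qed.

Lemma foliated_C1_annulus_fun (u : annulus -> R) {E P g} (h : R -> R -> R) {alpha} :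
  family E P g alpha -> cont2 h -> (forall c x, is_derive (fun c' => P c' x) c (h c x)) ->
  (forall c t, leaf_primitive u c t = P c t) -> C1_annulus_fun u.
Proof.
intros HA Hhc Hh Hu.
assert (Eu : forall p, u (projA p) = P (snd p) (fst p) - snd p * fst p).
{ intros [t c]. simpl. rewrite <- Hu. unfold leaf_primitive, projA; simpl. ring. }
assert (D1 : forall t c, is_derive (fun t => u (projA (t, c))) t (E c t - c)).
{ intros t c. apply (is_derive_ext (fun t => P c t - c * t)).
  - intros z. now rewrite Eu.
  - apply (is_derive_minus (P c) (fun t => c * t)); [apply (fam_P HA)|].
    auto_derive; auto; ring. }
assert (D2 : forall t c, is_derive (fun c => u (projA (t, c))) c (h c t - t)).
{ intros t c. apply (is_derive_ext (fun c => P c t - c * t)).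
  - intros z. now rewrite Eu.
  - apply (is_derive_minus (fun c => P c t) (fun c => c * t)); [apply Hh|].
    auto_derive; auto; ring. }
split; [|split; [|split]].
- intros t c. exists (E c t - c). apply D1.
- intros t c. exists (h c t - t). apply D2.
- intros p. apply (continuous_ext (fun q => E (snd q) (fst q) - snd q)).
  + intros [t c]. symmetry. apply is_derive_unique, D1.
  + apply (continuous_minus (fun q : R * R => E (snd q) (fst q)) (fun q => snd q));
      [|apply continuous_snd].
    apply (cont2_comp E); [apply (fam_E HA) | apply continuous_snd | apply continuous_fst].
- intros p. apply (continuous_ext (fun q => h (snd q) (fst q) - fst q)).
  + intros [t c]. symmetry. apply is_derive_unique, D2.
  + apply (continuous_minus (fun q : R * R => h (snd q) (fst q)) (fun q => fst q));
      [|apply continuous_fst].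
    apply (cont2_comp h); [exact Hhc | apply continuous_snd | apply continuous_fst].
Qed.

Theorem theorem1p3 (f : annulus -> annulus) (F : R * R -> R * R)
    (S : R * R -> R) (u : annulus -> R)
    (hf : symplectic_twist_diffeo f)
    (hF : is_lift f F)
    (hS : generating_function F S)
    (hu : weak_kam_family S u) :
  (C0_integrable f <-> C1_annulus_fun u) /\
  (C0_integrable f ->
     (forall v : annulus -> R, weak_kam_family S v -> forall x, v x = u x) /\
     (forall c : R,
        (forall eta, invariant_foliation f eta ->
           leaf eta (graph (fun t => c + du_dtheta u (t, c)))) /\
        (exists rho : R, forall t : circle,
           h_map u c (projected_dynamics f u c t) = rot rho (h_map u c t)))).
Proof.
destruct (twist_smooth f F S hf hF hS) as [a [b [s21 [s22 Hst]]]].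
assert (HC1 : C0_integrable f -> C1_annulus_fun u).
{ intros [eta Heta].
  destruct (foliation_leaves f F S eta hF hS Heta) as [E [P [g [alpha [HL [Hinc [Hon _]]]]]]].
  destruct (foliated_C1
    (lagrangian_foliated Hst HL Hinc Hon)) as [h [Hhc Hh]].
  apply (foliated_C1_annulus_fun u h (lagrangian_family HL) Hhc Hh).
  intros c t. now apply (family_on_leaves f F S u E P g alpha). }
split; [split; [exact HC1|]|].
- intros HU. destruct (C1_family_lagrangian f F S u hF hS hu HU) as [alpha Hsl].
  set (U := fun p => u (projA p)) in *. set (E := fun c t => c + d1 U (t, c)) in *.
  assert (HL := sl_lg Hsl).
  assert (HA := lagrangian_family HL).
  exists (fun c t => E c (repr t)).
  apply (leaves_foliation f F E (fun c t => fst (F (t, E c t)))); auto.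
  + apply (fam_E HA).
  + intros c t. apply (fam_E_per c t HA).
  + intros c c' t. apply (leaves_increasing c c' t Hsl).
  + intros t r. apply (leaves_exhaust t r Hsl).
  + apply (fam_cl HA).
  + intros c t.
    rewrite <- (lg_F2 HL c t : snd (F (t, E c t)) = E c (fst (F (t, E c t)))).
    apply surjective_pairing.
- intros HI. assert (HU := HC1 HI). split.
  (* Both families have as primitives those of the leaves of one and the same foliation. *)
  + intros v hv x. destruct HI as [eta Heta].
    destruct (foliation_leaves f F S eta hF hS Heta) as [E [P [g [alpha [HL [Hinc [Hon _]]]]]]].
    assert (A := family_on_leaves f F S v E P g alpha (snd x) (repr (fst x)) hF hS hv HL Hinc Hon).
    assert (B := family_on_leaves f F S u E P g alpha (snd x) (repr (fst x)) hF hS hu HL Hinc Hon).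
    unfold leaf_primitive in A, B. rewrite proj_repr in A, B.
    destruct x as [t c]. simpl in A, B. lra.
  + intros c. split.
    * intros eta Heta.
      destruct (foliation_leaves f F S eta hF hS Heta) as [E [P [g [alpha [HL [Hinc [Hon Hl]]]]]]].
      destruct (Hl c) as [k Hk]. exists k. intros [t r]. unfold graph; simpl.
      assert (K : c + du_dtheta u (t, c) = eta k t).
      { rewrite <- (proj_repr t) at 2. rewrite <- Hk.
        assert (D : is_derive (fun x => u (projA (x, c))) (repr t) (E c (repr t) - c)).
        { apply (is_derive_ext (fun x => P c x - c * x)).
          - intros x. rewrite <- (family_on_leaves f F S u E P g alpha c x hF hS hu HL Hinc Hon).
            unfold leaf_primitive, projA; simpl. ring.
          - apply (is_derive_minus (P c) (fun x => c * x)); [apply (lg_P HL)|].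
            auto_derive; auto; ring. }
        apply is_derive_unique in D. unfold du_dtheta, d1; simpl. simpl in D. lra. }
      rewrite K. reflexivity.
    * destruct (C1_family_lagrangian f F S u hF hS hu HU) as [alpha Hsl].
      destruct (semiconjugacy Hsl) as [rho Hrho].
      exists (rho c). intros t.
      set (U := fun p => u (projA p)) in *.
      (* Replacing [y] by the representative of its class changes [d2 U (y, c) + y] by an integer,
         so the lifted semi-conjugation descends to the circle. *)
      assert (Hh : forall y, h_map u c (proj y) = proj (d2 U (y, c) + y)).
      { intros y. unfold h_map, rot. apply proj_eq. destruct (repr_proj y) as [k Hk].
        exists (- k)%Z. rewrite opp_IZR.
        change (du_dc u (proj y, c)) with (d2 U (y, c)). lra. }
      specialize (Hrho c (repr t)). simpl in Hrho.
      unfold projected_dynamics.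
      change (c + du_dtheta u (t, c)) with (c + d1 U (repr t, c)).
      rewrite <- (proj_repr t) at 1. rewrite (lift_proj f F) by auto. simpl fst.
      rewrite Hh, Hrho.
      assert (Et := Hh (repr t)). rewrite proj_repr in Et. rewrite Et. unfold rot.
      apply proj_eq. destruct (repr_proj (d2 U (repr t, c) + repr t)) as [k Hk].
      exists k. lra.
Qed.
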